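(* Let $\Omega$ be a bounded domain in the $n$-dimensional Euclidean space $\mathbf{R}^n$, and let $0<\Gamma_1\leq\Gamma_2\leq\cdots\leq\Gamma_k\leq\cdots\to+\infty$ be the eigenvalues (repeated according to multiplicity) of the clamped plate problem $$\Delta^2 u=\Gamma u \ \text{ in } \Omega,\qquad u=\frac{\partial u}{\partial \nu}=0 \ \text{ on } \partial\Omega .$$ Then for every integer $k\geq 1$, $$ \begin{aligned} \frac{1}{k}\sum_{j=1}^k\Gamma_j\geq{}& \frac{n}{n+4}\,\frac{16\pi^4}{\big(B_nV(\Omega)\big)^{\frac{4}{n}}}\,k^{\frac{4}{n}}\\ &+\left(\frac{n+2}{12n(n+4)}-\frac{1}{1152n^2(n+4)}\right)\frac{V(\Omega)}{I(\Omega)}\,\frac{n}{n+2}\,\frac{4\pi^2}{\big(B_nV(\Omega)\big)^{\frac{2}{n}}}\,k^{\frac{2}{n}}\\ &+\left(\frac{1}{576n(n+4)}-\frac{1}{27648n^2(n+2)(n+4)}\right)\left(\frac{V(\Omega)}{I(\Omega)}\right)^2 . \end{aligned} $$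
   Context: $\Delta$ is the Laplacian on $\mathbf{R}^n$, $\Delta^2=\Delta\circ\Delta$, and $\nu$ is the outward unit normal to $\partial\Omega$. The clamped plate problem has a real discrete spectrum, each eigenvalue having finite multiplicity and being listed as many times as its multiplicity. $V(\Omega)$ denotes the volume of $\Omega$, $B_n$ the volume of the unit ball in $\mathbf{R}^n$, and $I(\Omega)=\min_{a\in\mathbf{R}^n}\int_\Omega|x-a|^2\,dx$ is the moment of inertia of $\Omega$. *)

(* Defs.v *)
From HB Require Import structures.
From mathcomp Require Import all_boot all_order all_algebra.
From mathcomp Require Import all_classical all_reals all_analysis.

Set Implicit Arguments.
Unset Strict Implicit.
Unset Printing Implicit Defensive.

Import Order.TTheory GRing.Theory Num.Theory.
Import numFieldNormedType.Exports.

Local Open Scope classical_set_scope.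
Local Open Scope ring_scope.

Definition measure_rV_display : measure_display -> measure_display.
Proof. exact. Qed.

(* The sigma-algebra on row vectors generated by the coordinate functions; on
   'rV[R]_n with R : realType this is the Borel sigma-algebra of R^n. *)
Section measurable_rV.
Context {d} {T : sigmaRingType d}.
Variable n : nat.

Let coords : 'I_n -> 'rV[T]_n -> T := fun i x => x ord0 i.

Let rV_set0 : g_sigma_preimage coords set0.
Proof. exact: sigma_algebra0. Qed.

Let rV_setC A : g_sigma_preimage coords A -> g_sigma_preimage coords (~` A).
Proof. exact: sigma_algebraC. Qed.

Let rV_bigcup (F : _^nat) : (forall i, g_sigma_preimage coords (F i)) ->
  g_sigma_preimage coords (\bigcup_i (F i)).
Proof. exact: sigma_algebra_bigcup. Qed.

HB.instance Definition _ := @isMeasurable.Build (measure_rV_display d)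
  'rV[T]_n (g_sigma_preimage coords) rV_set0 rV_setC rV_bigcup.

End measurable_rV.

Lemma measurable_coord d (T : sigmaRingType d) n (i : 'I_n) :
  measurable_fun [set: 'rV[T]_n] (fun x : 'rV[T]_n => x ord0 i).
Proof.
move=> _ Y mY; rewrite setTI; apply: sub_sigma_algebra => /=.
rewrite -bigcup_seq/=; exists i => /=; first by rewrite mem_index_enum.
by exists Y => //; rewrite setTI.
Qed.

Lemma measurable_fun_rV d1 d2 (T1 : measurableType d1) (T2 : measurableType d2)
    n (f : T1 -> 'rV[T2]_n) :
  (forall i, measurable_fun [set: T1] (fun x => f x ord0 i)) ->
  measurable_fun [set: T1] f.
Proof.
move=> mf.
have H : g_sigma_preimage (fun i => (fun v : 'rV[T2]_n => v ord0 i) \o f)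
    `<=` measurable.
  apply: smallest_sub; first exact: sigma_algebra_measurable.
  case: n => [|n] in f mf *; first by rewrite big_ord0.
  rewrite -bigcup_mkord_ord; apply: bigcup_sub => i Ii.
  by move=> A [B mB <-]; exact: mf.
by move=> _ A mA; apply: H; rewrite g_sigma_preimage_comp; exists A.
Qed.

Section lebesgue_measure_rV.
Variable R : realType.

Definition cons_rV n (p : R * 'rV[R]_n) : 'rV[R]_n.+1 :=
  \row_i oapp (p.2 ord0) p.1 (unlift ord0 i).

Definition uncons_rV n (v : 'rV[R]_n.+1) : R * 'rV[R]_n :=
  (v ord0 ord0, \row_i v ord0 (lift ord0 i)).

Lemma cons_rVK n : cancel (@cons_rV n) (@uncons_rV n).
Proof.
move=> [a w]; congr pair; first by rewrite mxE unlift_none.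
by apply/rowP => i; rewrite !mxE liftK.
Qed.

Lemma measurable_cons_rV n : measurable_fun setT (@cons_rV n).
Proof.
apply: measurable_fun_rV => i; under eq_fun do rewrite mxE.
case: (unliftP ord0 i) => [j _|_] /=; last exact: measurable_fst.
exact: (measurableT_comp (measurable_coord j) measurable_snd).
Qed.

Lemma measurable_uncons_rV n : measurable_fun setT (@uncons_rV n).
Proof.
apply/measurable_fun_pairP; split; first exact: measurable_coord.
apply: measurable_fun_rV => i.
under eq_fun do rewrite mxE.
exact: measurable_coord.
Qed.

Section lebesgue_cons.
Local Open Scope ereal_scope.
Variables (n : nat) (m : {sigma_finite_measure set 'rV[R]_n -> \bar R}).

Definition lebesgue_cons : set 'rV[R]_n.+1 -> \bar R :=
  pushforward (@lebesgue_measure R \x m) (@cons_rV n).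

Let lebesgue_cons0 : lebesgue_cons set0 = 0.
Proof. by rewrite /lebesgue_cons /pushforward preimage_set0 measure0. Qed.

Let lebesgue_cons_ge0 A : 0 <= lebesgue_cons A.
Proof. by rewrite /lebesgue_cons /pushforward; exact: measure_ge0. Qed.

Let lebesgue_cons_sigma_additive : semi_sigma_additive lebesgue_cons.
Proof.
have mC A : measurable A -> measurable (@cons_rV n @^-1` A).
  by move=> mA; rewrite -[X in measurable X]setTI; exact: measurable_cons_rV.
move=> F mF tF mUF; rewrite /lebesgue_cons /pushforward preimage_bigcup.
apply: measure_semi_sigma_additive.
- by move=> k; exact: mC.
- apply/trivIsetP => /= i j _ _ ij; rewrite -preimage_setI.
  by move/trivIsetP : tF => /(_ _ _ _ _ ij) ->//; rewrite preimage_set0.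
- by rewrite -preimage_bigcup; exact: mC.
Qed.

HB.instance Definition _ := isMeasure.Build _ _ _ lebesgue_cons
  lebesgue_cons0 lebesgue_cons_ge0 lebesgue_cons_sigma_additive.

Let lebesgue_cons_sigma_finite : sigma_finite setT lebesgue_cons.
Proof.
have /sigma_finiteP[F [TF ndF Foo]] := sigma_finiteT (@lebesgue_measure R).
have /sigma_finiteP[G [TG ndG Goo]] := sigma_finiteT m.
have mFG k : measurable (F k `*` G k).
  by apply: measurableX; [have [] := Foo k|have [] := Goo k].
exists (fun k => @uncons_rV n @^-1` (F k `*` G k)).
  apply/seteqP; split=> // x _.
  have [i _ Fi] : (\bigcup_i F i) (uncons_rV x).1 by rewrite -TF.
  have [j _ Gj] : (\bigcup_i G i) (uncons_rV x).2 by rewrite -TG.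
  exists (maxn i j) => //; split.
    by move: Fi; exact/subsetPset/ndF/leq_maxl.
  by move: Gj; exact/subsetPset/ndG/leq_maxr.
move=> k; split.
  rewrite -[X in measurable X]setTI; apply: measurable_uncons_rV => //; exact: mFG.
rewrite /lebesgue_cons /pushforward -comp_preimage.
rewrite (_ : _ \o _ = id); last by apply/funext => x; exact: cons_rVK.
have [? ?] := Foo k; have [? ?] := Goo k.
by rewrite preimage_id product_measure1E// lte_mul_pinfty// ge0_fin_numE.
Qed.

HB.instance Definition _ := Measure_isSigmaFinite.Build _ _ _ lebesgue_cons
  lebesgue_cons_sigma_finite.

End lebesgue_cons.

(* n-dimensional Lebesgue measure, as an iterated product measure. *)
Fixpoint lebesgue_rV (n : nat) : {sigma_finite_measure set 'rV[R]_n -> \bar R} :=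
  match n with
  | 0 => @dirac _ 'rV[R]_0 0 R
  | n'.+1 => lebesgue_cons (lebesgue_rV n')
  end.

End lebesgue_measure_rV.

Section clamped_plate.
Variables (R : realType) (n : nat).
Local Notation V := 'rV[R]_n.
Local Notation mu := (lebesgue_rV R n).
Implicit Types (Om : set V) (f u : V -> R) (s : seq 'I_n).

(* The library norm on 'rV[R]_n is the sup norm; this is the square of the
   Euclidean one. *)
Definition sqr_enorm (x : V) : R := \sum_(i < n) x ord0 i ^+ 2.

Definition is_domain Om := [/\ open Om, connected Om & Om !=set0].

Definition volume (A : set V) : R := fine (mu A).

Definition unit_ball_volume : R := volume [set x : V | sqr_enorm x < 1].

(* For a bounded domain the infimum is a minimum, attained at the centre of
   mass. *)
Definition moment_of_inertia Om : R :=
  inf (range (fun a : V => \int[mu]_(x in Om) sqr_enorm (x - a))).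

Definition partial (i : 'I_n) f : V -> R := 'D_(delta_mx ord0 i) f.

(* partials [:: i1; ...; ik] f = d_i1 (... (d_ik f)) *)
Definition partials s f : V -> R := foldr partial f s.

Definition laplacian f : V -> R := fun x => \sum_(i < n) partial i (partial i f) x.

Definition smooth f := forall s,
  continuous (partials s f) /\
  forall i x, derivable (partials s f) x (delta_mx ord0 i).

(* C_c^oo(Om) *)
Definition test_fun Om f :=
  [/\ smooth f, compact (closure [set x | f x != 0])
    & closure [set x | f x != 0] `<=` Om].

(* L^2(Om); functions represent their class modulo a.e. equality on Om, and
   their values outside Om are irrelevant. *)
Definition L2 Om u := u \_ Om \in Lfun mu 2%:E.

Definition L2_norm Om u : \bar R := 'N[mu]_2%:E[EFin \o (u \_ Om)].

Definition weak_partials Om s u g := forall f, test_fun Om f ->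
  \int[mu]_(x in Om) (u x * partials s f x) =
  (-1) ^+ size s * \int[mu]_(x in Om) (g x * f x).

(* H^2_0(Om), the closure of C_c^oo(Om) in H^2(Om); D s is the weak derivative
   of u of order s (D [::] = u a.e.). *)
Definition H20 Om u := L2 Om u /\
  exists2 D : seq 'I_n -> V -> R,
    forall s, (size s <= 2)%N -> L2 Om (D s) /\ weak_partials Om s u (D s) &
    exists2 f : nat -> V -> R, forall m, test_fun Om (f m) &
      forall s, (size s <= 2)%N ->
        L2_norm Om (partials s (f m) \- D s) @[m --> \oo] --> 0%E.

(* u is a solution of Delta^2 u = lam u in Om (in the sense of distributions)
   with u = du/dnu = 0 on the boundary (i.e., u in H^2_0(Om)). *)
Definition clamped_plate_solution Om (lam : R) u := H20 Om u /\
  forall f, test_fun Om f ->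
    \int[mu]_(x in Om) (u x * laplacian (laplacian f) x) =
    lam * \int[mu]_(x in Om) (u x * f x).

(* The solution space for lam has dimension m in L^2(Om); lam is an eigenvalue
   iff m > 0. *)
Definition multiplicity Om (lam : R) (m : nat) :=
  exists e : 'I_m -> V -> R,
  [/\ forall i, clamped_plate_solution Om lam (e i),
      forall c : 'I_m -> R,
        {ae mu, forall x, Om x -> \sum_(i < m) c i * e i x = 0} ->
        forall i, c i = 0
    & forall u, clamped_plate_solution Om lam u -> exists c : 'I_m -> R,
        {ae mu, forall x, Om x -> u x = \sum_(i < m) c i * e i x}].

(* Gam is the nondecreasing enumeration, with multiplicities, of all the
   eigenvalues; the enumeration starts at index 0. *)
Definition clamped_plate_spectrum Om (Gam : nat -> R) :=
  [/\ 0 < Gam 0, nondecreasing_seq Gam, Gam j @[j --> \oo] --> +oo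
    & forall lam : R, exists2 m, multiplicity Om lam m &
        ([set j | Gam j = lam] #= `I_m)%card].

End clamped_plate.

(* Main.v *)
Require Import Defs.
From HB Require Import structures.
From mathcomp Require Import all_boot all_order all_algebra.
From mathcomp Require Import all_classical all_reals all_analysis.
From mathcomp Require Import measurable_realfun ring lra zify.

Set Implicit Arguments.
Unset Strict Implicit.
Unset Printing Implicit Defensive.

Import Order.TTheory GRing.Theory Num.Theory.
Import numFieldNormedType.Exports.

Local Open Scope classical_set_scope.
Local Open Scope ring_scope.

(** Let w_0, ..., w_(k-1) be an orthonormal family of eigenfunctions for Gam 0, ...,
Gam (k-1), extended by 0 outside Om, and let F(z) be (2 pi)^-n times the sum of
the squared moduli of their Fourier transforms at z. By Plancherel's theorem F
has mass at least k [eigenfun_plancherel]; the Laplacian acts on the Fourier side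
as multiplication by - |z|^2, so that the integral of |z|^4 F is at most the sum of
the Gam j [eigenfun_quartic_le]. It remains to bound this fourth moment from below.

Two properties of F are used. Bessel's inequality for plane waves restricted to
Om gives F <= M with M = V(Om) / (2 pi)^n [sum_fpower_le]. Applied to the difference
of two plane waves centred at a, and followed by the infimum over a, it shows that
F is Lipschitz with constant L = 2 (2 pi)^-n sqrt (V(Om) I(Om))
[sum_fpower_lipschitz].

Among densities below M with mass k, the one concentrated on a ball, of radius rho
with M B rho^n = k, has the least fourth moment, n / (n + 4) k rho^4: this is the
leading term. A Lipschitz density cannot jump at |z| = rho. Quantitatively, for a
dilation factor s > 1 and |z| < rho, the mass M - F(z) missing at z and the mass
F(s z) present at s z add up to at least M - L (s - 1) rho; integrating this against
a suitable weight gives a gain over the ball [quartic_moment_lb]. For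
s = 1 + 2 e / 3 with e = M / (L rho) the gain is at least a multiple of
e^2 / 3 + e^4 / 36 [gain_lb], and as e^2 rho^2 = V(Om) / (4 I(Om)) these are the second
and third terms of the bound, without their negative corrections. The numerical
estimates need e^2 <= 1 / 3, which holds because the moment of inertia is at least
that of a ball of the same volume [inertia_radius_le].

The orthonormal family exists because multiplicities count dimensions of solution
spaces and solutions for distinct eigenvalues are orthogonal [orthonormal_eigenfuns].
Passing from a solution to its approximation by test functions requires
that only 0 is orthogonal to all test functions; this too is contained in the
hypothesis on the spectrum [spectrum_tests_total]. *)

(** * Lebesgue measure on row vectors *)
Section ge0_real_integrals.
Context d (T : measurableType d) (R : realType) (m : {measure set T -> \bar R}).
Implicit Types f g : T -> R.

Lemma integral_EFin_ge0 f : (forall x, 0 <= f x) -> (0 <= \int[m]_x (f x)%:E)%E.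
Proof. by move=> f0; apply: integral_ge0 => x _; rewrite lee_fin. Qed.

Lemma integral_EFinD f g : measurable_fun [set: T] f -> measurable_fun [set: T] g ->
  (forall x, 0 <= f x) -> (forall x, 0 <= g x) ->
  (\int[m]_x (f x + g x)%:E = \int[m]_x (f x)%:E + \int[m]_x (g x)%:E)%E.
Proof.
move=> mf mg f0 g0; under eq_integral do rewrite EFinD.
apply: ge0_integralD => //; try exact/measurable_EFinP.
- by move=> x _; rewrite lee_fin.
- by move=> x _; rewrite lee_fin.
Qed.

Lemma integral_EFinZ (c : R) f : 0 <= c -> measurable_fun [set: T] f ->
  (forall x, 0 <= f x) ->
  (\int[m]_x (c * f x)%:E = c%:E * \int[m]_x (f x)%:E)%E.
Proof.
move=> c0 mf f0; under eq_integral do rewrite EFinM.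
rewrite ge0_integralZl//; first exact/measurable_EFinP.
by move=> x _; rewrite lee_fin.
Qed.

Lemma le_integral_EFin f g : measurable_fun [set: T] f -> measurable_fun [set: T] g ->
  (forall x, 0 <= f x <= g x) ->
  (\int[m]_x (f x)%:E <= \int[m]_x (g x)%:E)%E.
Proof.
move=> mf mg fg; apply: ge0_le_integral => //; try exact/measurable_EFinP.
- by move=> x _; rewrite lee_fin; have /andP[] := fg x.
- by move=> x _; rewrite lee_fin; have /andP[] := fg x.
Qed.

End ge0_real_integrals.

Lemma integral_EFin_sum d (T : measurableType d) (R : realType) (m : {measure set T -> \bar R})
    k (f : 'I_k -> T -> R) : (forall j, measurable_fun [set: T] (f j)) ->
  (forall j x, 0 <= f j x) ->
  (\int[m]_x (\sum_(j < k) f j x)%:E = \sum_(j < k) \int[m]_x (f j x)%:E)%E.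
Proof.
move=> mf f0; rewrite -ge0_integral_sum//.
- by apply: eq_integral => x _; rewrite sumEFin.
- by move=> j; exact/measurable_EFinP.
- by move=> j x _; rewrite lee_fin.
Qed.

Section measure_rV.
Variable R : realType.
Implicit Types n : nat.

Lemma ge0_integral_cons n (f : 'rV[R]_n.+1 -> \bar R) :
  measurable_fun [set: 'rV[R]_n.+1] f -> (forall x, 0 <= f x)%E ->
  (\int[lebesgue_rV R n.+1]_x f x =
   \int[@lebesgue_measure R]_t \int[lebesgue_rV R n]_y f (cons_rV (t, y)))%E.
Proof.
move=> mf f0; rewrite /= /lebesgue_cons.
have mC : measurable_fun [set: measurableTypeR R * 'rV[R]_n] (@cons_rV R n).
  exact: measurable_cons_rV.
rewrite (ge0_integral_pushforward mC)// preimage_setT fubini_tonelli1//=.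
by apply: measurableT_comp => //; exact: measurable_cons_rV.
Qed.

Lemma integral_rV0 (f : 'rV[R]_0 -> \bar R) : (forall x, 0 <= f x)%E ->
  (\int[lebesgue_rV R 0]_x f x = f 0%R)%E.
Proof.
have E (x : 'rV[R]_0) : x = 0 by exact: thinmx0.
move=> f0 /=; rewrite integral_dirac// ?diracT ?mul1e//.
move=> _ A _.
have [fA|fA] := pselect (A (f 0)).
  rewrite setTI [X in measurable X](_ : _ = setT)//.
  by apply/seteqP; split=> // x _; rewrite /preimage /= (E x).
rewrite setTI [X in measurable X](_ : _ = set0)//.
apply/seteqP; split=> // x; rewrite /preimage /= => Ax; apply: fA.
by rewrite -(E x).
Qed.

Lemma integral_affine1 (f : R -> \bar R) (a s : R) : 0 < s ->
  measurable_fun setT f -> (forall x, 0 <= f x)%E ->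
  (\int[@lebesgue_measure R]_t f t =
   s%:E * \int[@lebesgue_measure R]_t f (a + s * t)%R)%E.
Proof.
move=> s0 mf f0.
have mphi : measurable_fun [set: measurableTypeR R]
    (fun t : R => a + s * t : measurableTypeR R).
  by apply: measurable_funD => //; exact: measurable_funM.
pose m0 := measure_function_pushforward__canonical__measure_function_Measure
  (@lebesgue_measure R) mphi.
pose m : {measure set (measurableTypeR R) -> \bar R} := mscale (NngNum (ltW s0)) m0.
have mE A : measurable A -> lebesgue_measure A = m A.
  apply: lebesgue_measure_unique => _ [[b c] _ <-]/=.
  rewrite /m /mscale/= /pushforward.
  rewrite [X in (_ * lebesgue_measure X)%E](_ : _ = `](b - a) / s, (c - a) / s]%classic).
    rewrite !lebesgue_measure_itv/= !lte_fin ltr_pM2r ?invr_gt0// ltrD2r.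
    case: ifPn => _; last by rewrite mule0.
    rewrite -!EFinB -EFinM; congr EFin; field; exact: lt0r_neq0.
  apply/seteqP; split => x; rewrite /preimage/= !in_itv/=.
    by rewrite ltr_pdivrMr// ler_pdivlMr// ltrBlDl lerBrDl (mulrC x).
  by rewrite ltr_pdivrMr// ler_pdivlMr// ltrBlDl lerBrDl (mulrC x).
rewrite (eq_measure_integral m); last by move=> A mA _; exact: mE.
rewrite ge0_integral_mscale//=; congr (_ * _)%E.
by rewrite ge0_integral_pushforward.
Qed.

(** Induction on the dimension: Tonelli peels off one coordinate, on which the
one-dimensional substitution applies. *)
Lemma integral_affine n (f : 'rV[R]_n -> \bar R) (a : 'rV[R]_n) (s : R) :
  0 < s -> measurable_fun [set: 'rV[R]_n] f -> (forall x, 0 <= f x)%E ->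
  (\int[lebesgue_rV R n]_x f x =
   (s ^+ n)%:E * \int[lebesgue_rV R n]_x f (a + s *: x)%R)%E.
Proof.
move=> s0; elim: n => [|n IH] in f a * => mf f0.
  rewrite !integral_rV0// expr0 mul1e; congr f.
  by apply/rowP => -[].
have maff : measurable_fun [set: 'rV[R]_n.+1] (fun x : 'rV[R]_n.+1 => a + s *: x).
  apply: measurable_fun_rV => i; under eq_fun do rewrite !mxE.
  by apply: measurable_funD => //; apply: measurable_funM => //; exact: measurable_coord.
rewrite ge0_integral_cons// ge0_integral_cons//; last exact: measurableT_comp.
pose G t := (\int[lebesgue_rV R n]_y f (cons_rV (t, y)))%E.
have mG : measurable_fun setT G.
  apply: (@measurable_fun_fubini_tonelli_F _ _ _ _ _ _ (fun p => f (cons_rV p))) => //.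
  by apply: measurableT_comp => //; exact: measurable_cons_rV.
rewrite (integral_affine1 (a ord0 ord0) s0 mG); last first.
  by move=> x; apply: integral_ge0.
rewrite exprS EFinM -muleA; congr (_ * _)%E.
have mG' t : measurable_fun [set: 'rV[R]_n] (fun y : 'rV[R]_n => f (cons_rV (t, y))).
  apply: measurableT_comp => //.
  by apply: (measurableT_comp (@measurable_cons_rV R n)); exact: measurable_pair1.
rewrite -ge0_integralZl//; last 3 first.
- apply: (@measurable_fun_fubini_tonelli_F _ _ _ _ _ _ (fun p => f (a + s *: cons_rV p))) => //.
  apply: measurableT_comp => //.
  by apply: (measurableT_comp maff); exact: measurable_cons_rV.
- by move=> t _; exact: integral_ge0.
- by rewrite lee_fin exprn_ge0// ltW.
apply: eq_integral => t _; rewrite /G (IH _ (\row_i a ord0 (lift ord0 i)))//.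
congr (_ * _)%E; apply: eq_integral => y _; congr f.
apply/rowP => i; rewrite !mxE; case: unliftP => [j ->|->]//=.
by rewrite !mxE.
Qed.

(** An open set is the union of the countably many cubes with rational centre
and radius that it contains. *)
Lemma open_measurable_rV n (A : set 'rV[R]_n) : open A -> measurable A.
Proof.
move=> oA.
pose q2r (q : 'rV[rat]_n) : 'rV[R]_n := map_mx ratr q.
have mball (c : 'rV[R]_n) (r : R) : 0 < r -> measurable (ball c r).
  move=> r0.
  rewrite (_ : ball c r = \bigcap_(i in [set: 'I_n])
     ((fun x : 'rV[R]_n => x ord0 i) @^-1` ball (c ord0 i) r)); last first.
    apply/seteqP; split=> x.
      by move=> [_ bx] i _; exact: bx.
    by move=> bx; split => // i j; rewrite (ord1 i); exact: bx.
  apply: fin_bigcap_measurable => // i _; rewrite -[X in measurable X]setTI.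
  by apply: measurable_coord => //; exact: measurable_ball.
pose P (p : 'rV[rat]_n * rat) := `[< 0 < p.2 /\ ball (q2r p.1) (ratr p.2) `<=` A >].
have -> : A = \bigcup_p (if P p then ball (q2r p.1) (ratr p.2) else set0).
  apply/seteqP; split => [x Ax|x [p _]]; last first.
    by case: ifPn => // /asboolP[_]; exact.
  have /nbhs_ballP[e /= e0 eA] := oA x Ax.
  have [r] : exists r : rat, (ratr r : R) \in `]0, (e / 2)[.
    by apply: rat_in_itvoo; rewrite divr_gt0.
  rewrite in_itv/= ltr0q => /andP[r0 re].
  have qP i : exists q : rat, ball (x ord0 i) (ratr r) (ratr q : R).
    have [|q] := @rat_in_itvoo R (x ord0 i - ratr r) (x ord0 i + ratr r).
      by rewrite ltrBlDr -addrA ltrDl addr_gt0// ltr0q.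
    by move=> xq; exists q; rewrite ball_itv/=.
  have [q xq] := choice qP.
  exists (\row_i q i, r) => //=.
  have bqx : ball x (ratr r) (q2r (\row_i q i)).
    by split=> [|i j]; rewrite ?ltr0q// (ord1 i) !mxE; exact: xq.
  rewrite /P ifT; first exact: ball_sym.
  apply/asboolP; split => //= y qy; apply: eA.
  apply: (@le_ball _ _ x (ratr r + ratr r)); last exact: ball_triangle bqx qy.
  by rewrite [leRHS]splitr lerD ?ltW.
apply: countable_bigcupT_measurable; first exact: countableP.
move=> p.
by case: ifPn => // /asboolP[p0 _]; apply: mball; rewrite ltr0q.
Qed.

Lemma continuous_measurable_rV n (f : 'rV[R]_n -> R) : continuous f ->
  measurable_fun [set: 'rV[R]_n] f.
Proof.
move=> /continuousP cf; apply: (measurability _ (RGenOpens.measurableE R)).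
move=> _ [_ [a [b ->]] <-]; rewrite setTI; apply: open_measurable_rV.
exact/cf/interval_open.
Qed.

Lemma integral_prod_rV n (g : 'I_n -> R -> R) (c : 'I_n -> R) :
  (forall i, measurable_fun [set: R] (g i)) -> (forall i x, 0 <= g i x) ->
  (forall i, (\int[@lebesgue_measure R]_t (g i t)%:E = (c i)%:E)%E) ->
  (\int[lebesgue_rV R n]_x (\prod_(i < n) g i (x ord0 i))%:E =
   (\prod_(i < n) c i)%:E)%E.
Proof.
elim: n g c => [|n IH] g c mg g0 gc.
  by rewrite integral_rV0 ?big_ord0// => x; rewrite big_ord0.
have mP m (h : 'I_m -> R -> R) : (forall i, measurable_fun [set: R] (h i)) ->
    measurable_fun [set: 'rV[R]_m]
      (fun x : 'rV[R]_m => (\prod_(i < m) h i (x ord0 i))%:E).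
  move=> mh; apply/measurable_EFinP; apply: measurable_prod => i _.
  by apply: measurableT_comp => //; exact: measurable_coord.
rewrite ge0_integral_cons//; last 2 first.
- exact: mP.
- by move=> x; rewrite lee_fin prodr_ge0.
under eq_integral => t _.
  under eq_integral => y _.
    rewrite big_ord_recl mxE unlift_none /=.
    under eq_bigr do rewrite mxE liftK /=.
    rewrite EFinM.
    over.
  rewrite ge0_integralZl//; last 3 first.
  - exact: (mP _ (fun i => g (lift ord0 i))).
  - by move=> y _; rewrite lee_fin prodr_ge0.
  - by rewrite lee_fin.
  rewrite (IH (fun i => g (lift ord0 i)) (fun i => c (lift ord0 i)))//.
  over.
rewrite ge0_integralZr//; last 3 first.
- by apply/measurable_EFinP; exact: mg.
- by move=> y _; rewrite lee_fin.
- rewrite lee_fin prodr_ge0// => i _.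
  by rewrite -lee_fin -gc integral_ge0// => x _; rewrite lee_fin.
by rewrite gc -EFinM big_ord_recl.
Qed.

Lemma measurable_cube n (r : R) :
  measurable [set x : 'rV[R]_n | forall i, `|x ord0 i| <= r].
Proof.
rewrite (_ : [set _ | _] = \bigcap_(i in [set: 'I_n])
     ((fun x : 'rV[R]_n => x ord0 i) @^-1` `[- r, r])); last first.
  apply/seteqP; split=> x.
    by move=> Ax i _; rewrite /= in_itv/= -ler_norml; exact: Ax.
  by move=> Ax i; have := Ax i I; rewrite /= in_itv/= -ler_norml.
apply: fin_bigcap_measurable => // i _; rewrite -[X in measurable X]setTI.
exact: measurable_coord.
Qed.

Lemma measure_cube n (r : R) : 0 <= r ->
  lebesgue_rV R n [set x : 'rV[R]_n | forall i, `|x ord0 i| <= r] =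
  ((2 * r) ^+ n)%:E.
Proof.
move=> r0; set A := [set x : 'rV[R]_n | _]; have mA : measurable A by exact: measurable_cube.
rewrite -[A]setIT -integral_indic//.
have := @integral_prod_rV n (fun i => \1_(`[- r, r])) (fun=> 2 * r).
rewrite prodr_const card_ord => <-//; last first.
  move=> i; rewrite integral_indic//= setIT [LHS]lebesgue_measure_itv/= lte_fin.
  by case: ltP => h; rewrite -?EFinB; congr EFin; lra.
apply: eq_integral => x _; rewrite indicE; congr EFin.
have [Ax|/[dup] nAx /existsNP[i Ai]] := pselect (A x).
  rewrite mem_set// big1// => i _; rewrite indicE mem_set//= in_itv/= -ler_norml.
  exact: Ax.
rewrite memNset//; apply/esym/eqP; rewrite prodf_seq_eq0; apply/hasP.
exists i; first by rewrite mem_index_enum.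
by rewrite /= indicE memNset//= in_itv/= -ler_norml.
Qed.

Lemma measurable_affine n (a : 'rV[R]_n) (s : R) :
  measurable_fun [set: 'rV[R]_n] (fun x : 'rV[R]_n => a + s *: x).
Proof.
apply: measurable_fun_rV => i; under eq_fun do rewrite !mxE.
by apply: measurable_funD => //; apply: measurable_funM => //; exact: measurable_coord.
Qed.

Lemma measure_affine n (A : set 'rV[R]_n) (a : 'rV[R]_n) (s : R) : 0 < s ->
  measurable A ->
  (lebesgue_rV R n A = (s ^+ n)%:E * lebesgue_rV R n [set x : 'rV[R]_n | A (a + s *: x)%R])%E.
Proof.
move=> s0 mA.
have mA' : measurable [set x | A (a + s *: x)].
  by rewrite -[X in measurable X]setTI; exact: measurable_affine.
rewrite -[in LHS](setIT A) -integral_indic//.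
rewrite -[X in lebesgue_rV R n X]setIT -integral_indic//.
rewrite (@integral_affine _ _ a s)//; exact/measurable_EFinP.
Qed.

Lemma sqr_enorm_ge0 n (x : 'rV[R]_n) : 0 <= sqr_enorm x.
Proof. by apply: sumr_ge0 => i _; exact: sqr_ge0. Qed.

Lemma sqr_enormZ n (s : R) (x : 'rV[R]_n) :
  sqr_enorm (s *: x) = s ^+ 2 * sqr_enorm x.
Proof. by rewrite /sqr_enorm mulr_sumr; apply: eq_bigr => i _; rewrite mxE exprMn. Qed.

Lemma measurable_sqr_enorm n : measurable_fun [set: 'rV[R]_n] (@sqr_enorm R n).
Proof.
by apply: measurable_sum => i; apply: measurable_funX; exact: measurable_coord.
Qed.

Lemma measurable_sqr_enormB n (a : 'rV[R]_n) :
  measurable_fun [set: 'rV[R]_n] (fun x => sqr_enorm (x - a)).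
Proof.
apply: (measurableT_comp (@measurable_sqr_enorm n)).
rewrite (_ : (fun x => x - a) = (fun x => - a + 1 *: x)); first exact: measurable_affine.
by apply/funext => x; rewrite scale1r addrC.
Qed.

Lemma measurable_eball n (a : 'rV[R]_n) (c : R) :
  measurable [set x : 'rV[R]_n | sqr_enorm (x - a) < c].
Proof.
rewrite (_ : [set _ | _] =
    [set: 'rV[R]_n] `&` ((fun x => sqr_enorm (x - a)) @^-1` `]-oo, c[)); last first.
  by rewrite setTI; apply/seteqP; split => x /=; rewrite in_itv.
by apply: measurable_sqr_enormB => //; exact: measurable_itv.
Qed.

Lemma eball_sub_cube n (r : R) : 0 <= r ->
  [set x : 'rV[R]_n | sqr_enorm x < r ^+ 2] `<=` [set x | forall i, `|x ord0 i| <= r].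
Proof.
move=> r0 x /= xr i; rewrite -(@ler_pXn2r _ 2)// ?nnegrE// real_normK ?num_real//.
apply: le_trans (ltW xr); rewrite /sqr_enorm (bigD1 i)//= lerDl.
by apply: sumr_ge0 => j _; exact: sqr_ge0.
Qed.

Lemma measure_eball1 n : lebesgue_rV R n [set x : 'rV[R]_n | sqr_enorm x < 1] =
  (unit_ball_volume R n)%:E.
Proof.
rewrite /unit_ball_volume /volume fineK// ge0_fin_numE ?measure_ge0//.
apply: (@le_lt_trans _ _ (lebesgue_rV R n [set x : 'rV[R]_n | forall i, `|x ord0 i| <= 1])).
  apply: le_measure; rewrite ?inE.
  - by have := @measurable_eball n 0 1; under eq_set do rewrite subr0.
  - exact: measurable_cube.
  - by have := @eball_sub_cube n 1 ler01; rewrite expr1n.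
by rewrite measure_cube// ltry.
Qed.

(** The ball lies in the cube of side 2; this crude bound is all that the
comparison of inertia and volume below has to know about the unit ball. *)
Lemma unit_ball_volume_le n : unit_ball_volume R n <= 2 ^+ n.
Proof.
rewrite -lee_fin -measure_eball1 -[2]mulr1 -measure_cube//.
apply: le_measure; rewrite ?inE.
- by have := @measurable_eball n 0 1; under eq_set do rewrite subr0.
- exact: measurable_cube.
- by have := @eball_sub_cube n 1 ler01; rewrite expr1n.
Qed.

Lemma unit_ball_volume_gt0 n : 0 < unit_ball_volume R n.
Proof.
rewrite -lte_fin -measure_eball1.
apply: (@lt_le_trans _ _ (lebesgue_rV R n [set x : 'rV[R]_n | forall i, `|x ord0 i| <= n.+1%:R^-1])).
  by rewrite measure_cube// lte_fin exprn_gt0// mulr_gt0.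
apply: le_measure; rewrite ?inE.
- exact: measurable_cube.
- by have := @measurable_eball n 0 1; under eq_set do rewrite subr0.
- move=> x /= xn; rewrite /sqr_enorm.
  apply: (@le_lt_trans _ _ (\sum_(i < n) n.+1%:R^-1 ^+ 2)).
    by apply: ler_sum => i _; rewrite -real_normK ?num_real// lerXn2r// nnegrE.
  rewrite sumr_const card_ord -[ltLHS]mulr_natl exprVn ltr_pdivrMr ?exprn_gt0//.
  by rewrite mul1r -natrX ltr_nat; lia.
Qed.

Lemma measure_eball n (a : 'rV[R]_n) (r : R) : 0 < r ->
  lebesgue_rV R n [set x : 'rV[R]_n | sqr_enorm (x - a) < r ^+ 2] =
  (r ^+ n * unit_ball_volume R n)%:E.
Proof.
move=> r0; rewrite (measure_affine a r0)/=; last exact: measurable_eball.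
rewrite EFinM -measure_eball1; congr (_ * lebesgue_rV _ _ _)%E.
apply/seteqP; split => x /=; rewrite addrC addKr sqr_enormZ;
  by rewrite gtr_pMr// exprn_gt0.
Qed.

End measure_rV.

(** * Radial tents *)
Section ball_integrals.
Variable R : realType.
Implicit Types n : nat.

Lemma integral_is_derive (F f : R -> R) (a b : R) : a <= b ->
  (forall x : R, is_derive x (1 : R) F (f x)) -> continuous f ->
  (\int[@lebesgue_measure R]_(x in `]a, b]) (f x)%:E = (F b - F a)%:E)%E.
Proof.
rewrite le_eqVlt => /predU1P[<- _ _|ab dF cf].
  by rewrite set_itvoc0 integral_set0 subrr.
have mf : measurable_fun [set: R] f by exact: continuous_measurable_fun.
rewrite integral_itv_obnd_cbnd; last first.
  by apply/measurable_EFinP; apply: measurable_funTS.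
rewrite (@continuous_FTC2 _ f F)//.
- exact: continuous_subspaceT.
- have cF : continuous F.
    move=> x; apply/differentiable_continuous/derivable1_diffP.
    by have [] := dF x.
  split.
  + by move=> x _; have [] := dF x.
  + exact/cvg_at_right_filter/cF.
  + exact/cvg_at_left_filter/cF.
- by move=> x _; rewrite derive1E; have [_ ->] := dF x.
Qed.

Lemma integral_exprn (m : nat) (a b : R) : a <= b ->
  (\int[@lebesgue_measure R]_(t in `]a, b]) (m.+1%:R * t ^+ m)%:E =
   (b ^+ m.+1 - a ^+ m.+1)%:E)%E.
Proof.
move=> ab; apply: (integral_is_derive (F := fun t => t ^+ m.+1)) => //.
  move=> x; split; first exact: exprn_derivable.
  by rewrite exp_derive -mulr_natl [LHS]mulr1.
move=> x; apply: cvgM; first exact: cvg_cst.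
exact: exprn_continuous.
Qed.

Definition enorm n (x : 'rV[R]_n) : R := Num.sqrt (sqr_enorm x).

Lemma enorm_ge0 n (x : 'rV[R]_n) : 0 <= enorm x.
Proof. exact: sqrtr_ge0. Qed.

Lemma sqr_enormE n (x : 'rV[R]_n) : enorm x ^+ 2 = sqr_enorm x.
Proof. by rewrite sqr_sqrtr// sqr_enorm_ge0. Qed.

Lemma enorm_lt n (x : 'rV[R]_n) (r : R) : 0 <= r ->
  (enorm x < r) = (sqr_enorm x < r ^+ 2).
Proof. by move=> r0; rewrite -sqr_enormE ltr_pXn2r// nnegrE enorm_ge0. Qed.

Lemma enormZ n (s : R) (x : 'rV[R]_n) : 0 <= s -> enorm (s *: x) = s * enorm x.
Proof. by move=> s0; rewrite /enorm sqr_enormZ sqrtrM ?sqr_ge0// sqrtr_sqr ger0_norm. Qed.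

Lemma measurable_enormB n (a : 'rV[R]_n) :
  measurable_fun [set: 'rV[R]_n] (fun x => enorm (x - a)).
Proof.
apply: (@measurableT_comp _ _ _ _ _ _ (@Num.sqrt R)); last exact: measurable_sqr_enormB.
exact: (continuous_measurable_fun (@sqrt_continuous R)).
Qed.

(** Layer cake: r^p - |x - a|^p integrates p t^(p-1) over the t between |x - a| and
r, so after Tonelli the integral is that of p t^(p-1) B t^n over [0, r]. *)
Lemma integral_ball_tent n m (a : 'rV[R]_n) (r : R) : 0 <= r ->
  (\int[lebesgue_rV R n]_x (Num.max 0 (r ^+ m.+1 - enorm (x - a) ^+ m.+1))%:E =
   (m.+1%:R / (n + m.+1)%:R * unit_ball_volume R n * r ^+ (n + m.+1))%:E)%E.
Proof.
move=> r0.
pose g (t : R) := m.+1%:R * t ^+ m * \1_(`]0, r]) t.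
pose b (x : 'rV[R]_n) (t : R) : R := if enorm (x - a) < t then 1 else 0.
have g0 t : 0 <= g t.
  rewrite /g indicE; have [|] := boolP (t \in _); last by rewrite mulr0.
  by rewrite inE/= in_itv/= => /andP[t0 _]; rewrite mulr1 mulr_ge0// exprn_ge0// ltW.
have b0 x t : 0 <= b x t by rewrite /b; case: ifP.
have mg : measurable_fun [set: R] g.
  apply: measurable_funM; last exact: measurable_indic.
  by apply: measurable_funM => //; exact: exprn_measurable.
have mb : measurable_fun [set: 'rV[R]_n * R] (fun p => b p.1 p.2).
  apply: measurable_fun_ifT => //; apply: measurable_fun_ltr => //.
  exact: (measurableT_comp (@measurable_enormB n a)).
transitivity (\int[lebesgue_rV R n]_x \int[@lebesgue_measure R]_t (g t * b x t)%:E)%E.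
  apply: eq_integral => x _.
  have [xr|rx] := ltP (enorm (x - a)) r; last first.
    rewrite max_l ?subr_le0 ?lerXn2r ?nnegrE ?enorm_ge0//.
    rewrite integral0_eq// => t _; rewrite /g /b indicE.
    case: ifPn => [xt|]; last by rewrite mulr0.
    rewrite memNset ?mulr0 ?mul0r//= in_itv/= => /andP[_].
    by rewrite leNgt (le_lt_trans rx).
  rewrite max_r ?subr_ge0 ?lerXn2r ?nnegrE ?enorm_ge0// ?(ltW xr)//.
  rewrite -integral_exprn ?(ltW xr)// [LHS]integral_mkcond.
  apply: eq_integral => t _; rewrite patchE /g /b indicE !mem_setE !in_itv/=.
  case: ifPn => [/andP[xt tr]|xt].
    by rewrite xt (le_lt_trans (enorm_ge0 _) xt) tr !mulr1.
  case: ifPn => [xt'|]; last by rewrite mulr0.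
  by rewrite xt' /= in xt; rewrite (negbTE xt) andbF mulr0 mul0r.
rewrite (fubini_tonelli (m1 := lebesgue_rV R n) (m2 := @lebesgue_measure R)
  (fun p => (g p.2 * b p.1 p.2)%:E))//=; last 2 first.
- apply/measurable_EFinP; apply: measurable_funM => //.
  exact: measurableT_comp.
- by move=> p; rewrite lee_fin mulr_ge0.
pose B := unit_ball_volume R n.
transitivity (\int[@lebesgue_measure R]_(t in `]0%R, r])
    ((m.+1%:R / (n + m.+1)%:R * B) * ((n + m).+1%:R * t ^+ (n + m)))%:E)%E.
  rewrite [RHS]integral_mkcond; apply: eq_integral => t _.
  rewrite patchE; case: ifPn => [|tr]; last first.
    by rewrite integral0_eq// => x _; rewrite /g indicE (negbTE tr) mulr0 mul0r.
  rewrite inE/= in_itv/= => /andP[t0 tr].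
  under eq_integral do rewrite EFinM.
  rewrite ge0_integralZl//; last 3 first.
  - apply/measurable_EFinP; apply: measurable_fun_ifT => //.
    by apply: measurable_fun_ltr => //; exact: measurable_enormB.
  - by move=> x _; rewrite lee_fin.
  - by rewrite lee_fin.
  rewrite (_ : (\int[_]_x (b x t)%:E)%E = (t ^+ n * B)%:E); last first.
    rewrite -(measure_eball a t0) -[in RHS](setIT [set x | _]) -integral_indic//; last first.
      exact: measurable_eball.
    apply: eq_integral => x _; rewrite /b indicE; congr EFin.
    rewrite enorm_lt ?(ltW t0)//.
    by case: ifPn => h; [rewrite mem_set|rewrite memNset//=; apply/negP].
  rewrite -EFinM /g indicE mem_set ?mulr1/=; last by rewrite in_itv/= t0.
  congr EFin; rewrite addnS exprD; field.
  by rewrite -natrD nat1r pnatr_eq0.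
under eq_integral do rewrite EFinM.
rewrite ge0_integralZl//; last 3 first.
- apply/measurable_EFinP; apply: measurable_funM => //; exact: measurable_funTS.
- move=> t; rewrite /= in_itv/= => /andP[t0 _].
  by rewrite lee_fin mulr_ge0// exprn_ge0// ltW.
- by rewrite lee_fin !mulr_ge0 ?invr_ge0 ?(ltW (unit_ball_volume_gt0 _ _)).
by rewrite integral_exprn// expr0n subr0 -EFinM addnS.
Qed.

End ball_integrals.

(** * The fourth moment of a bounded density *)
Section quartic_moment.
Variable R : realType.

(** The kernel w of the transport argument for the fourth moment, in the variable
q = |z|^4 (rho and s stand for the fourth powers of the radius and of the
dilation factor). As a combination of three tents it has an explicit integral;
it is the minimum of the two weights (rho - q)_+ and (s q - rho)_+, and it
vanishes outside the ball. *)
Lemma dilated_tent_split (s rho q : R) : 1 <= s -> 0 <= q ->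
  let a := Num.max 0 (rho - q) in
  let w := a + Num.max 0 (rho - s * q) - Num.max 0 (2 * rho - (s + 1) * q) in
  [/\ 0 <= w, w <= a, w <= Num.max 0 (s * q - rho) & rho <= q -> w = 0].
Proof.
move=> s1 q0 a w; rewrite /w /a.
have sq : q <= s * q by rewrite ler_peMl.
rewrite (mulrDl s 1 q) mul1r; move: (s * q) sq => t qt.
case: (leP 0 (rho - q)) => h1; case: (leP 0 (rho - t)) => h2;
case: (leP 0 (2 * rho - (t + q))) => h3; case: (leP 0 (t - rho)) => h4;
by split=> [||| ?]; lra.
Qed.

Variable n : nat.
Local Notation mu := (lebesgue_rV R n).
Local Notation B := (unit_ball_volume R n).

Lemma integral_quartic_tent (r : R) : 0 <= r ->
  (\int[mu]_z (Num.max 0 (r ^+ 4 - enorm z ^+ 4))%:E =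
   (4 / (n%:R + 4) * B * r ^+ (n + 4))%:E)%E.
Proof.
move=> r0; have := @integral_ball_tent R n 3 0 r r0; rewrite natrD => <-.
by apply: eq_integral => z _; rewrite subr0.
Qed.

Lemma measurable_enorm : measurable_fun [set: 'rV[R]_n] (@enorm R n).
Proof.
have := @measurable_enormB R n 0.
by under eq_fun do rewrite subr0.
Qed.

Lemma measurable_quartic (c d : R) :
  measurable_fun [set: 'rV[R]_n] (fun z => c - d * enorm z ^+ 4).
Proof.
apply: measurable_funB => //; apply: measurable_funM => //.
exact: measurable_funX measurable_enorm.
Qed.

(** The term n is the fourth moment of the extremal density M 1_(|z| < rho). The
rest is the price of not jumping at the radius rho. Write a, b for the positive
and negative parts of rho^4 - |z|^4. The excess over the extremal value is
int a (M - F) + int b F, where the first integral penalises missing mass inside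
the ball and the second one mass outside. Substituting s z for z in the second
one shows that it is at least int b(s z) F(s z). A weight w below both a and
b(s .) then collects M - F(z) + F(s z) at each point of the ball, and this is
at least M - L (s - 1) rho. *)
Lemma quartic_moment_lb (F : 'rV[R]_n -> R) (M L k rho s x : R) :
  measurable_fun [set: 'rV[R]_n] F -> (forall z, 0 <= F z <= M) ->
  (k%:E <= \int[mu]_z (F z)%:E)%E ->
  0 < M -> 0 < rho -> M * B * rho ^+ n = k ->
  1 <= s -> 0 <= L -> (forall z, F z - L * (s - 1) * enorm z <= F (s *: z)) ->
  0 <= x -> x ^+ 4 * (s ^+ 4 + 1) = 2 ->
  L * (s - 1) * rho <= M ->
  ((k * rho ^+ 4 / (n%:R + 4) *
    (n%:R + 4 * (1 - L * (s - 1) * rho / M) * (1 + s ^- n - 2 * x ^+ n)))%:E <=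
   \int[mu]_z (enorm z ^+ 4 * F z)%:E)%E.
Proof.
move=> mF F0M kF M0 rho0 kE s1 L0 Flip x0 xE LM.
have s0 : 0 < s by apply: lt_le_trans s1.
have n4 : n%:R + 4 != 0 :> R by rewrite lt0r_neq0// ltr_wpDl.
pose q (z : 'rV[R]_n) := enorm z ^+ 4.
have q0 z : 0 <= q z by rewrite exprn_ge0// enorm_ge0.
pose a z := Num.max 0 (rho ^+ 4 - q z).
pose b z := Num.max 0 (q z - rho ^+ 4).
pose c z := Num.max 0 (rho ^+ 4 - s ^+ 4 * q z).
pose d z := Num.max 0 (2 * rho ^+ 4 - (s ^+ 4 + 1) * q z).
pose w z := a z + c z - d z.
have max0 (y : R) : 0 <= Num.max 0 y by rewrite le_max lexx.
have s41 : 1 <= s ^+ 4 by rewrite exprn_ege1.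
have W z : [/\ 0 <= w z, w z <= a z, w z <= Num.max 0 (s ^+ 4 * q z - rho ^+ 4)
    & rho ^+ 4 <= q z -> w z = 0] by exact: dilated_tent_split.
have w0 z : 0 <= w z by have [] := W z.
have mq : measurable_fun [set: 'rV[R]_n] q by exact: measurable_funX measurable_enorm.
have ma : measurable_fun [set: 'rV[R]_n] a.
  by apply: measurable_maxr => //; exact: measurable_funB.
have mb : measurable_fun [set: 'rV[R]_n] b.
  by apply: measurable_maxr => //; exact: measurable_funB.
have mc : measurable_fun [set: 'rV[R]_n] c.
  by apply: measurable_maxr => //; exact: measurable_quartic.
have md : measurable_fun [set: 'rV[R]_n] d.
  by apply: measurable_maxr => //; exact: measurable_quartic.
have mw : measurable_fun [set: 'rV[R]_n] w.
  by apply: measurable_funB => //; exact: measurable_funD.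
pose T r := 4 / (n%:R + 4) * B * r ^+ (n + 4).
have a0 z : 0 <= a z by exact: max0.
have b0 z : 0 <= b z by exact: max0.
have c0 z : 0 <= c z by exact: max0.
have d0 z : 0 <= d z by exact: max0.
have Ea : (\int[mu]_z (a z)%:E = (T rho)%:E)%E.
  by rewrite integral_quartic_tent// ltW.
have mtent r : measurable_fun [set: 'rV[R]_n] (fun z => Num.max 0 (r - q z)).
  by apply: measurable_maxr => //; exact: measurable_funB.
have Ec : (\int[mu]_z (c z)%:E = (s ^+ 4 * T (rho / s))%:E)%E.
  rewrite EFinM -integral_quartic_tent ?divr_ge0 ?ltW//.
  rewrite -integral_EFinZ ?exprn_ge0 ?(ltW s0)//.
  apply: eq_integral => z _; congr EFin.
  rewrite /c maxr_pMr ?exprn_ge0 ?(ltW s0)// mulr0; congr Num.max.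
  by rewrite /q; field; exact: lt0r_neq0.
have Ed : (\int[mu]_z (d z)%:E = ((s ^+ 4 + 1) * T (rho * x))%:E)%E.
  rewrite EFinM -integral_quartic_tent ?mulr_ge0 ?(ltW rho0)//.
  rewrite -integral_EFinZ ?addr_ge0 ?exprn_ge0 ?(ltW s0)//.
  apply: eq_integral => z _; congr EFin.
  rewrite /d maxr_pMr ?addr_ge0 ?exprn_ge0 ?(ltW s0)// mulr0; congr Num.max.
  by rewrite /q -xE; ring.
have Ew : (\int[mu]_z (w z)%:E =
    (4 / (n%:R + 4) * B * rho ^+ (n + 4) * (1 + s ^- n - 2 * x ^+ n))%:E)%E.
  have : (\int[mu]_z (w z)%:E + \int[mu]_z (d z)%:E =
      \int[mu]_z (a z)%:E + \int[mu]_z (c z)%:E)%E.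
    rewrite -!integral_EFinD//.
    by apply: eq_integral => z _; rewrite /w subrK.
  rewrite Ea Ec Ed -EFinD => /eqP; rewrite eq_sym -sube_eq//; last by rewrite fin_num_adde_defl.
  move=> /eqP <-; rewrite -EFinB; congr EFin; rewrite /T.
  rewrite -xE expr_div_n exprMn !exprD; field.
  by rewrite n4 !expf_neq0// lt0r_neq0.
have mB : measurable_fun [set: 'rV[R]_n] (fun z => b z * F z) by exact: measurable_funM.
have mG : measurable_fun [set: 'rV[R]_n] (fun z => a z * (M - F z)).
  by apply: measurable_funM => //; exact: measurable_funB.
have F0 z : 0 <= F z by have /andP[] := F0M z.
have bF0 z : 0 <= b z * F z by rewrite mulr_ge0 ?max0.
have aG0 z : 0 <= a z * (M - F z) by rewrite mulr_ge0 ?max0// subr_ge0; have /andP[] := F0M z.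
have H1 : (\int[mu]_z (q z * F z)%:E + (M * T rho)%:E =
    (rho ^+ 4)%:E * \int[mu]_z (F z)%:E +
    (\int[mu]_z (a z * (M - F z))%:E + \int[mu]_z (b z * F z)%:E))%E.
  rewrite EFinM -Ea -!integral_EFinZ ?exprn_ge0 ?(ltW M0) ?(ltW rho0)//.
  rewrite -!integral_EFinD//; first last.
  - by move=> z; rewrite mulr_ge0// ltW.
  - by move=> z; rewrite mulr_ge0.
  - exact: measurable_funM.
  - exact: measurable_funM.
  - by move=> z; rewrite addr_ge0.
  - by move=> z; rewrite mulr_ge0// exprn_ge0// ltW.
  - exact: measurable_funD.
  - exact: measurable_funM.
  (* q F = rho^4 F - a F + b F *)
  apply: eq_integral => z _; congr EFin.
  have -> : b z = a z + (q z - rho ^+ 4).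
    rewrite /a /b; move: (rho ^+ 4) (q z) => u v.
    by case: (leP 0 (u - v)) => h1; case: (leP 0 (v - u)) => h2; lra.
  by ring.
have maff : measurable_fun [set: 'rV[R]_n] (fun z : 'rV[R]_n => s *: z).
  by have := @measurable_affine R n 0 s; under eq_fun do rewrite add0r.
have mBs : measurable_fun [set: 'rV[R]_n] (fun z => b (s *: z) * F (s *: z)).
  exact: (measurableT_comp mB).
have H2 : (\int[mu]_z (b (s *: z) * F (s *: z))%:E <= \int[mu]_z (b z * F z)%:E)%E.
  rewrite (@integral_affine _ _ (fun z => (b z * F z)%:E) 0 s)//; last exact/measurable_EFinP.
  under [X in (_ <= _ * X)%E]eq_integral do rewrite add0r.
  apply: lee_pemull; last by rewrite lee_fin exprn_ege1.
  by apply: integral_ge0 => z _; rewrite lee_fin.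
have H3 : ((M - L * (s - 1) * rho)%:E * \int[mu]_z (w z)%:E <=
  \int[mu]_z (a z * (M - F z))%:E + \int[mu]_z (b (s *: z) * F (s *: z))%:E)%E.
  rewrite -integral_EFinZ ?subr_ge0// -integral_EFinD//.
  apply: le_integral_EFin; [exact: measurable_funM|exact: measurable_funD|].
  move=> z; apply/andP; split; first by rewrite mulr_ge0// subr_ge0.
  have [_ wa wb wq] := W z.
  have [zr|rz] := leP (rho ^+ 4) (q z).
    by rewrite (wq zr) mulr0 addr_ge0.
  have zrho : enorm z <= rho.
    by rewrite -(@ler_pXn2r _ 4)// ?nnegrE ?enorm_ge0// ?(ltW rho0)// ltW.
  have bs : w z <= b (s *: z).
    by rewrite /b /q enormZ ?(ltW s0)// exprMn.
  have /andP[_ FM] := F0M z.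
  have h : (M - L * (s - 1) * rho) <= (M - F z) + F (s *: z).
    have := Flip z; have : L * (s - 1) * enorm z <= L * (s - 1) * rho.
      by rewrite ler_wpM2l// mulr_ge0// subr_ge0.
    lra.
  apply: (@le_trans _ _ (((M - F z) + F (s *: z)) * w z)); first by rewrite ler_wpM2r.
  by rewrite mulrDl mulrC lerD// ?[_ * w z]mulrC ler_wpM2r// subr_ge0.
have -> : (\int[mu]_z (enorm z ^+ 4 * F z)%:E = (\int[mu]_z (q z * F z)%:E + (M * T rho)%:E) -
   (M * T rho)%:E)%E by rewrite addeK.
rewrite leeBrDr// H1; apply: (@le_trans _ _ ((rho ^+ 4)%:E * k%:E +
  ((M - L * (s - 1) * rho)%:E * \int[mu]_z (w z)%:E))%E); last first.
  apply: leeD; first by rewrite lee_wpmul2l// lee_fin exprn_ge0// ltW.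
  by apply: le_trans H3 _; exact: leeD.
rewrite Ew -!EFinM -!EFinD lee_fin le_eqVlt; apply/orP; left; apply/eqP.
rewrite /T -kE exprD; field.
by rewrite n4 expf_neq0 lt0r_neq0.
Qed.

End quartic_moment.

(** * Volume and moment of inertia *)
Section bounded_domain.
Variables (R : realType) (n : nat).
Local Notation mu := (lebesgue_rV R n).
Local Notation B := (unit_ball_volume R n).
Implicit Types (Om : set 'rV[R]_n).

Lemma coord_le_norm (x : 'rV[R]_n) i : `|x ord0 i| <= `|x|.
Proof.
rewrite [leRHS](mx_normrE x).
exact: (le_bigmax _ (fun p : 'I_1 * 'I_n => `|x p.1 p.2|) (ord0, i)).
Qed.

Lemma norm_le_coord (x : 'rV[R]_n) (r : R) : 0 <= r ->
  (forall i, `|x ord0 i| <= r) -> `|x| <= r.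
Proof.
move=> r0 xr; rewrite [leLHS](mx_normrE x).
by apply/bigmax_leP; split => // -[i j] _; rewrite (ord1 i)/=.
Qed.

Lemma bounded_sub_cube Om : bounded_set Om ->
  exists2 r : R, 0 < r & Om `<=` [set x | forall i, `|x ord0 i| <= r].
Proof.
move=> [M [Mr OM]]; exists (`|M| + 1); first by rewrite ltr_wpDl.
move=> x Ox i; apply: (le_trans (coord_le_norm x i)).
by apply: (OM (`|M| + 1)) => //; rewrite ltr_pwDr// ler_norm.
Qed.

Lemma bounded_measure_lty Om : measurable Om -> bounded_set Om -> (mu Om < +oo)%E.
Proof.
move=> mO /bounded_sub_cube[r r0 Or].
apply: (@le_lt_trans _ _ (mu [set x : 'rV[R]_n | forall i, `|x ord0 i| <= r])).
  by apply: le_measure; rewrite ?inE//; exact: measurable_cube.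
by rewrite measure_cube ?(ltW r0)// ltry.
Qed.

(** A point of an open set has around it a dilated copy of the unit cube. *)
Lemma open_measure_gt0 Om : open Om -> Om !=set0 -> (0 < mu Om)%E.
Proof.
move=> oO [x Ox]; have /nbhs_ballP[e /= e0 eO] := oO x Ox.
have e20 : 0 < e / 2 by rewrite divr_gt0.
rewrite (measure_affine x e20); last exact: open_measurable_rV.
rewrite mule_gt0 ?lte_fin ?exprn_gt0//.
apply: (@lt_le_trans _ _ (mu [set y : 'rV[R]_n | forall i, `|y ord0 i| <= 1])).
  by rewrite measure_cube// lte_fin exprn_gt0// mulr_gt0.
apply: le_measure; rewrite ?inE.
- exact: measurable_cube.
- rewrite -[X in measurable X]setTI; apply: measurable_affine => //.
  exact: open_measurable_rV.
- move=> y /= y1; apply: eO; rewrite -ball_normE/= opprD addNKr normrN.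
  rewrite normrZ gtr0_norm//; apply: (@le_lt_trans _ _ (e / 2 * 1)).
    by rewrite ler_pM2l//; exact: norm_le_coord.
  by rewrite mulr1 gtr_pMr// invf_lt1// ltr1n.
Qed.

Lemma sqr_enormB_le Om (a : 'rV[R]_n) : bounded_set Om ->
  exists2 C : R, 0 <= C & forall x, Om x -> sqr_enorm (x - a) <= C.
Proof.
move=> /bounded_sub_cube[r r0 Or].
exists (\sum_(i < n) (r + `|a ord0 i|) ^+ 2); first by apply: sumr_ge0 => i _; exact: sqr_ge0.
move=> x Ox; apply: ler_sum => i _; rewrite !mxE -real_normK ?num_real//.
rewrite lerXn2r ?nnegrE ?addr_ge0 ?(ltW r0)//.
by apply: le_trans (ler_normB _ _) _; rewrite lerD2r; exact: Or.
Qed.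

Lemma integrable_bounded Om (f : 'rV[R]_n -> R) (C : R) : measurable Om ->
  bounded_set Om -> measurable_fun [set: 'rV[R]_n] f ->
  (forall x, Om x -> `|f x| <= C) -> mu.-integrable Om (EFin \o f).
Proof.
move=> mO bO mf fC; apply: measurable_bounded_integrable => //.
- exact: bounded_measure_lty.
- exact: measurable_funTS.
- exists C; split; first exact: num_real.
  by move=> D CD x Ox /=; apply: le_trans (fC x Ox) (ltW CD).
Qed.

Lemma volumeE Om : measurable Om -> bounded_set Om -> mu Om = (volume Om)%:E.
Proof.
move=> mO bO; rewrite /volume fineK// ge0_fin_numE ?measure_ge0//.
exact: bounded_measure_lty.
Qed.

Lemma inertia_integralE Om (a : 'rV[R]_n) : measurable Om -> bounded_set Om ->
  ((\int[mu]_(x in Om) sqr_enorm (x - a))%:E =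
   \int[mu]_(x in Om) (sqr_enorm (x - a))%:E)%E.
Proof.
move=> mO bO; rewrite fineK//.
have [C C0 CO] := sqr_enormB_le a bO.
apply: integrable_fin_num => //; apply: (integrable_bounded (C := C)) => //.
  exact: measurable_sqr_enormB.
by move=> x Ox; rewrite ger0_norm ?sqr_enorm_ge0//; exact: CO.
Qed.

(** Bathtub principle: r^2 <= |x - a|^2 + (r^2 - |x - a|^2)_+ holds pointwise;
integrated over Om, with the last term extended to the whole space, it compares
Om with the ball of the same volume. *)
Lemma inertia_lb Om (a : 'rV[R]_n) (r : R) : measurable Om -> bounded_set Om ->
  0 <= r -> B * r ^+ n = volume Om ->
  n%:R / (n%:R + 2) * volume Om * r ^+ 2 <= \int[mu]_(x in Om) sqr_enorm (x - a).
Proof.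
move=> mO bO r0 BV.
have n2 : n%:R + 2 != 0 :> R by rewrite lt0r_neq0// ltr_wpDl.
pose t (x : 'rV[R]_n) := Num.max 0 (r ^+ 2 - enorm (x - a) ^+ 2).
have t0 x : 0 <= t x by rewrite /t le_max lexx.
have mt : measurable_fun [set: 'rV[R]_n] t.
  apply: measurable_maxr => //; apply: measurable_funB => //.
  exact: measurable_funX (@measurable_enormB _ _ a).
have mq := @measurable_sqr_enormB R n a.
have : (\int[mu]_(x in Om) (r ^+ 2)%:E <=
    \int[mu]_(x in Om) (sqr_enorm (x - a))%:E + \int[mu]_x (t x)%:E)%E.
  apply: (@le_trans _ _ (\int[mu]_(x in Om) (sqr_enorm (x - a))%:E +
      \int[mu]_(x in Om) (t x)%:E)%E); last first.
    rewrite leeD2l//; apply: ge0_subset_integral => //.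
    - exact/measurable_EFinP.
    - by move=> x _; rewrite lee_fin.
  rewrite -ge0_integralD//; last 4 first.
  - by move=> x _; rewrite lee_fin sqr_enorm_ge0.
  - by apply/measurable_EFinP; exact: measurable_funTS.
  - by move=> x _; rewrite lee_fin.
  - by apply/measurable_EFinP; exact: measurable_funTS.
  apply: ge0_le_integral => //.
  - by move=> x _; rewrite lee_fin sqr_ge0.
  - under eq_fun do rewrite -EFinD; apply/measurable_EFinP; apply: measurable_funTS.
    exact: measurable_funD.
  - move=> x _; rewrite -EFinD lee_fin /t sqr_enormE -lerBlDl le_max lexx orbT//.
have -> : (\int[mu]_(x in Om) (r ^+ 2)%:E = (r ^+ 2 * volume Om)%:E)%E.
  by rewrite integral_cst// [RHS]EFinM; congr (_ * _)%E; exact: volumeE.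
rewrite -inertia_integralE// (@integral_ball_tent R n 1 a r r0).
rewrite -EFinD lee_fin -lerBlDr => h; apply: le_trans h.
rewrite natrD le_eqVlt; apply/orP; left; apply/eqP.
by rewrite -BV exprD; field.
Qed.

Lemma moment_of_inertia_lb Om (c : R) :
  (forall a, c <= \int[mu]_(x in Om) sqr_enorm (x - a)) -> c <= moment_of_inertia Om.
Proof.
move=> h; apply: lb_le_inf; first by exists (\int[mu]_(x in Om) sqr_enorm (x - 0)), 0.
by move=> _ [a _ <-]; exact: h.
Qed.

End bounded_domain.

(** * Numerical bounds *)
Section numerics.
Variable R : realType.

(** Mean value theorem, as the derivative of sin is at most 1. *)
Lemma sin_le_id (x : R) : 0 <= x -> sin x <= x.
Proof.
move=> x0; have [c _] := @MVT_segment R sin cos 0 x x0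
  (fun y _ => is_derive_sin y) (continuous_subspaceT (@continuous_sin R)).
by rewrite sin0 !subr0 => ->; rewrite ler_piMl// cos_le1.
Qed.

(** The triple angle formula at pi / 6 forces sin (pi / 6) = 1 / 2, and sin t <= t. *)
Lemma pi_ge3 : 3 <= pi :> R.
Proof.
pose t : R := pi / 6.
have tpi : t + t + t = pi / 2 by rewrite /t; field.
have s0 : 0 <= sin t.
  by apply: sin_ge0_pi; rewrite /t; have := pi_ge0 R; lra.
have : sin (t + t + t) = 1 by rewrite tpi sin_pihalf.
rewrite sinD sinD cosD; have := cos2Dsin2 t => /eqP; rewrite eq_sym -subr_eq => /eqP.
have : sin t <= t by apply: sin_le_id; rewrite /t; have := pi_ge0 R; lra.
move: (sin t) (cos t) s0 => s c s0 st c2 h.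
have : (s + 1) * (2 * s - 1) ^+ 2 = 0.
  have e : (s * c + c * s) * c + (c * c - s * s) * s = 3 * c ^+ 2 * s - s ^+ 3 by ring.
  rewrite e -c2 in h; rewrite -[RHS](subrr 1) -[X in _ = 1 - X]h; ring.
move=> /eqP; rewrite mulf_eq0 expf_eq0/= => /orP[/eqP|/eqP]; first lra.
by move: st; rewrite /t; lra.
Qed.

(** The one-dimensional case of the gain. With s = 1 + 2 h, x is the reciprocal of
the quartic mean of 1 and s, which is bounded below by 1 + h + 11 h^2 / 10, the
coefficient 11 / 10 being less than the Taylor coefficient 3 / 2. *)
Lemma quartic_mean_gap (h x : R) : 0 <= h -> h ^+ 2 <= 27^-1 -> 0 <= x ->
  x ^+ 4 * ((1 + 2 * h) ^+ 4 + 1) = 2 ->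
  37 / 16 * h ^+ 2 <= 1 + (1 + 2 * h)^-1 - 2 * x.
Proof.
move=> h0 h27 x0 xE.
have h5 : h <= 1 / 5 by nra.
(* m is a lower bound for the quartic mean of 1 and 1 + 2 h. *)
pose m : R := 1 + h + 11 / 10 * h ^+ 2.
have m0 : 0 < m by rewrite /m; nra.
have m4 : m ^+ 4 * 2 <= (1 + 2 * h) ^+ 4 + 1.
  have a : m ^+ 2 <= (1 + h) ^+ 2 + 14 / 5 * h ^+ 2 by rewrite /m; nra.
  have b : ((1 + h) ^+ 2 + 14 / 5 * h ^+ 2) ^+ 2 * 2 <= (1 + 2 * h) ^+ 4 + 1 by nra.
  apply: le_trans b; rewrite ler_pM2r// (exprM m 2 2).
  rewrite ler_pXn2r// ?nnegrE ?sqr_ge0//.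
  by rewrite addr_ge0 ?sqr_ge0// mulr_ge0 ?sqr_ge0//; lra.
have xm : x * m <= 1.
  rewrite -(@ler_pXn2r _ 4)// ?nnegrE ?mulr_ge0 ?(ltW m0)// expr1n exprMn.
  rewrite -(ler_pM2r (ltr0n R 2)) mul1r -mulrA -[leRHS]xE.
  by rewrite ler_wpM2l ?exprn_ge0.
have x1 : x <= m^-1 by rewrite -[m^-1]mul1r ler_pdivlMr.
have {x1 xm} : 1 + (1 + 2 * h)^-1 - 2 * m^-1 <= 1 + (1 + 2 * h)^-1 - 2 * x by lra.
apply: le_trans.
rewrite (_ : 1 + _ - _ = (2 * (1 + h) * m - 2 * (1 + 2 * h)) / ((1 + 2 * h) * m)); last first.
  by field; rewrite !lt0r_neq0//; lra.
rewrite ler_pdivlMr; last by rewrite mulr_gt0//; lra.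
rewrite /m.
have -> : 2 * (1 + h) * (1 + h + 11 / 10 * h ^+ 2) - 2 * (1 + 2 * h) =
  h ^+ 2 * (21 / 5 + 11 / 5 * h) by field.
have : 37 / 16 * ((1 + 2 * h) * (1 + h + 11 / 10 * h ^+ 2)) <= 21 / 5 + 11 / 5 * h by nra.
by move=> /(ler_wpM2l (sqr_ge0 h)); lra.
Qed.

(** The increment from n to n + 1 of 1 + y^n - 2 x^n is
x^n (1 + y - 2 x) + (x^n - y^n) (1 - y), a sum of nonnegative terms. *)
Lemma power_gap_mono (x y : R) (n : nat) : 0 <= y -> y <= x -> 0 <= 1 + y - 2 * x ->
  (0 < n)%N -> 1 + y - 2 * x <= 1 + y ^+ n - 2 * x ^+ n.
Proof.
move=> y0 yx e0; case: n => // n _; elim: n => [|n IH]; first by rewrite !expr1.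
apply: (le_trans IH); rewrite -subr_ge0.
have yxn : y ^+ n.+1 <= x ^+ n.+1 by rewrite lerXn2r// nnegrE// (le_trans y0).
have y1 : y <= 1 by lra.
rewrite (_ : _ - _ = x ^+ n.+1 * (1 + y - 2 * x) + (x ^+ n.+1 - y ^+ n.+1) * (1 - y)); last first.
  by rewrite !exprS; ring.
by rewrite addr_ge0// mulr_ge0 ?exprn_ge0 ?(le_trans y0 yx)// subr_ge0.
Qed.

(** Reduction to dimension one by monotonicity in n. Here e is the distance
M / L over which a density with slope at most L climbs to M, divided by the
radius; among the dilation factors, s = 1 + 2 e / 3 makes 1 - L (s - 1) rho / M
equal to 1 / 3, close to the best choice for small e. *)
Lemma gain_lb (e x : R) (n : nat) : (0 < n)%N -> 0 <= e -> e ^+ 2 <= 3^-1 -> 0 <= x ->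
  let s := 1 + 2 / 3 * e in
  x ^+ 4 * (s ^+ 4 + 1) = 2 ->
  e ^+ 2 / 3 + e ^+ 4 / 36 <= 4 / 3 * (1 + s ^- n - 2 * x ^+ n).
Proof.
move=> n0 e0 e3 x0 s xE.
have s1 : 1 <= s by rewrite /s lerDl mulr_ge0// divr_ge0.
have := @quartic_mean_gap (e / 3) x; rewrite (_ : 1 + 2 * (e / 3) = s); last by rewrite /s; field.
move=> /(_ _ _ x0 xE); rewrite divr_ge0// => /(_ isT).
have -> : (e / 3) ^+ 2 <= 27^-1 by rewrite expr_div_n ler_pdivrMr//; lra.
move=> /(_ isT) gap.
have yx : s^-1 <= x.
  rewrite -(@ler_pXn2r _ 4)// ?nnegrE// ?invr_ge0 ?(le_trans ler01 s1)//.
  rewrite exprVn -[_^-1]mul1r ler_pdivrMr ?exprn_gt0 ?(lt_le_trans ltr01 s1)//.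
  have := exprn_ege1 4 s1; have := exprn_ge0 4 x0; nra.
have := @power_gap_mono x s^-1 n; rewrite invr_ge0 (le_trans ler01 s1) yx n0.
have -> : 0 <= 1 + s^-1 - 2 * x by apply: le_trans gap; rewrite mulr_ge0 ?sqr_ge0.
move=> /(_ isT isT isT isT); rewrite exprVn => mono.
have e4 : e ^+ 4 <= e ^+ 2 / 3 by rewrite (_ : e ^+ 4 = e ^+ 2 * e ^+ 2) ?ler_wpM2l ?sqr_ge0// -exprD.
rewrite expr_div_n in gap.
move: (s ^- n) (x ^+ n) (s^-1) (e ^+ 4) (e ^+ 2) mono gap e4 => A1 A2 A3 A4 A5; lra.
Qed.

End numerics.

(** * The Poisson kernel *)
Section one_dimensional.
Variable R : realType.
Local Notation leb := (@lebesgue_measure R).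

Lemma measurable_oppr : measurable_fun [set: R] (-%R : R -> R).
Proof. by apply: continuous_measurable_fun => x; exact: cvgN. Qed.

Lemma is_derive_mull (c x : R) : is_derive x (1 : R) (fun t => c * t) c.
Proof.
have -> : (fun t => c * t) = c \*: (@id R) by [].
by apply: is_derive_eq; exact: mulr1.
Qed.

(** Reduces even integrands to the half-line, where antiderivatives are available. *)
Lemma ge0_integral_fold (g : R -> R) : measurable_fun [set: R] g ->
  (forall x, 0 <= g x) ->
  (\int[leb]_x (g x)%:E = \int[leb]_(x in `[0%R, +oo[) (g x + g (- x))%:E)%E.
Proof.
move=> mg g0.
have mgN : measurable_fun [set: R] (fun x => g (- x)).
  apply: (measurableT_comp mg); exact: measurable_oppr.
have mgE : measurable_fun [set: R] (EFin \o g) by exact/measurable_EFinP.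
rewrite -(setUv `[0%R, +oo[%classic) ge0_integral_setU//=; last 4 first.
- exact: measurableC.
- exact: measurable_funTS.
- by move=> x _; rewrite lee_fin.
- by apply/disj_set2P; rewrite setICr.
under [RHS]eq_integral do rewrite EFinD.
rewrite ge0_integralD//=; last 4 first.
- by move=> x _; rewrite lee_fin.
- by apply/measurable_EFinP; exact: measurable_funTS.
- by move=> x _; rewrite lee_fin.
- by apply/measurable_EFinP; exact: measurable_funTS.
congr (_ + _)%E.
rewrite (@ge0_integration_by_substitution0 _ (fun x => (g (- x))%:E))//; last 2 first.
- exact/measurable_EFinP.
- by move=> x; rewrite lee_fin.
under [RHS]eq_integral do rewrite opprK.
rewrite setCitvr/=.
rewrite -integral_itv_bndo_bndc//.
by apply: measurable_funTS.
Qed.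

Lemma ge0_integral_is_derivey (F f : R -> R) (a l : R) :
  (forall x : R, is_derive x (1 : R) F (f x)) -> continuous f ->
  (forall x, a <= x -> 0 <= f x) -> F x @[x --> +oo] --> l ->
  (\int[leb]_(x in `[a, +oo[) (f x)%:E = (l - F a)%:E)%E.
Proof.
move=> dF cf f0 Fl; rewrite (@ge0_continuous_FTC2y _ f F _ l)//.
- exact: continuous_subspaceT.
- apply/cvg_at_right_filter/differentiable_continuous/derivable1_diffP.
  by have [] := dF a.
- by move=> x _; rewrite derive1E; have [_ ->] := dF x.
Qed.

(** The factor 1 + cos keeps the integrand nonnegative, so that the fundamental
theorem of calculus on the half-line applies. With al = 0 and al = pi / 2 the
formula contains the Fourier transform of exp (- e |t|), namely the Poisson
kernel 2 e / (e^2 + w^2). *)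
Lemma integral_window (e w al : R) : 0 < e ->
  (\int[leb]_t (expR (- (e * `|t|)) * (1 + cos (w * t + al)))%:E =
   (2 / e + cos al * (2 * e / (e ^+ 2 + w ^+ 2)))%:E)%E.
Proof.
move=> e0.
have ew : e ^+ 2 + w ^+ 2 != 0 by rewrite lt0r_neq0// ltr_pwDl ?exprn_gt0// sqr_ge0.
have cos1 (x : R) : 0 <= 1 + cos x by have := cos_geN1 x; lra.
rewrite ge0_integral_fold; last 2 first.
- apply: measurable_funM.
    apply: measurableT_comp => //; apply: measurableT_comp; first exact: measurable_oppr.
    by apply: measurable_funM => //; exact: normr_measurable.
  apply: measurable_funD => //; apply: measurableT_comp.
    exact: continuous_measurable_fun (@continuous_cos R).
  by apply: measurable_funD => //; exact: measurable_funM.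
- by move=> x; rewrite mulr_ge0// expR_ge0.
pose f t := expR (- (e * t)) * (2 + 2 * cos al * cos (w * t)).
pose F t := expR (- (e * t)) *
  (- (2 / e) + 2 * cos al / (e ^+ 2 + w ^+ 2) * (w * sin (w * t) - e * cos (w * t))).
transitivity (\int[leb]_(t in `[0%R, +oo[) (f t)%:E)%E.
  apply: eq_integral => t; rewrite inE/= in_itv/= andbT => t0; congr EFin.
  rewrite normrN ger0_norm// -mulrDr; congr (_ * _).
  rewrite mulrN (addrC (- _)) cosD cosB; ring.
have dF (x : R) : is_derive x (1 : R) F (f x).
  have dE : is_derive x (1 : R) (fun t => expR (- (e * t))) (- e * expR (- (e * x))).
    under eq_fun do rewrite -mulNr.
    rewrite -mulNr mulrC; apply: (@is_derive1_comp _ expR (fun t => - e * t)).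
    exact: is_derive_mull.
  have dS : is_derive x (1 : R) (fun t => sin (w * t)) (cos (w * x) * w).
    apply: (@is_derive1_comp _ sin (fun t => w * t)); exact: is_derive_mull.
  have dC : is_derive x (1 : R) (fun t => cos (w * t)) (- sin (w * x) * w).
    apply: (@is_derive1_comp _ cos (fun t => w * t)); exact: is_derive_mull.
  pose c := 2 * cos al / (e ^+ 2 + w ^+ 2).
  have := is_deriveM dE (is_deriveD (is_derive_cst (- (2 / e)) x 1)
     (is_deriveZ c (is_deriveB (is_deriveZ w dS) (is_deriveZ e dC)))).
  move=> h; apply: (is_derive_eq h).
  set G := (X in X x *: _); have -> : G x =
    - (2 / e) + c * (w * sin (w * x) - e * cos (w * x)) by [].
  rewrite /GRing.scale/= /c /f.
  by field; rewrite ew lt0r_neq0.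
have cf : continuous f.
  move=> x; apply: cvgM.
    apply: continuous_comp; last exact: continuous_expR.
    by apply: cvgN; apply: cvgM => //; exact: cvg_cst.
  apply: cvgD; first exact: cvg_cst.
  apply: cvgM; first exact: cvg_cst.
  apply: continuous_comp; last exact: continuous_cos.
  by apply: cvgM => //; exact: cvg_cst.
have f0 x : 0 <= x -> 0 <= f x.
  move=> x0; rewrite /f mulr_ge0 ?expR_ge0//.
have Fl : F x @[x --> +oo] --> (0 : R).
  pose C := 2 / e + `|2 * cos al / (e ^+ 2 + w ^+ 2)| * (`|w| + e).
  have eCl : expR (- (e * t)) * C @[t --> +oo] --> (0 : R).
    rewrite -[X in _ --> X](mul0r C); apply: cvgM; last exact: cvg_cst.
    by apply: (cvg_comp _ _ _ (@cvgr_expR R)); apply: gt0_cvgMry.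
  apply: norm_cvg0.
  apply: (@squeeze_cvgr _ _ _ _ (fun=> 0) (fun t => expR (- (e * t)) * C)) => //; last exact: cvg_cst.
  apply: nearW => t; rewrite normr_ge0/= normrM ger0_norm ?expR_ge0//.
  rewrite ler_wpM2l ?expR_ge0// /C; apply: le_trans (ler_normD _ _) _.
  rewrite normrN (ger0_norm (_ : 0 <= 2 / e)) ?divr_ge0 ?(ltW e0)// lerD2l normrM.
  rewrite ler_wpM2l//; apply: le_trans (ler_normB _ _) _.
  rewrite !normrM (ger0_norm (ltW e0)); apply: lerD.
    by rewrite ler_piMr// ler_norml sin_geN1 sin_le1.
  by rewrite ler_piMr ?(ltW e0)// ler_norml cos_geN1 cos_le1.
rewrite (ge0_integral_is_derivey dF cf f0 Fl).
rewrite /F !mulr0 oppr0 expR0 cos0 sin0 mul1r; congr EFin.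
by field; rewrite ew lt0r_neq0.
Qed.

Definition poisson (e t : R) : R := e / pi / (e ^+ 2 + t ^+ 2).

Lemma poisson_ge0 (e t : R) : 0 < e -> 0 <= poisson e t.
Proof.
move=> e0; rewrite /poisson !divr_ge0 ?pi_ge0 ?(ltW e0)//.
by rewrite addr_ge0 ?sqr_ge0.
Qed.

Lemma continuous_poisson (e : R) : 0 < e -> continuous (poisson e).
Proof.
move=> e0 x; apply: cvgM; first exact: cvg_cst.
apply: cvgV; first by rewrite lt0r_neq0// ltr_pwDl ?exprn_gt0// sqr_ge0.
apply: cvgD; first exact: cvg_cst.
exact: exprn_continuous.
Qed.

(** The antiderivative is an arc tangent. The case a = 0 says that the kernel has
mass 1; for a > 0 the tail tends to 0 with e. *)
Lemma integral_poisson_tail (e a : R) : 0 < e -> 0 <= a ->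
  (\int[leb]_t (if (a <= `|t|)%R then poisson e t else 0)%:E =
   (1 - 2 / pi * atan (a / e))%:E)%E.
Proof.
move=> e0 a0; have pi0 := @pi_gt0 R.
have e2 t : e ^+ 2 + t ^+ 2 != 0 by rewrite lt0r_neq0// ltr_pwDl ?exprn_gt0// sqr_ge0.
rewrite ge0_integral_fold; last 2 first.
- apply: measurable_fun_ifT => //.
    by apply: measurable_fun_ler => //; exact: normr_measurable.
  exact: continuous_measurable_fun (continuous_poisson e0).
- by move=> x; case: ifP => // _; exact: poisson_ge0.
pose f t := 2 * poisson e t.
transitivity (\int[leb]_(t in `[a, +oo[) (f t)%:E)%E.
  rewrite [LHS]integral_mkcond [RHS]integral_mkcond; apply: eq_integral => t _.
  rewrite !patchE !mem_setE !in_itv/= !andbT normrN /f /poisson sqrrN.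
  have [t0|t0] := leP 0 t; last by rewrite ifF//; apply/negbTE; rewrite -ltNge (lt_le_trans t0).
  rewrite ger0_norm//; case: ifP => _; congr EFin; last by rewrite addr0.
  by ring.
pose F t := 2 / pi * atan (e^-1 * t).
have dF (x : R) : is_derive x (1 : R) F (f x).
  have dA : is_derive x (1 : R) (fun t => atan (e^-1 * t))
     ((1 + (e^-1 * x) ^+ 2)^-1 * e^-1).
    apply: (@is_derive1_comp _ atan (fun t => e^-1 * t)).
    exact: is_derive_mull.
  apply: (is_derive_eq (is_deriveZ (2 / pi) dA)); rewrite /f /poisson /GRing.scale/=.
  have := e2 x => ex; have -> : 1 + (e^-1 * x) ^+ 2 = (e ^+ 2 + x ^+ 2) / e ^+ 2.
    by field; exact: lt0r_neq0.
  move: (@pi R) (lt0r_neq0 pi0) => p pn.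
  by field; rewrite ex pn lt0r_neq0.
have cf : continuous f.
  by move=> x; apply: cvgM; [exact: cvg_cst|exact: continuous_poisson].
have f0 x : a <= x -> 0 <= f x by move=> _; rewrite mulr_ge0// poisson_ge0.
have Fl : F x @[x --> +oo] --> (1 : R).
  rewrite -[X in _ --> X](_ : 2 / pi * (pi / 2) = 1); last first.
    by rewrite mulrA divfK ?lt0r_neq0// divff.
  apply: cvgM; first exact: cvg_cst.
  apply: (cvg_comp _ _ _ (@cvgy_atan R)); apply: gt0_cvgMry => //.
  by rewrite invr_gt0.
by rewrite (ge0_integral_is_derivey dF cf f0 Fl) /F (mulrC a).
Qed.

End one_dimensional.

(** * Fourier transform of the window *)
Section fourier_kernels.
Variables (R : realType).
Implicit Types n : nat.

Definition dot n (z x : 'rV[R]_n) : R := \sum_(i < n) z ord0 i * x ord0 i.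

(** A summability factor, chosen for its explicit nonnegative Fourier transform. *)
Definition window (e : R) n (z : 'rV[R]_n) : R := \prod_(i < n) expR (- (e * `|z ord0 i|)).

Definition poisson_rV (e : R) n (w : 'rV[R]_n) : R := \prod_(i < n) poisson e (w ord0 i).

Lemma window_gt0 e n (z : 'rV[R]_n) : 0 < window e z.
Proof. by apply: prodr_gt0 => i _; exact: expR_gt0. Qed.

Lemma poisson_rV_ge0 e n (w : 'rV[R]_n) : 0 < e -> 0 <= poisson_rV e w.
Proof. by move=> e0; apply: prodr_ge0 => i _; exact: poisson_ge0. Qed.

Lemma measurable_expRN e : measurable_fun [set: R] (fun t : R => expR (- (e * `|t|))).
Proof.
apply: measurableT_comp => //; apply: measurableT_comp; first exact: measurable_oppr.
by apply: measurable_funM => //; exact: normr_measurable.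
Qed.

Lemma measurable_window e n : measurable_fun [set: 'rV[R]_n] (@window e n).
Proof.
apply: measurable_prod => i _.
by apply: (measurableT_comp (measurable_expRN e)); exact: measurable_coord.
Qed.

Lemma measurable_poisson_rV e n : 0 < e -> measurable_fun [set: 'rV[R]_n] (@poisson_rV e n).
Proof.
move=> e0; apply: measurable_prod => i _.
apply: (measurableT_comp (continuous_measurable_fun (continuous_poisson e0))).
exact: measurable_coord.
Qed.

Lemma dotC n (z x : 'rV[R]_n) : dot z x = dot x z.
Proof. by apply: eq_bigr => i _; exact: mulrC. Qed.

Lemma dotDr n (z x y : 'rV[R]_n) : dot z (x + y) = dot z x + dot z y.
Proof. by rewrite /dot -big_split; apply: eq_bigr => i _; rewrite mxE mulrDr. Qed.

Lemma dotZr n (z x : 'rV[R]_n) c : dot z (c *: x) = c * dot z x.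
Proof. by rewrite /dot mulr_sumr; apply: eq_bigr => i _; rewrite mxE mulrCA. Qed.

Lemma dotNr n (z x : 'rV[R]_n) : dot z (- x) = - dot z x.
Proof. by rewrite -scaleN1r dotZr mulN1r. Qed.

Lemma dotBr n (z x y : 'rV[R]_n) : dot z (x - y) = dot z x - dot z y.
Proof. by rewrite dotDr dotNr. Qed.

Lemma dotBl n (z x y : 'rV[R]_n) : dot (x - y) z = dot x z - dot y z.
Proof. by rewrite !(dotC _ z) dotBr. Qed.

Lemma dot_cons n (t : R) (z : 'rV[R]_n) (w : 'rV[R]_n.+1) :
  dot (cons_rV (t, z)) w = w ord0 ord0 * t + dot z (\row_i w ord0 (lift ord0 i)).
Proof.
rewrite /dot big_ord_recl mxE unlift_none/= mulrC; congr (_ + _).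
by apply: eq_bigr => i _; rewrite !mxE liftK.
Qed.

Lemma measurable_dot n d (T : measurableType d) (f g : T -> 'rV[R]_n) :
  measurable_fun [set: T] f -> measurable_fun [set: T] g ->
  measurable_fun [set: T] (fun p => dot (f p) (g p)).
Proof.
move=> mf mg; apply: measurable_sum => i; apply: measurable_funM.
- exact: (measurableT_comp (measurable_coord i) mf).
- exact: (measurableT_comp (measurable_coord i) mg).
Qed.

Lemma measurable_cos : measurable_fun [set: R] (@cos R).
Proof. exact: continuous_measurable_fun (@continuous_cos R). Qed.

Lemma measurable_sin : measurable_fun [set: R] (@sin R).
Proof. exact: continuous_measurable_fun (@continuous_sin R). Qed.

Lemma oneDcos_ge0 (x : R) : 0 <= 1 + cos x.
Proof. by have := cos_geN1 x; lra. Qed.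

(** The nonnegative form of the Fourier transform of the window. The phase al is
what makes the induction on the dimension work: for a fixed first coordinate the
integrand has the same form in the others, with a phase depending on the first one. *)
Lemma integral_window_cos (e al : R) n (w : 'rV[R]_n) : 0 < e ->
  (\int[lebesgue_rV R n]_z (window e z * (1 + cos (dot z w + al)))%:E =
   ((2 / e) ^+ n + cos al * ((2 * pi) ^+ n * poisson_rV e w))%:E)%E.
Proof.
move=> e0; pose c (w : R) := 2 * e / (e ^+ 2 + w ^+ 2).
have ew v : 0 < e ^+ 2 + v ^+ 2 by rewrite ltr_pwDl ?exprn_gt0// sqr_ge0.
have c0 v : 0 <= c v by rewrite /c divr_ge0// ?mulr_ge0 ?(ltW e0)// ltW.
have ce v : c v <= 2 / e.
  rewrite /c ler_pdivrMr// mulrAC ler_pdivlMr// -mulrA ler_wpM2l// -expr2.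
  by rewrite lerDl sqr_ge0.
have -> : (2 * pi) ^+ n * poisson_rV e w = \prod_(i < n) c (w ord0 i).
  rewrite (_ : (2 * pi) ^+ n = \prod_(i < n) (2 * pi)); last by rewrite prodr_const card_ord.
  rewrite /poisson_rV -big_split/=.
  apply: eq_bigr => i _; rewrite /c /poisson.
  have := lt0r_neq0 (@pi_gt0 R); have := lt0r_neq0 (ew (w ord0 i)).
  by move: (@pi R) => p ? pn; field; exact/andP.
elim: n al w => [|n IH] al w.
  rewrite integral_rV0; last first.
    by move=> x; rewrite lee_fin mulr_ge0// ?oneDcos_ge0// ltW// window_gt0.
  by rewrite /window /dot !big_ord0 expr0 mul1r add0r mulr1.
have mW m (v : 'rV[R]_m) be : measurable_fun [set: 'rV[R]_m]
    (fun z : 'rV[R]_m => window e z * (1 + cos (dot z v + be))).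
  apply: measurable_funM; first exact: measurable_window.
  apply: measurable_funD => //; apply: (measurableT_comp measurable_cos).
  by apply: measurable_funD => //; exact: measurable_dot.
rewrite ge0_integral_cons//; last 2 first.
- by apply/measurable_EFinP; exact: mW.
- by move=> x; rewrite lee_fin mulr_ge0// ?oneDcos_ge0// ltW// window_gt0.
pose w' := \row_i w ord0 (lift ord0 i).
pose C := \prod_(i < n) c (w' ord0 i).
have C0 : 0 <= C by apply: prodr_ge0 => i _.
have Ce : C <= (2 / e) ^+ n.
  rewrite (_ : (2 / e) ^+ n = \prod_(i < n) (2 / e)); last by rewrite prodr_const card_ord.
  by apply: ler_prod => i _; rewrite c0 ce.
pose E (t : R) := expR (- (e * `|t|)).
have E0 (t : R) : 0 <= E t by exact: expR_ge0.
have mE : measurable_fun [set: R] E := measurable_expRN e.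
pose f (t : R) := E t * (1 + cos (w ord0 ord0 * t + al)).
have f0 (t : R) : 0 <= f t by rewrite mulr_ge0// oneDcos_ge0.
have mf : measurable_fun [set: R] f.
  apply: measurable_funM => //; apply: measurable_funD => //.
  apply: (measurableT_comp measurable_cos); exact: measurable_funD.
transitivity (\int[@lebesgue_measure R]_t (((2 / e) ^+ n - C) * E t + C * f t)%:E)%E.
  apply: eq_integral => t _.
  transitivity ((E t)%:E * \int[lebesgue_rV R n]_y
     (window e y * (1 + cos (dot y w' + (w ord0 ord0 * t + al))))%:E)%E.
    rewrite -integral_EFinZ//; last 2 first.
    - exact: mW.
    - by move=> x; rewrite mulr_ge0// ?oneDcos_ge0// ltW// window_gt0.
    apply: eq_integral => y _; rewrite dot_cons /window big_ord_recl mxE unlift_none/=.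
    under eq_bigr do rewrite mxE liftK/=.
    by rewrite -!mulrA; do 5 f_equal; rewrite addrCA addrA.
  by rewrite IH -EFinM; congr EFin; rewrite /f -/C; ring.
rewrite integral_EFinD//; first last.
- by move=> x; exact: mulr_ge0.
- by move=> x; rewrite mulr_ge0// subr_ge0.
- exact: measurable_funM.
- exact: measurable_funM.
rewrite !integral_EFinZ ?subr_ge0// integral_window//.
have -> : (\int[@lebesgue_measure R]_x (E x)%:E = (2 / e)%:E)%E.
  have := integral_window 0 (pi / 2) e0; rewrite cos_pihalf mul0r addr0 => <-.
  by apply: eq_integral => x _; rewrite mul0r add0r cos_pihalf addr0 mulr1.
rewrite -!EFinM -EFinD; congr EFin; rewrite big_ord_recl [(2 / e) ^+ n.+1]exprS.
rewrite -/(c (w ord0 ord0)) (_ : \prod_(i < n) _ = C); last first.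
  by apply: eq_bigr => i _; rewrite mxE.
ring.
Qed.

End fourier_kernels.

(** * Fourier transform and Plancherel's theorem *)
Lemma integrable_mull d (T : measurableType d) (R : realType)
    (m : {measure set T -> \bar R}) (c : R) (f : T -> R) :
  m.-integrable setT (EFin \o f) -> m.-integrable setT (EFin \o (fun x => c * f x)).
Proof.
move=> mf; rewrite (_ : EFin \o _ = (fun x => c%:E * (EFin \o f) x)%E); first exact: integrableZl.
by apply/funext => x; rewrite /= EFinM.
Qed.

Lemma integrable_addr d (T : measurableType d) (R : realType)
    (m : {measure set T -> \bar R}) (f g : T -> R) :
  m.-integrable setT (EFin \o f) -> m.-integrable setT (EFin \o g) ->
  m.-integrable setT (EFin \o (fun x => f x + g x)).
Proof.
move=> mf mg; rewrite (_ : EFin \o _ = ((EFin \o f) \+ (EFin \o g))%E); first exact: integrableD.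
by apply/funext => x; rewrite /= EFinD.
Qed.

Lemma integrable_normr d (T : measurableType d) (R : realType)
    (m : {measure set T -> \bar R}) (f : T -> R) :
  m.-integrable setT (EFin \o f) -> m.-integrable setT (EFin \o (fun x => `|f x|)).
Proof. exact: integrable_norm. Qed.

Lemma integrable_mul_bounded d (T : measurableType d) (R : realType)
    (m : {measure set T -> \bar R}) (f k : T -> R) (C : R) :
  m.-integrable setT (EFin \o f) -> measurable_fun [set: T] k ->
  (forall x, `|k x| <= C) -> m.-integrable setT (EFin \o (fun x => f x * k x)).
Proof.
move=> fi mk kC.
have mf : measurable_fun [set: T] f by apply/measurable_EFinP; exact: (measurable_int m).
apply: (@le_integrable _ _ _ m _ measurableT _ (EFin \o (fun y => C * f y))).
- by apply/measurable_EFinP; exact: measurable_funM.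
- move=> y _; rewrite /= lee_fin !normrM mulrC ler_wpM2r//.
  by apply: le_trans (kC _) _; exact: ler_norm.
- exact: integrable_mull.
Qed.

Lemma measurable_section1 d1 d2 d3 (T1 : measurableType d1) (T2 : measurableType d2)
    (T3 : measurableType d3) (k : T1 -> T2 -> T3) x :
  measurable_fun [set: T1 * T2] (fun p => k p.1 p.2) -> measurable_fun [set: T2] (k x).
Proof. by move=> mk; exact: (measurableT_comp mk (measurable_pair1 x)). Qed.

Section product_kernels.
Context d1 d2 (T1 : measurableType d1) (T2 : measurableType d2) (R : realType).
Variables (m1 : {sigma_finite_measure set T1 -> \bar R})
          (m2 : {sigma_finite_measure set T2 -> \bar R}).
Variables (b : T2 -> R) (k : T1 * T2 -> R) (C : R).
Hypothesis C0 : 0 <= C.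
Hypotheses (ib : m2.-integrable setT (EFin \o b)).
Hypotheses (mk : measurable_fun [set: T1 * T2] k) (kC : forall p, `|k p| <= C).

Let mb : measurable_fun [set: T2] b.
Proof. by apply/measurable_EFinP; exact: (measurable_int m2). Qed.

Let mkx x : measurable_fun [set: T2] (fun y => k (x, y)).
Proof. by apply: (measurableT_comp mk). Qed.

Lemma integrable_kernel x : m2.-integrable setT (fun y => (b y * k (x, y))%:E).
Proof.
exact: (integrable_mul_bounded ib (mkx x) (fun y => kC (x, y))).
Qed.

Lemma kernel_integral_le x :
  `|\int[m2]_y (b y * k (x, y))| <= C * \int[m2]_y `|b y|.
Proof.
have inb : m2.-integrable setT (fun y => (`|b y|)%:E) by exact: (integrable_norm ib).
apply: le_trans (le_normr_Rintegral measurableT (integrable_kernel x)) _.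
rewrite -RintegralZl//; apply: le_Rintegral => //.
- exact: (integrable_norm (integrable_kernel x)).
- exact: integrable_mull.
- by move=> y _; rewrite normrM mulrC ler_wpM2r.
Qed.

(** Tonelli gives the measurability of parametric integrals of nonnegative
functions: b k + C |b| is one, and C |b| contributes a constant. *)
Lemma measurable_kernel_integral :
  measurable_fun [set: T1] (fun x => \int[m2]_y (b y * k (x, y))).
Proof.
pose h (p : T1 * T2) : R := b p.2 * k p + C * `|b p.2|.
have h0 p : 0 <= h p.
  have : `|b p.2 * k p| <= C * `|b p.2| by rewrite normrM mulrC ler_wpM2r.
  by rewrite ler_norml /h => /andP[]; lra.
have mbp : measurable_fun [set: T1 * T2] (fun p => b p.2) by exact: measurableT_comp.
have mh : measurable_fun [set: T1 * T2] h.
  apply: measurable_funD; first exact: measurable_funM.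
  by apply: measurable_funM => //; exact: measurableT_comp.
have inb : m2.-integrable setT (fun y => (`|b y|)%:E) by exact: (integrable_norm ib).
have inb' : m2.-integrable setT (fun y => (C * `|b y|)%:E).
  exact: integrable_mull.
rewrite (_ : (fun x => _) = (fun x =>
    fine (\int[m2]_y (h (x, y))%:E) - \int[m2]_y (C * `|b y|))); last first.
  apply/funext => x; rewrite -[fine _]/(\int[m2]_y (h (x, y))) /h/=.
  by rewrite RintegralD ?addrK//; exact: integrable_kernel.
apply: measurable_funB => //; apply: measurableT_comp => //.
apply: (@measurable_fun_fubini_tonelli_F _ _ _ _ _ _ (fun p => (h p)%:E)) => //.
exact/measurable_EFinP.
Qed.

Variables (a : T1 -> R).
Hypothesis ia : m1.-integrable setT (EFin \o a).

Let ma : measurable_fun [set: T1] a.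
Proof. by apply/measurable_EFinP; exact: (measurable_int m1). Qed.

Lemma integrable_outer_kernel :
  m1.-integrable setT (fun x => (a x * \int[m2]_y (b y * k (x, y)))%:E).
Proof.
pose D := C * \int[m2]_y `|b y|.
apply: (@le_integrable _ _ _ m1 _ measurableT _ (fun x => (D * a x)%:E)).
- apply/measurable_EFinP; apply: measurable_funM => //.
  exact: measurable_kernel_integral.
- move=> x _; rewrite /= lee_fin [leRHS]normrM normrM mulrC ler_wpM2r//.
  by apply: le_trans (kernel_integral_le _) _; exact: ler_norm.
- exact: integrable_mull.
Qed.

Lemma integrable_prod_kernel :
  (m1 \x m2)%E.-integrable setT (fun p => (a p.1 * (b p.2 * k p))%:E).
Proof.
have mf : measurable_fun [set: T1 * T2] (fun p => (a p.1 * (b p.2 * k p))%:E).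
  apply/measurable_EFinP; apply: measurable_funM; first exact: measurableT_comp.
  by apply: measurable_funM => //; exact: measurableT_comp.
apply/integrable12ltyP => //.
have inb : m2.-integrable setT (fun y => (`|b y|)%:E) by exact: (integrable_norm ib).
have ina : m1.-integrable setT (fun y => (`|a y|)%:E) by exact: (integrable_norm ia).
pose D := C * \int[m2]_y `|b y|.
apply: (@le_lt_trans _ _ (\int[m1]_x (`|a x| * D)%:E)%E).
  apply: ge0_le_integral => //.
  - by move=> x _; exact: integral_ge0.
  - by apply: (@measurable_fun_fubini_tonelli_F _ _ _ _ _ _ (fun p => `|(a p.1 * (b p.2 * k p))%:E|%E)) => //; exact: measurableT_comp.
  - by apply/measurable_EFinP; apply: measurable_funM => //; exact: measurableT_comp.
  move=> x _; apply: (@le_trans _ _ (\int[m2]_y (`|a x| * (C * `|b y|))%:E)%E).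
    apply: ge0_le_integral => //.
    - apply/measurable_EFinP; apply: measurableT_comp => //=.
      by apply: measurable_funM => //; exact: measurable_funM.
    - by apply/measurable_EFinP; apply: measurable_funM => //; apply: measurable_funM => //; exact: measurableT_comp.
    by move=> y _; rewrite lee_fin !normrM (mulrC `|b y|) ler_wpM2l// ler_wpM2r.
  rewrite integral_EFinZ//; last first.
  - by move=> y; rewrite mulr_ge0.
  - by apply: measurable_funM => //; exact: measurableT_comp.
  rewrite integral_EFinZ//; last exact: measurableT_comp.
  by rewrite /D !EFinM fineK//; exact: integrable_fin_num.
under eq_integral do rewrite mulrC.
rewrite integral_EFinZ//; last exact: measurableT_comp.
  by rewrite -(fineK (integrable_fin_num measurableT ina)) -EFinM; exact: ltry.
by rewrite mulr_ge0//; exact: Rintegral_ge0.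
Qed.

Lemma prod_kernelE :
  ((\int[m1]_x (a x * \int[m2]_y (b y * k (x, y))))%:E =
   \int[m1 \x m2]_p (a p.1 * (b p.2 * k p))%:E)%E.
Proof.
rewrite -integral12_prod_meas1; last exact: integrable_prod_kernel.
rewrite fineK; last exact: (integrable_fin_num measurableT integrable_outer_kernel).
apply: eq_integral => x _; rewrite /fubini_F/=.
under eq_integral do rewrite EFinM.
rewrite integralZl//; last exact: integrable_kernel.
rewrite EFinM fineK//; exact: (integrable_fin_num measurableT (integrable_kernel x)).
Qed.

End product_kernels.

(** Fubini, in the form used for double transforms. *)
Lemma kernel_swap d1 d2 (T1 : measurableType d1) (T2 : measurableType d2) (R : realType)
    (m1 : {sigma_finite_measure set T1 -> \bar R})
    (m2 : {sigma_finite_measure set T2 -> \bar R})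
    (a : T1 -> R) (b : T2 -> R) (k : T1 -> T2 -> R) (C : R) : 0 <= C ->
  m1.-integrable setT (EFin \o a) -> m2.-integrable setT (EFin \o b) ->
  measurable_fun [set: T1 * T2] (fun p => k p.1 p.2) -> (forall x y, `|k x y| <= C) ->
  \int[m1]_x (a x * \int[m2]_y (b y * k x y)) =
  \int[m2]_y (b y * \int[m1]_x (a x * k x y)).
Proof.
move=> C0 ia ib mk kC; apply: EFin_inj.
rewrite (@prod_kernelE _ _ _ _ _ m1 m2 b (fun p => k p.1 p.2) C)//.
have mk' : measurable_fun [set: T2 * T1] (fun p => k p.2 p.1).
  exact: (measurableT_comp mk (@measurable_swap _ _ T2 T1)).
rewrite (@prod_kernelE _ _ _ _ _ m2 m1 a (fun p => k p.2 p.1) C)//.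
have i1 := @integrable_prod_kernel _ _ _ _ _ m1 m2 b _ C C0 ib mk (fun p => kC _ _) a ia.
have i2 := @integrable_prod_kernel _ _ _ _ _ m2 m1 a _ C C0 ia mk' (fun p => kC _ _) b ib.
rewrite -(integral12_prod_meas1 i2) -(integral21_prod_meas1 i1).
apply: eq_integral => y _; apply: eq_integral => x _ /=.
by rewrite mulrCA.
Qed.

Section fourier_power.
Variables (R : realType) (n : nat).
Local Notation V := 'rV[R]_n.
Local Notation mu := (lebesgue_rV R n).
Implicit Types (u : V -> R) (g : R -> R).

Lemma measurable_L1 u : mu.-integrable setT (EFin \o u) -> measurable_fun [set: V] u.
Proof. by move=> iu; apply/measurable_EFinP; exact: (measurable_int mu). Qed.

(** The Fourier transform is handled by its real and imaginary parts, the cosine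
and sine transforms (g = cos, g = sin); fpower is its squared modulus. *)
Definition ftrig g u (z : V) : R := \int[mu]_x (u x * g (dot z x)).

Definition fpower u (z : V) : R := ftrig cos u z ^+ 2 + ftrig sin u z ^+ 2.

(** The pairing of u with its Poisson mean. *)
Definition poisson_form (e : R) u : R :=
  \int[mu]_x (u x * \int[mu]_y (u y * poisson_rV e (x - y))).

Lemma integrable_window (e : R) : 0 < e -> mu.-integrable setT (EFin \o @window R e n).
Proof.
move=> e0; apply/integrableP; split; first by apply/measurable_EFinP; exact: measurable_window.
have := @integral_window_cos R e (pi / 2) n 0 e0; rewrite cos_pihalf mul0r addr0 => h.
rewrite [ltLHS](_ : _ = ((2 / e) ^+ n)%:E) ?ltry// -h; apply: eq_integral => z _.
rewrite /= ger0_norm ?(ltW (window_gt0 _ _))//.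
rewrite (_ : dot z 0 = 0) ?add0r ?cos_pihalf ?addr0 ?mulr1//.
by rewrite /dot big1// => i _; rewrite mxE mulr0.
Qed.

Lemma Rintegral_window_cos (e : R) (w : V) : 0 < e ->
  \int[mu]_z (window e z * cos (dot z w)) = (2 * pi) ^+ n * poisson_rV e w.
Proof.
move=> e0; have iW := integrable_window e0.
have mc : measurable_fun [set: V] (fun z => cos (dot z w)).
  by apply: (measurableT_comp (@measurable_cos R)); exact: measurable_dot.
have iWc : mu.-integrable setT (EFin \o (fun z => window e z * cos (dot z w))).
  apply: (@integrable_mul_bounded _ _ _ mu _ _ 1) => // z.
  by rewrite ler_norml cos_geN1 cos_le1.
have h be := @integral_window_cos R e be n w e0.
have H : \int[mu]_z (window e z + window e z * cos (dot z w)) =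
    (2 / e) ^+ n + (2 * pi) ^+ n * poisson_rV e w.
  have := h 0; rewrite cos0 mul1r => /(congr1 fine)/= <-; congr fine.
  by apply: eq_integral => z _; rewrite addr0 mulrDr mulr1.
rewrite RintegralD// in H.
have H0 : \int[mu]_z (window e z) = (2 / e) ^+ n.
  have := @integral_window_cos R e (pi / 2) n 0 e0; rewrite cos_pihalf mul0r addr0.
  move=> /(congr1 fine)/= <-; congr fine; apply: eq_integral => z _.
  rewrite (_ : dot z 0 = 0) ?add0r ?cos_pihalf ?addr0 ?mulr1//.
  by rewrite /dot big1// => i _; rewrite mxE mulr0.
by move: H; rewrite H0 => /addrI.
Qed.

Lemma measurable_ftrig g u : measurable_fun [set: R] g -> (forall t, `|g t| <= 1) ->
  mu.-integrable setT (EFin \o u) -> measurable_fun [set: V] (ftrig g u).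
Proof.
move=> mg g1 iu.
apply: (@measurable_kernel_integral _ _ _ _ _ mu u (fun p => g (dot p.1 p.2)) 1) => //.
by apply: (measurableT_comp mg); exact: measurable_dot.
Qed.

Lemma ftrig_le g u z : measurable_fun [set: R] g -> (forall t, `|g t| <= 1) ->
  mu.-integrable setT (EFin \o u) -> `|ftrig g u z| <= \int[mu]_x `|u x|.
Proof.
move=> mg g1 iu; rewrite -[leRHS]mul1r.
apply: (@kernel_integral_le _ _ V V _ mu u (fun p => g (dot p.1 p.2)) 1) => //.
by apply: (measurableT_comp mg); exact: measurable_dot.
Qed.

Lemma window_ftrig2 g u (e : R) : 0 < e -> measurable_fun [set: R] g ->
  (forall t, `|g t| <= 1) -> mu.-integrable setT (EFin \o u) ->
  \int[mu]_z (window e z * ftrig g u z ^+ 2) =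
  \int[mu]_x (u x * \int[mu]_y (u y *
     \int[mu]_z (window e z * (g (dot z x) * g (dot z y))))).
Proof.
move=> e0 mg g1 iu; have iW := integrable_window e0.
pose A := \int[mu]_x `|u x|.
have A0 : 0 <= A by exact: Rintegral_ge0.
have mgd : measurable_fun [set: V * V] (fun p => g (dot p.1 p.2)).
  by apply: (measurableT_comp mg); exact: measurable_dot.
have mgx x : measurable_fun [set: V] (fun z => g (dot z x)).
  by apply: (measurableT_comp mg); exact: measurable_dot.
have mgz z : measurable_fun [set: V] (fun x => g (dot z x)).
  by apply: (measurableT_comp mg); exact: measurable_dot.
have iug z : mu.-integrable setT (EFin \o (fun x => u x * g (dot z x))).
  exact: (integrable_mul_bounded iu (mgz z)).
transitivity (\int[mu]_z (window e z * \int[mu]_x (u x * (g (dot z x) * ftrig g u z)))).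
  apply: eq_Rintegral => z _; congr (_ * _); rewrite expr2 {1}/ftrig -RintegralZr//.
  by apply: eq_Rintegral => x _; rewrite mulrA.
have mk1 : measurable_fun [set: V * V] (fun p => g (dot p.1 p.2) * ftrig g u p.1).
  apply: measurable_funM => //.
  exact: (measurableT_comp (measurable_ftrig mg g1 iu)).
have k1 (z x : V) : `|g (dot z x) * ftrig g u z| <= A.
  by rewrite normrM -[leRHS]mul1r ler_pM//; exact: ftrig_le.
rewrite (kernel_swap A0 iW iu mk1 k1).
apply: eq_Rintegral => x _; congr (_ * _).
transitivity (\int[mu]_z (window e z * \int[mu]_y (u y * (g (dot z x) * g (dot z y))))).
  apply: eq_Rintegral => z _; congr (_ * _); rewrite /ftrig -RintegralZl//.
  by apply: eq_Rintegral => y _; rewrite mulrCA.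
have mk2 : measurable_fun [set: V * V] (fun p => g (dot p.1 x) * g (dot p.1 p.2)).
  by apply: measurable_funM => //; exact: (measurableT_comp (mgx x)).
have k2 (z y : V) : `|g (dot z x) * g (dot z y)| <= 1 by rewrite normrM mulr_ile1.
exact: (kernel_swap ler01 iW iu mk2 k2).
Qed.

Lemma poisson_rV_le (e : R) (w : V) : 0 < e -> poisson_rV e w <= (e * pi)^-1 ^+ n.
Proof.
move=> e0; rewrite (_ : _ ^+ n = \prod_(i < n) (e * pi)^-1); last by rewrite prodr_const card_ord.
apply: ler_prod => i _; rewrite poisson_ge0//= /poisson.
move: (@pi R) (@pi_gt0 R) => p p0.
rewrite ler_pdivrMr; last by rewrite ltr_pwDl ?exprn_gt0// sqr_ge0.
have -> : e / p = (e * p)^-1 * e ^+ 2 by field; rewrite !lt0r_neq0.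
by rewrite ler_wpM2l ?invr_ge0 ?mulr_ge0 ?(ltW e0) ?(ltW p0)// lerDl sqr_ge0.
Qed.

Lemma measurable_poisson_sub (e : R) : 0 < e ->
  measurable_fun [set: V * V] (fun p => poisson_rV e (p.1 - p.2)).
Proof.
move=> e0; have mB : measurable_fun [set: V * V] (fun p : V * V => p.1 - p.2 : V).
  apply: measurable_fun_rV => i; under eq_fun do rewrite !mxE.
  apply: measurable_funB.
    exact: (measurableT_comp (measurable_coord i) measurable_fst).
  exact: (measurableT_comp (measurable_coord i) measurable_snd).
have mP := @measurable_poisson_rV R e n e0.
exact: (measurableT_comp mP mB).
Qed.

Lemma cos_le1_norm (t : R) : `|cos t| <= 1.
Proof. by rewrite ler_norml cos_geN1 cos_le1. Qed.

Lemma sin_le1_norm (t : R) : `|sin t| <= 1.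
Proof. by rewrite ler_norml sin_geN1 sin_le1. Qed.

Lemma measurable_fpower u : mu.-integrable setT (EFin \o u) ->
  measurable_fun [set: V] (fpower u).
Proof.
move=> iu; apply: measurable_funD; apply: measurable_funX; apply: measurable_ftrig => //.
- exact: measurable_cos.
- exact: cos_le1_norm.
- exact: measurable_sin.
- exact: sin_le1_norm.
Qed.

Lemma fpower_ge0 u z : 0 <= fpower u z.
Proof. by rewrite addr_ge0 ?sqr_ge0. Qed.

(** Expanding the two squares and swapping integrals leaves, between x and y, the
integral of window e z * cos (z . (x - y)), i.e. the Poisson kernel. *)
Lemma window_fpower u (e : R) : 0 < e -> mu.-integrable setT (EFin \o u) ->
  (\int[mu]_z (window e z * fpower u z)%:E = ((2 * pi) ^+ n * poisson_form e u)%:E)%E.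
Proof.
move=> e0 iu; have iW := integrable_window e0.
have mcos := @measurable_cos R; have msin := @measurable_sin R.
pose A := \int[mu]_x `|u x|.
have A0 : 0 <= A by exact: Rintegral_ge0.
have gen g : measurable_fun [set: R] g -> (forall t, `|g t| <= 1) ->
    mu.-integrable setT (EFin \o (fun z => window e z * ftrig g u z ^+ 2)).
  move=> mg g1; apply: (@integrable_mul_bounded _ _ _ mu _ _ (A ^+ 2)) => //.
    by apply: measurable_funX; exact: measurable_ftrig.
  by move=> z; rewrite normrX lerXn2r ?nnegrE//; exact: ftrig_le.
have mgd g : measurable_fun [set: R] g -> measurable_fun [set: V * V] (fun p => g (dot p.1 p.2)).
  by move=> mg; apply: (measurableT_comp mg); exact: measurable_dot.
pose K g (x y : V) := \int[mu]_z (window e z * (g (dot z x) * g (dot z y))).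
have mK g : measurable_fun [set: R] g -> (forall t, `|g t| <= 1) ->
    measurable_fun [set: V * V] (fun p => K g p.1 p.2) /\
    exists2 C : R, 0 <= C & forall x y, `|K g x y| <= C.
  move=> mg g1.
  have mgg : measurable_fun [set: (V * V) * V] (fun p => g (dot p.2 p.1.1) * g (dot p.2 p.1.2)).
    apply: measurable_funM; apply: (measurableT_comp mg); apply: measurable_dot => //.
      exact: measurableT_comp.
    exact: measurableT_comp.
  have gg1 (p : (V * V) * V) : `|g (dot p.2 p.1.1) * g (dot p.2 p.1.2)| <= 1.
    by rewrite normrM mulr_ile1.
  split; first exact: (measurable_kernel_integral iW mgg gg1).
  exists (1 * \int[mu]_z `|window e z|).
    by rewrite mul1r; exact: Rintegral_ge0.
  move=> x y.
  exact: (kernel_integral_le iW mgg gg1 (x, y)).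
have [mKc [Cc Cc0 KcC]] := mK cos mcos cos_le1_norm.
have [mKs [Cs Cs0 KsC]] := mK sin msin sin_le1_norm.
have mKx g x : measurable_fun [set: V * V] (fun p => K g p.1 p.2) ->
   measurable_fun [set: V] (K g x).
  exact: measurable_section1.
have iK g x C : measurable_fun [set: V * V] (fun p => K g p.1 p.2) ->
    (forall x y, `|K g x y| <= C) ->
    mu.-integrable setT (EFin \o (fun y => u y * K g x y)).
  by move=> mKg KC; exact: (integrable_mul_bounded iu (mKx _ x mKg) (KC x)).
have iKK g C : 0 <= C -> measurable_fun [set: V * V] (fun p => K g p.1 p.2) ->
    (forall x y, `|K g x y| <= C) ->
    mu.-integrable setT (EFin \o (fun x => u x * \int[mu]_y (u y * K g x y))).
  move=> C0 mKg KC.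
  exact: (@integrable_outer_kernel _ _ _ _ _ mu mu u (fun p => K g p.1 p.2) C).
transitivity (\int[mu]_z (window e z * ftrig cos u z ^+ 2 + window e z * ftrig sin u z ^+ 2))%:E.
  rewrite fineK; last first.
    apply: integrable_fin_num => //.
    exact: (integrable_addr (gen cos mcos cos_le1_norm) (gen sin msin sin_le1_norm)).
  by apply: eq_integral => z _; rewrite -mulrDr.
congr EFin.
rewrite (RintegralD measurableT (gen cos mcos cos_le1_norm) (gen sin msin sin_le1_norm)).
rewrite (window_ftrig2 e0 mcos cos_le1_norm iu) (window_ftrig2 e0 msin sin_le1_norm iu).
rewrite -(RintegralD measurableT (iKK cos Cc Cc0 mKc KcC) (iKK sin Cs Cs0 mKs KsC)).
pose D := (e * pi)^-1 ^+ n : R.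
have mP := measurable_poisson_sub e0.
have PD (x y : V) : `|poisson_rV e (x - y)| <= D.
  by rewrite ger0_norm ?poisson_rV_ge0// poisson_rV_le.
have D0 : 0 <= D by rewrite exprn_ge0// invr_ge0 mulr_ge0 ?pi_ge0// ltW.
have iP x : mu.-integrable setT (EFin \o (fun y => u y * poisson_rV e (x - y))).
  exact: (@integrable_kernel _ _ V V _ mu u _ D iu mP (fun p => PD p.1 p.2) x).
have iO := @integrable_outer_kernel _ _ _ _ _ mu mu u _ D iu mP (fun p => PD p.1 p.2) u iu.
rewrite /poisson_form -(RintegralZl _ measurableT iO).
apply: eq_Rintegral => x _; rewrite -mulrDr [RHS]mulrCA; congr (_ * _).
rewrite -(RintegralZl _ measurableT (iP x)).
rewrite -(RintegralD measurableT (iK cos x Cc mKc KcC) (iK sin x Cs mKs KsC)).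
apply: eq_Rintegral => y _; rewrite -mulrDr [RHS]mulrCA; congr (_ * _).
have iWg g : measurable_fun [set: R] g -> (forall t, `|g t| <= 1) ->
    mu.-integrable setT (EFin \o (fun z => window e z * (g (dot z x) * g (dot z y)))).
  move=> mg g1; apply: (@integrable_mul_bounded _ _ _ mu _ _ 1) => //.
    by apply: measurable_funM; apply: (measurableT_comp mg); exact: measurable_dot.
  by move=> z; rewrite normrM mulr_ile1.
rewrite -Rintegral_window_cos//.
rewrite -(RintegralD measurableT (iWg cos mcos cos_le1_norm) (iWg sin msin sin_le1_norm)).
by apply: eq_Rintegral => z _; rewrite dotBr cosB mulrDr.
Qed.

End fourier_power.

Section poisson_limits.
Variables (R : realType) (n : nat).
Local Notation V := 'rV[R]_n.
Local Notation mu := (lebesgue_rV R n).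
Implicit Types (u f : V -> R).

Lemma poissonN (e t : R) : poisson e (- t) = poisson e t.
Proof. by rewrite /poisson sqrrN. Qed.

Lemma poisson_subC (e : R) (x y : V) : poisson_rV e (x - y) = poisson_rV e (y - x).
Proof.
by apply: eq_bigr => i _; rewrite !mxE -opprB poissonN.
Qed.

Lemma integral_poisson_prod (e : R) (x : V) (b : 'I_n -> R -> bool) (c : 'I_n -> R) :
  0 < e -> (forall i, measurable_fun [set: R] (b i)) -> (forall i t, b i (- t) = b i t) ->
  (forall i, \int[@lebesgue_measure R]_t (if b i t then poisson e t else 0)%:E = (c i)%:E)%E ->
  (\int[mu]_y (\prod_(i < n) if b i (x ord0 i - y ord0 i)
     then poisson e (x ord0 i - y ord0 i) else 0)%:E = (\prod_(i < n) c i)%:E)%E.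
Proof.
move=> e0 mb bN bc.
pose g i (t : R) := if b i t then poisson e t else 0.
have mg i : measurable_fun [set: R] (g i).
  by apply: measurable_fun_ifT => //; exact: continuous_measurable_fun (continuous_poisson e0).
have g0 i t : 0 <= g i t by rewrite /g; case: ifP => // _; exact: poisson_ge0.
rewrite -(integral_prod_rV mg g0 bc) (@integral_affine _ _ _ x 1)//; first last.
- by move=> y; rewrite lee_fin; apply: prodr_ge0 => i _; exact: (g0 i).
- apply/measurable_EFinP; apply: measurable_prod => i _.
  apply: (measurableT_comp (mg i)); apply: measurable_funB => //; exact: measurable_coord.
rewrite expr1n mul1e; apply: eq_integral => y _; congr EFin; apply: eq_bigr => i _.
by rewrite !mxE mul1r opprD addNKr /g poissonN bN.
Qed.

Lemma integral_poisson_sub (e : R) (x : V) : 0 < e ->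
  (\int[mu]_y (poisson_rV e (x - y))%:E = 1)%E.
Proof.
move=> e0.
have := @integral_poisson_prod e x (fun _ _ => true) (fun=> 1) e0.
rewrite big1// => <- //.
  by apply: eq_integral => y _; congr EFin; apply: eq_bigr => i _; rewrite !mxE.
move=> _; have := @integral_poisson_tail R e 0 e0 (lexx 0).
rewrite mul0r atan0 mulr0 subr0 => <-.
by apply: eq_integral => t _; rewrite normr_ge0.
Qed.

Lemma integral_poisson_sub_tail (e d : R) (x : V) (j : 'I_n) : 0 < e -> 0 <= d ->
  (\int[mu]_y (if (d <= `|x ord0 j - y ord0 j|)%R then poisson_rV e (x - y) else 0)%:E =
   (1 - 2 / pi * atan (d / e))%:E)%E.
Proof.
move=> e0 d0.
pose b (i : 'I_n) (t : R) := (i == j) ==> (d <= `|t|).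
pose c (i : 'I_n) : R := if i == j then 1 - 2 / pi * atan (d / e) else 1.
have := @integral_poisson_prod e x b c e0.
have -> : \prod_(i < n) c i = 1 - 2 / pi * atan (d / e).
  by rewrite (bigD1 j)//= big1 ?mulr1 /c ?eqxx// => i /negbTE ->.
move=> <-.
- apply: eq_integral => y _; congr EFin; rewrite /b.
  case: ifPn => dx.
    apply: eq_bigr => i _; rewrite !mxE; case: eqP => [->/=|//]; by rewrite dx.
  by apply/esym; rewrite (bigD1 j)//= eqxx/= (negbTE dx) mul0r.
- move=> i; rewrite /b; case: eqP => _ //=.
  by apply: measurable_fun_ler => //; exact: normr_measurable.
- by move=> i t; rewrite /b normrN.
- move=> i; rewrite /b /c; case: eqP => _ /=.
    exact: integral_poisson_tail.
  have := @integral_poisson_tail R e 0 e0 (lexx 0).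
  rewrite mul0r atan0 mulr0 subr0 => <-.
  by apply: eq_integral => t _; rewrite normr_ge0.
Qed.

Lemma measurable_poisson_section (e : R) (x : V) : 0 < e ->
  measurable_fun [set: V] (fun y => poisson_rV e (x - y)).
Proof.
move=> e0; have mP := @measurable_poisson_rV R e n e0.
have mB : measurable_fun [set: V] (fun y : V => x - y : V).
  apply: measurable_fun_rV => i; under eq_fun do rewrite !mxE.
  by apply: measurable_funB => //; exact: measurable_coord.
exact: (measurableT_comp mP mB).
Qed.

(** Schur test: u x * u y <= (u x ^2 + u y ^2) / 2 and the kernel has mass 1 in
each variable. *)
Lemma poisson_form_le (e : R) u : 0 < e -> mu.-integrable setT (EFin \o u) ->
  ((poisson_form e u)%:E <= \int[mu]_x (u x ^+ 2)%:E)%E.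
Proof.
move=> e0 iu; have mu_ := measurable_L1 iu.
have mP := @measurable_poisson_sub R n e e0.
pose D := (e * pi)^-1 ^+ n : R.
have PD (p : V * V) : `|poisson_rV e (p.1 - p.2)| <= D.
  by rewrite ger0_norm ?poisson_rV_ge0// poisson_rV_le.
have D0 : 0 <= D by rewrite exprn_ge0// invr_ge0 mulr_ge0 ?pi_ge0// ltW.
have P0 (x y : V) : 0 <= poisson_rV e (x - y) by exact: poisson_rV_ge0.
have mu1 : measurable_fun [set: V * V] (fun p => u p.1) by exact: (measurableT_comp mu_).
have mu2 : measurable_fun [set: V * V] (fun p => u p.2) by exact: (measurableT_comp mu_).
pose G (p : V * V) := 2^-1 * (u p.1 ^+ 2 * poisson_rV e (p.1 - p.2)) + 2^-1 * (u p.2 ^+ 2 * poisson_rV e (p.1 - p.2)).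
have G10 p : 0 <= u p.1 ^+ 2 * poisson_rV e (p.1 - p.2) by rewrite mulr_ge0 ?sqr_ge0.
have G20 p : 0 <= u p.2 ^+ 2 * poisson_rV e (p.1 - p.2) by rewrite mulr_ge0 ?sqr_ge0.
have mG1 : measurable_fun [set: V * V] (fun p => u p.1 ^+ 2 * poisson_rV e (p.1 - p.2)).
  by apply: measurable_funM => //; exact: measurable_funX.
have mG2 : measurable_fun [set: V * V] (fun p => u p.2 ^+ 2 * poisson_rV e (p.1 - p.2)).
  by apply: measurable_funM => //; exact: measurable_funX.
have half0 : 0 <= 2^-1 :> R by rewrite invr_ge0.
have PE1 : (\int[mu \x mu]_p (u p.1 ^+ 2 * poisson_rV e (p.1 - p.2))%:E =
    \int[mu]_x (u x ^+ 2)%:E)%E.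
  rewrite (fubini_tonelli1 (m1 := mu) (m2 := mu)
    (fun p => (u p.1 ^+ 2 * poisson_rV e (p.1 - p.2))%:E)); last 2 first.
  - exact/measurable_EFinP.
  - by move=> p; rewrite lee_fin.
  apply: eq_integral => x _; rewrite /fubini_F/= integral_EFinZ ?sqr_ge0//.
    by rewrite integral_poisson_sub// mule1.
  exact: measurable_poisson_section.
have PE2 : (\int[mu \x mu]_p (u p.2 ^+ 2 * poisson_rV e (p.1 - p.2))%:E =
    \int[mu]_x (u x ^+ 2)%:E)%E.
  rewrite (fubini_tonelli1 (m1 := mu) (m2 := mu)
    (fun p => (u p.2 ^+ 2 * poisson_rV e (p.1 - p.2))%:E)); last 2 first.
  - exact/measurable_EFinP.
  - by move=> p; rewrite lee_fin.
  rewrite /fubini_F/= (fubini_tonelli (m1 := mu) (m2 := mu)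
    (fun p => (u p.2 ^+ 2 * poisson_rV e (p.1 - p.2))%:E)); last 2 first.
  - exact/measurable_EFinP.
  - by move=> p; rewrite lee_fin.
  apply: eq_integral => y _ /=; rewrite integral_EFinZ ?sqr_ge0//.
    under eq_integral do rewrite poisson_subC.
    by rewrite integral_poisson_sub// mule1.
  under eq_fun do rewrite poisson_subC.
  exact: measurable_poisson_section.
have -> : ((poisson_form e u)%:E =
    \int[mu \x mu]_p (u p.1 * (u p.2 * poisson_rV e (p.1 - p.2)))%:E)%E.
  exact: (prod_kernelE D0 iu mP PD iu).
have half : (\int[mu]_x (u x ^+ 2)%:E = \int[mu \x mu]_p (G p)%:E)%E.
  rewrite integral_EFinD//; try exact: measurable_funM; try by move=> p; rewrite mulr_ge0.
  rewrite !integral_EFinZ// PE1 PE2 -ge0_muleDl//.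
  by rewrite -EFinD (_ : 2^-1 + 2^-1 = 1) ?mul1e//; field.
rewrite half.
have iF := integrable_prod_kernel D0 iu mP PD iu.
apply: le_trans (lee_abs _) _; apply: le_trans (le_abse_integral _ measurableT (measurable_int _ iF)) _.
apply: ge0_le_integral => //.
- by apply: measurableT_comp => //; exact: (measurable_int _ iF).
- by apply/measurable_EFinP; apply: measurable_funD; exact: measurable_funM.
move=> p _; rewrite /= lee_fin /G -mulrDr -mulrDl (mulrA 2^-1) (mulrA (u p.1)) normrM.
rewrite (ger0_norm (P0 _ _)) ler_wpM2r// ler_norml.
have := sqr_ge0 (u p.1 - u p.2); have := sqr_ge0 (u p.1 + u p.2).
by move=> h1 h2; apply/andP; split; nra.
Qed.

(** The kernel has mass 1; near x the function f is within eta of f x, and the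
complement of a cube around x is covered by n slabs, each carrying the
one-dimensional tail. *)
Lemma poisson_mean_dist (f : V -> R) (C : R) (e d : R) (x : V) (eta : R) :
  measurable_fun [set: V] f -> (forall y, `|f y| <= C) -> 0 < e -> 0 < d -> 0 <= eta ->
  (forall y : V, (forall i, `|x ord0 i - y ord0 i| < d) -> `|f y - f x| <= eta) ->
  `|\int[mu]_y (f y * poisson_rV e (x - y)) - f x| <=
    eta + 2 * C * n%:R * (1 - 2 / pi * atan (d / e)).
Proof.
move=> mf fC e0 d0 eta0 fx.
have C0 : 0 <= C by apply: le_trans (fC x).
have mP : measurable_fun [set: V] (fun y => poisson_rV e (x - y)).
  exact: measurable_poisson_section.
have P0 y : 0 <= poisson_rV e (x - y) by exact: poisson_rV_ge0.
have P1 := integral_poisson_sub x e0.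
have iP : mu.-integrable setT (EFin \o (fun y => poisson_rV e (x - y))).
  apply/integrableP; split; first exact/measurable_EFinP.
  under eq_integral do rewrite /= ger0_norm//.
  by rewrite P1 ltry.
have RP1 : \int[mu]_y poisson_rV e (x - y) = 1 by rewrite /Rintegral P1.
have ifP : mu.-integrable setT (EFin \o (fun y => f y * poisson_rV e (x - y))).
  under eq_fun do rewrite mulrC.
  exact: (integrable_mul_bounded iP mf fC).
have i1 : mu.-integrable setT (EFin \o (fun y => f x * poisson_rV e (x - y))).
  exact: integrable_mull.
have -> : \int[mu]_y (f y * poisson_rV e (x - y)) - f x =
    \int[mu]_y (f y * poisson_rV e (x - y) - f x * poisson_rV e (x - y)).
  by rewrite RintegralB// RintegralZl// RP1 mulr1.
have iB : mu.-integrable setT (EFin \o (fun y => f y * poisson_rV e (x - y) - f x * poisson_rV e (x - y))).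
  under eq_fun do rewrite -mulrBl mulrC.
  apply: (@integrable_mul_bounded _ _ _ mu _ _ (C + C)) => //; first exact: measurable_funB.
  by move=> y; apply: le_trans (ler_normB _ _) _; exact: lerD.
apply: le_trans (le_normr_Rintegral measurableT iB) _.
pose t (i : 'I_n) (y : V) : R := if (d <= `|x ord0 i - y ord0 i|)%R then poisson_rV e (x - y) else 0.
have t0 i (y : V) : 0 <= t i y.
  by rewrite /t; case: (leP d) => _; [exact: P0|exact: lexx].
have mt i : measurable_fun [set: V] (t i).
  apply: measurable_fun_ifT => //; apply: measurable_fun_ler => //.
  apply: measurableT_comp; first exact: normr_measurable.
  by apply: measurable_funB => //; exact: measurable_coord.
have mS : measurable_fun [set: V] (fun y => \sum_(i < n) t i y) by exact: measurable_sum.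
have S0 y : 0 <= \sum_(i < n) t i y by exact: sumr_ge0.
have IS : (\int[mu]_y (\sum_(i < n) t i y)%:E = (n%:R * (1 - 2 / pi * atan (d / e)))%:E)%E.
  under eq_integral do rewrite -sumEFin.
  rewrite ge0_integral_sum//; last 2 first.
  - by move=> i; exact/measurable_EFinP.
  - by move=> i y _; rewrite lee_fin.
  under eq_bigr do rewrite integral_poisson_sub_tail ?(ltW d0)//.
  by rewrite sumEFin sumr_const card_ord (mulr_natl _ n).
have inB := integrable_normr iB.
rewrite -lee_fin /Rintegral fineK; last exact: (integrable_fin_num measurableT inB).
apply: (@le_trans _ _ (\int[mu]_y (eta * poisson_rV e (x - y) + (2 * C) * \sum_(i < n) t i y)%:E)%E); last first.
  rewrite integral_EFinD; first last.
  - by move=> y; rewrite !mulr_ge0.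
  - by move=> y; rewrite mulr_ge0.
  - exact: measurable_funM.
  - exact: measurable_funM.
  rewrite !integral_EFinZ ?mulr_ge0// P1 IS mule1 -EFinM -EFinD lee_fin.
  by rewrite !mulrA.
apply: le_integral_EFin.
- by apply/measurable_EFinP; exact: (measurable_int mu inB).
- by apply: measurable_funD; exact: measurable_funM.
move=> y; rewrite normr_ge0/= -mulrBl normrM (ger0_norm (P0 y)).
have [ye|/existsNP[i /negP]] := pselect (forall i, `|x ord0 i - y ord0 i| < d).
  rewrite -[leLHS]addr0; apply: lerD; last by rewrite !mulr_ge0.
  by rewrite ler_wpM2r//; exact: fx.
rewrite -leNgt => di; rewrite -[leLHS]add0r; apply: lerD; first by rewrite mulr_ge0.
apply: (@le_trans _ _ (2 * C * t i y)).
  rewrite /t di ler_wpM2r//; apply: le_trans (ler_normB _ _) _.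
  by rewrite mulr_natl mulr2n; exact: lerD.
rewrite ler_wpM2l ?mulr_ge0//.
by rewrite (bigD1 i)//= lerDl; exact: sumr_ge0.
Qed.

(** The Poisson means of a bounded continuous f converge to f pointwise, and they
are bounded by C, so that dominated convergence applies. *)
Lemma poisson_form_cvg (f : V -> R) (C : R) :
  continuous f -> (forall y, `|f y| <= C) -> mu.-integrable setT (EFin \o f) ->
  poisson_form m.+1%:R^-1 f @[m --> \oo] --> \int[mu]_x (f x ^+ 2).
Proof.
move=> cf fC fi.
have mf := measurable_L1 fi.
have e0 m : 0 < m.+1%:R^-1 :> R by rewrite invr_gt0.
pose I m x := \int[mu]_y (f y * poisson_rV m.+1%:R^-1 (x - y)).
have C0 : 0 <= C by apply: le_trans (fC 0).
have Icvg x : I m x @[m --> \oo] --> f x.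
  apply/cvgrPdist_le => /= eps eps0.
  have eps2 : 0 < eps / 2 by rewrite divr_gt0.
  have /cvgrPdist_le /(_ _ eps2) := cf x.
  move=> /nbhs_ballP[d /= d0 dx].
  have xd (y : V) : (forall i, `|x ord0 i - y ord0 i| < d) -> `|f y - f x| <= eps / 2.
    move=> xy; rewrite distrC; apply: dx; split => // i j; rewrite (ord1 i).
    exact: xy.
  have tail : 2 * C * n%:R * (1 - 2 / pi * atan (d / m.+1%:R^-1)) @[m --> \oo] --> (0 : R).
    rewrite -[X in _ --> X](mulr0 (2 * C * n%:R)); apply: cvgM; first exact: cvg_cst.
    rewrite -[X in _ --> X](subrr 1); apply: cvgB; first exact: cvg_cst.
    rewrite -[X in _ --> X](_ : 2 / pi * (pi / 2) = 1); last first.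
      by rewrite mulrA divfK ?lt0r_neq0 ?pi_gt0// divff.
    apply: cvgM; first exact: cvg_cst.
    apply: (cvg_comp _ _ _ (@cvgy_atan R)).
    under eq_fun do rewrite invrK.
    have mS : (m.+1%:R : R) @[m --> \oo] --> +oo.
      by rewrite (cvg_shiftS (fun m : nat => m%:R : R)); exact: cvgr_idn.
    exact: (@gt0_cvgMry R (m.+1%:R @[m --> \oo]) _ d id d0 mS).
  have /cvgrPdist_le /(_ _ eps2) := tail.
  apply: filterS => m; rewrite sub0r normrN => /ler_normlW tm.
  rewrite distrC; apply: le_trans (poisson_mean_dist mf fC (e0 m) d0 (ltW eps2) xd) _.
  by rewrite [leRHS]splitr lerD2l.
have IC m x : `|I m x| <= C.
  have mP := measurable_poisson_section x (e0 m).
  have P0 y : 0 <= poisson_rV m.+1%:R^-1 (x - y) by exact: poisson_rV_ge0.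
  have P1 := integral_poisson_sub x (e0 m).
  have iP : mu.-integrable setT (EFin \o (fun y => poisson_rV m.+1%:R^-1 (x - y))).
    apply/integrableP; split; first exact/measurable_EFinP.
    under eq_integral do rewrite /= ger0_norm//.
    by rewrite P1 ltry.
  have mf2 : measurable_fun [set: V * V] (fun p => f p.2) by exact: (measurableT_comp mf).
  have := kernel_integral_le iP mf2 (fun p => fC p.2) x.
  rewrite /I; under [in X in X -> _]eq_Rintegral do rewrite mulrC.
  move=> /le_trans; apply; under eq_Rintegral do rewrite ger0_norm//.
  by rewrite /Rintegral P1 mulr1.
have mI m : measurable_fun [set: V] (I m).
  have PD (p : V * V) : `|poisson_rV m.+1%:R^-1 (p.1 - p.2)| <= (m.+1%:R^-1 * pi)^-1 ^+ n.
    by rewrite ger0_norm ?poisson_rV_ge0// poisson_rV_le.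
  exact: (measurable_kernel_integral fi (measurable_poisson_sub (e0 m)) PD).
have h := @dominated_convergence _ _ _ mu _ measurableT (fun m x => (f x * I m x)%:E)
  (fun x => (f x ^+ 2)%:E) (fun x => (C * `|f x|)%:E).
have [] := h.
- by move=> m; apply/measurable_EFinP; exact: measurable_funM.
- by apply/measurable_EFinP; exact: measurable_funX.
- apply: aeW => x _; apply/cvg_EFin; first exact: nearW.
  by rewrite expr2; apply: cvgM => //; exact: cvg_cst.
- exact/integrable_mull/integrable_normr.
- apply: aeW => x m _; rewrite lee_fin normrM mulrC ler_wpM2r//.
move=> i2 _; rewrite -(fineK (integrable_fin_num measurableT i2)) => /fine_cvgP[_].
exact.
Qed.

Lemma windowE (e : R) (z : V) : window e z = expR (- (e * \sum_(i < n) `|z ord0 i|)).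
Proof. by rewrite /window -expR_sum sumrN mulr_sumr. Qed.

Lemma window_le1 (e : R) (z : V) : 0 < e -> window e z <= 1.
Proof.
move=> e0; rewrite windowE -expR0 ler_expR oppr_le0 mulr_ge0 ?(ltW e0)//.
exact: sumr_ge0.
Qed.

(** One half of Plancherel's theorem, by monotone convergence as the window
increases to 1. *)
Lemma fpower_integral_le u : mu.-integrable setT (EFin \o u) ->
  (\int[mu]_z (fpower u z)%:E <= ((2 * pi) ^+ n)%:E * \int[mu]_x (u x ^+ 2)%:E)%E.
Proof.
move=> iu; have e0 m : 0 < m.+1%:R^-1 :> R by rewrite invr_gt0.
have pi0 : 0 <= (2 * pi) ^+ n :> R by rewrite exprn_ge0// mulr_ge0 ?pi_ge0.
pose g m (z : V) := (window m.+1%:R^-1 z * fpower u z)%:E.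
have mg m : measurable_fun [set: V] (g m).
  apply/measurable_EFinP; apply: measurable_funM; first exact: measurable_window.
  exact: measurable_fpower.
have g0 m z : setT z -> (0 <= g m z)%E.
  by move=> _; rewrite lee_fin mulr_ge0 ?fpower_ge0 ?(ltW (window_gt0 _ _)).
have ndg z : setT z -> {homo g^~ z : m p / (m <= p)%N >-> (m <= p)%E}.
  move=> _ m p mp; rewrite lee_fin ler_wpM2r ?fpower_ge0// !windowE ler_expR lerN2.
  rewrite ler_wpM2r ?sumr_ge0// lef_pV2 ?posrE// ler_nat ltnS//.
have := monotone_convergence mu measurableT mg g0 ndg.
have -> : (\int[mu]_z (fpower u z)%:E = \int[mu]_z limn (g^~ z))%E.
  apply: eq_integral => z _; apply/esym/cvg_lim => //.
  apply/cvg_EFin; first exact: nearW.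
  rewrite -[X in _ --> X]mul1r; apply: cvgM; last exact: cvg_cst.
  rewrite -[X in _ --> X](_ : expR (- (0 * \sum_(i < n) `|z ord0 i|)) = 1); last first.
    by rewrite mul0r oppr0 expR0.
  under eq_fun do rewrite windowE.
  apply: (@continuous_cvg _ _ _ _ _ _ expR); first exact: continuous_expR.
  apply: cvgN; apply: cvgM; last exact: cvg_cst.
  exact: cvg_harmonic.
move=> ->; apply: lime_le.
  apply: ereal_nondecreasing_is_cvgn => m p mp; apply: ge0_le_integral => //.
  - by move=> z; exact: g0.
  - by move=> z _; exact: ndg.
apply: nearW => m; rewrite /g window_fpower// EFinM lee_wpmul2l//.
exact: poisson_form_le.
Qed.

(** The other half of Plancherel's theorem, for functions whose Poisson means are
known to converge: the window is at most 1. *)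
Lemma fpower_integral_ge (f : V -> R) (C : R) : continuous f -> (forall y, `|f y| <= C) ->
  mu.-integrable setT (EFin \o f) ->
  (((2 * pi) ^+ n * \int[mu]_x (f x ^+ 2))%:E <= \int[mu]_z (fpower f z)%:E)%E.
Proof.
move=> cf fC fi; have e0 m : 0 < m.+1%:R^-1 :> R by rewrite invr_gt0.
have h m : (((2 * pi) ^+ n * poisson_form m.+1%:R^-1 f)%:E <= \int[mu]_z (fpower f z)%:E)%E.
  rewrite -window_fpower//; apply: le_integral_EFin.
  - by apply: measurable_funM; [exact: measurable_window|exact: measurable_fpower].
  - exact: measurable_fpower.
  move=> z; rewrite mulr_ge0 ?fpower_ge0 ?(ltW (window_gt0 _ _))//=.
  by rewrite ler_piMl ?fpower_ge0// window_le1.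
have cv : ((2 * pi) ^+ n * poisson_form m.+1%:R^-1 f)%:E @[m --> \oo] -->
    ((2 * pi) ^+ n * \int[mu]_x (f x ^+ 2))%:E.
  apply/cvg_EFin; first exact: nearW.
  by apply: cvgM; [exact: cvg_cst|exact: (poisson_form_cvg cf fC fi)].
rewrite -(cvg_lim _ cv)//; apply: lime_le; first by apply/cvg_ex; eexists; exact: cv.
exact: nearW.
Qed.

End poisson_limits.

(** * Square-integrable functions *)
Section square_integrable.
Context d (T : measurableType d) (R : realType) (m : {measure set T -> \bar R}).
Implicit Types f g h : T -> R.

Definition sqint f := measurable_fun [set: T] f /\
  m.-integrable setT (EFin \o (fun x => f x ^+ 2)).

Definition ip f g : R := \int[m]_x (f x * g x).

Lemma sqint_mul f g : sqint f -> sqint g -> m.-integrable setT (EFin \o (fun x => f x * g x)).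
Proof.
move=> [mf if2] [mg ig2].
apply: (le_integrable measurableT _ _ (integrable_addr if2 ig2)).
  by apply/measurable_EFinP; exact: measurable_funM.
move=> x _; rewrite /= lee_fin (ger0_norm (addr_ge0 _ _)) ?sqr_ge0//.
rewrite ler_norml; have := sqr_ge0 (f x + g x); have := sqr_ge0 (f x - g x).
have := sqr_ge0 (f x); have := sqr_ge0 (g x).
by move=> *; apply/andP; split; nra.
Qed.

Lemma sqintD f g : sqint f -> sqint g -> sqint (fun x => f x + g x).
Proof.
move=> sf sg; have ifg := sqint_mul sf sg; case: sf sg => mf if2 [mg ig2].
split; first exact: measurable_funD.
rewrite (_ : _ \o _ = EFin \o (fun x => f x ^+ 2 + (g x ^+ 2 + 2 * (f x * g x)))).
  by apply: integrable_addr => //; apply: integrable_addr => //; exact: integrable_mull.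
by apply/funext => x /=; congr EFin; ring.
Qed.

Lemma sqintZ c f : sqint f -> sqint (fun x => c * f x).
Proof.
move=> [mf if2]; split; first exact: measurable_funM.
rewrite (_ : _ \o _ = EFin \o (fun x => c ^+ 2 * f x ^+ 2)); first exact: integrable_mull.
by apply/funext => x /=; rewrite exprMn.
Qed.

Lemma sqint0 : sqint (fun=> 0).
Proof.
split => //; rewrite (_ : _ \o _ = cst 0%E); first exact: integrable0.
by apply/funext => x /=; rewrite expr0n.
Qed.

Lemma sqintB f g : sqint f -> sqint g -> sqint (fun x => f x - g x).
Proof.
move=> sf /(sqintZ (-1)) sg; rewrite (_ : (fun x => _) = (fun x => f x + -1 * g x)).
  exact: sqintD.
by apply/funext => x; rewrite mulN1r.
Qed.

Lemma sqint_sum k (c : 'I_k -> R) (f : 'I_k -> T -> R) : (forall j, sqint (f j)) ->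
  sqint (fun x => \sum_(j < k) c j * f j x).
Proof.
move=> sf; elim: k => [|k IH] in c f sf *.
  by under eq_fun do rewrite big_ord0; exact: sqint0.
under eq_fun do rewrite big_ord_recl.
by apply: sqintD; [exact: sqintZ|exact: (IH (fun j => c (lift ord0 j)) (fun j => f (lift ord0 j)))].
Qed.

Lemma ipC f g : ip f g = ip g f.
Proof. by apply: eq_Rintegral => x _; rewrite mulrC. Qed.

Lemma ipDl f g h : sqint f -> sqint g -> sqint h ->
  ip (fun x => f x + g x) h = ip f h + ip g h.
Proof.
move=> sf sg sh; rewrite /ip -RintegralD//; try exact: sqint_mul.
by apply: eq_Rintegral => x _; rewrite mulrDl.
Qed.

Lemma ipZl c f h : sqint f -> sqint h -> ip (fun x => c * f x) h = c * ip f h.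
Proof.
move=> sf sh; rewrite /ip -RintegralZl//; last exact: sqint_mul.
by apply: eq_Rintegral => x _; rewrite mulrA.
Qed.

Lemma ipBl f g h : sqint f -> sqint g -> sqint h ->
  ip (fun x => f x - g x) h = ip f h - ip g h.
Proof.
move=> sf sg sh; rewrite /ip -RintegralB//; try exact: sqint_mul.
by apply: eq_Rintegral => x _; rewrite mulrBl.
Qed.

Lemma ipBB f g : sqint f -> sqint g ->
  ip (fun x => f x - g x) (fun x => f x - g x) = ip f f - 2 * ip f g + ip g g.
Proof.
move=> sf sg; have sB := sqintB sf sg.
rewrite ipBl// (ipC f) (ipC g) !ipBl// (ipC g f); ring.
Qed.

Lemma ip_suml k (c : 'I_k -> R) (f : 'I_k -> T -> R) h : (forall j, sqint (f j)) -> sqint h ->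
  ip (fun x => \sum_(j < k) c j * f j x) h = \sum_(j < k) c j * ip (f j) h.
Proof.
move=> sf sh; elim: k => [|k IH] in c f sf *.
  rewrite big_ord0; under [X in ip X _]eq_fun do rewrite big_ord0.
  by rewrite /ip; under eq_Rintegral do rewrite mul0r; rewrite Rintegral_cst ?mul0r.
under [X in ip X _]eq_fun do rewrite big_ord_recl.
rewrite ipDl//; last 2 first.
- exact: sqintZ.
- exact: (sqint_sum (fun j => c (lift ord0 j)) (f := fun j => f (lift ord0 j))).
rewrite big_ord_recl ipZl//; congr (_ + _).
exact: (IH (fun j => c (lift ord0 j)) (fun j => f (lift ord0 j))).
Qed.

Lemma ip_ge0 f : 0 <= ip f f.
Proof. by apply: Rintegral_ge0 => x _; rewrite -expr2 sqr_ge0. Qed.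

(** The squared norm of g minus its projection is nonnegative. *)
Lemma bessel k (u : 'I_k -> T -> R) g : (forall j, sqint (u j)) -> sqint g ->
  (forall i j, ip (u i) (u j) = (i == j)%:R) ->
  \sum_(j < k) ip (u j) g ^+ 2 <= ip g g.
Proof.
move=> su sg on.
pose c j := ip (u j) g; pose p x := \sum_(j < k) c j * u j x.
have sp : sqint p by exact: sqint_sum.
have := ip_ge0 (fun x => g x - p x).
have sgp := sqintB sg sp.
rewrite ipBl// (ipC g) (ipC p) !ipBl//.
have pg : ip p g = \sum_(j < k) c j ^+ 2.
  by rewrite /p ip_suml//; apply: eq_bigr => j _; rewrite expr2.
have pp : ip p p = \sum_(j < k) c j ^+ 2.
  rewrite {1}/p ip_suml//; apply: eq_bigr => j _; rewrite ipC {1}/p ip_suml//.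
  rewrite (bigD1 j)//= on eqxx mulr1 big1 ?addr0 ?expr2//.
  by move=> i ij; rewrite on (negbTE ij) mulr0.
by rewrite (ipC g p) pg pp subrr subr0 subr_ge0.
Qed.

(** The quadratic polynomial t |-> |f - t g|^2 is nonnegative. *)
Lemma cauchy_schwarz f g : sqint f -> sqint g -> ip f g ^+ 2 <= ip f f * ip g g.
Proof.
move=> sf sg.
have h (t : R) : 0 <= ip f f - 2 * t * ip f g + t ^+ 2 * ip g g.
  have stg := sqintZ t sg; have sfg := sqintB sf stg.
  have := ip_ge0 (fun x => f x - t * g x); rewrite ipBB//.
  have -> : ip f (fun x => t * g x) = t * ip f g by rewrite ipC ipZl// ipC.
  have -> : ip (fun x => t * g x) (fun x => t * g x) = t ^+ 2 * ip g g.
    by rewrite ipZl// ipC ipZl// expr2 mulrA.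
  by move=> /le_trans; apply; rewrite le_eqVlt; apply/orP; left; apply/eqP; ring.
have := ip_ge0 g; rewrite le_eqVlt => /predU1P[g0|g0].
  have [fg0|fg0] := eqVneq (ip f g) 0; first by rewrite fg0 expr0n -g0 mulr0.
  have := h ((ip f f + 1) / (2 * ip f g)); rewrite -g0 mulr0 addr0.
  rewrite mulrAC -[2 * _ * _]mulrC divfK; first lra.
  by rewrite mulf_neq0.
have := h (ip f g / ip g g).
rewrite -(pmulr_lge0 _ g0) mulrC.
have -> : ip g g * (ip f f - 2 * (ip f g / ip g g) * ip f g + (ip f g / ip g g) ^+ 2 * ip g g)
  = ip f f * ip g g - ip f g ^+ 2 by field; exact: lt0r_neq0.
by rewrite subr_ge0.
Qed.

Lemma ip_cvg (f_ : nat -> T -> R) f g : (forall i, sqint (f_ i)) -> sqint f -> sqint g ->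
  ip (fun x => f_ i x - f x) (fun x => f_ i x - f x) @[i --> \oo] --> (0 : R) ->
  ip (f_ i) g @[i --> \oo] --> ip f g.
Proof.
move=> sf_ sf sg h.
apply/cvgrPdist_le => /= eps eps0.
have G0 : 0 < ip g g + 1 by have := ip_ge0 g; lra.
have e2 : 0 < eps ^+ 2 / (ip g g + 1) by rewrite divr_gt0// exprn_gt0.
have /cvgrPdist_le /(_ _ e2) := h.
apply: filterS => i; rewrite sub0r normrN ger0_norm ?ip_ge0// => hi.
rewrite distrC -ipBl// -(@ler_pXn2r _ 2)// ?nnegrE ?(ltW eps0)// real_normK ?num_real//.
have sB := sqintB (sf_ i) sf.
apply: le_trans (cauchy_schwarz sB sg) _.
apply: (@le_trans _ _ (eps ^+ 2 / (ip g g + 1) * (ip g g + 1))); last by rewrite divfK ?lt0r_neq0.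
by apply: ler_pM => //; rewrite ?ip_ge0// lerDl.
Qed.

Lemma ip_eq0_ae f : sqint f -> ip f f = 0 -> {ae m, forall x, f x = 0}.
Proof.
move=> [mf if2] f0.
have : (\int[m]_x `|(f x ^+ 2)%:E| = 0)%E.
  transitivity ((ip f f)%:E); last by rewrite f0.
  rewrite /ip /Rintegral; under [in RHS]eq_integral do rewrite -expr2.
  rewrite fineK; last exact: (integrable_fin_num measurableT if2).
  by apply: eq_integral => x _; rewrite /= ger0_norm ?sqr_ge0.
have mf2 : measurable_fun [set: T] (EFin \o (fun x => f x ^+ 2)) := measurable_int _ if2.
move=> /(ae_eq_integral_abs m measurableT mf2).
apply: filterS => x /(_ I) h; have /eqP : f x ^+ 2 = 0 by apply: EFin_inj; exact: h.
by rewrite sqrf_eq0 => /eqP.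
Qed.

End square_integrable.

(** * Test functions and integration by parts *)
Section partial_derivatives.
Variables (R : realType) (n : nat).
Local Notation V := 'rV[R]_n.
Local Notation mu := (lebesgue_rV R n).
Local Notation ei i := (delta_mx ord0 i : 'rV[R]_n).
Implicit Types (f g : V -> R) (Om : set V).

Lemma integrable_translate f (a : V) : measurable_fun [set: V] f ->
  \int[mu]_x (f (a + x)) = \int[mu]_x (f x).
Proof.
move=> mf; rewrite /Rintegral [in LHS]integralE [in RHS]integralE; apply/esym; congr (fine (_ - _)%E).
  rewrite (@integral_affine R n _ a 1)//; last first.
    by apply: measurable_funepos; exact/measurable_EFinP.
  by rewrite expr1n mul1e; apply: eq_integral => x _; rewrite !funeposE scale1r.
rewrite (@integral_affine R n _ a 1)//; last first.
  by apply: measurable_funeneg; exact/measurable_EFinP.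
by rewrite expr1n mul1e; apply: eq_integral => x _; rewrite !funenegE scale1r.
Qed.

Lemma integrable_indic_bounded (A : set V) : measurable A -> bounded_set A ->
  mu.-integrable setT (EFin \o \1_A).
Proof.
move=> mA bA; apply/integrableP; split; first by apply/measurable_EFinP.
under eq_integral do rewrite /= ger0_norm//.
by rewrite integral_indic// setIT; exact: bounded_measure_lty.
Qed.

Lemma is_derive_line f (x v : V) (t d : R) :
  is_derive (x + t *: v) v f d <-> is_derive t (1 : R) (fun t => f (x + t *: v)) d.
Proof.
have E : (fun h : R => h^-1 *: ((f \o shift (x + t *: v)) (h *: v) - f (x + t *: v))) =
  (fun h : R => h^-1 *: (((fun t => f (x + t *: v)) \o shift t) (h *: (1 : R)) - f (x + t *: v))).
  apply/funext => h /=; congr (_ *: (f _ - _)).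
  by rewrite [h *: (1 : R)]mulr1 scalerDl addrCA.
by split=> -[dv de]; (split; [move: dv|rewrite -de]); rewrite /derivable /derive E.
Qed.

(** The difference quotients of f have integral 0 by translation invariance, and by
the mean value theorem they are bounded by C on one fixed cube; dominated
convergence gives the claim. *)
Lemma integral_partial0 i f (C r : R) : 0 <= r -> measurable_fun [set: V] f ->
  (forall x, derivable f x (ei i)) -> (forall x, `|f x| <= C) ->
  (forall x, `|'D_(ei i) f x| <= C) ->
  (forall x : V, ~ (forall j, `|x ord0 j| <= r) -> f x = 0) ->
  \int[mu]_x 'D_(ei i) f x = 0.
Proof.
move=> r0 mf df fC dfC f0.
pose t (m : nat) : R := m.+1%:R^-1.
have t0 m : 0 < t m by rewrite invr_gt0.
have t1 m : t m <= 1 by rewrite invf_le1// ler1n.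
have tlim : t m @[m --> \oo] --> (0:R)^'.
  move=> P; rewrite /dnbhs /within /= => h; have := @cvg_harmonic R _ h.
  move=> h1; have {}h1 : \forall m \near \oo, (t m != 0 -> P (t m)) by exact: h1.
  by apply: filterS h1 => m; apply; rewrite gt_eqF ?t0.
pose q (m : nat) (x : V) : R := (t m)^-1 * (f (x + t m *: ei i) - f x).
have mfa a : measurable_fun [set: V] (fun x => f (x + a)).
  apply: (measurableT_comp mf); have := @measurable_affine R n a 1.
  by under eq_fun do rewrite scale1r addrC.
have mq m : measurable_fun [set: V] (q m).
  by apply: measurable_funM => //; apply: measurable_funB.
pose Q := [set x : V | forall j, `|x ord0 j| <= r + 1].
have mQ : measurable Q by exact: measurable_cube.
have bQ : bounded_set Q.
  exists (r + 1); split; first exact: num_real.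
  move=> M rM x Qx; apply: le_trans (ltW rM); apply: norm_le_coord => //; lra.
have C0 : 0 <= C by exact: le_trans (normr_ge0 _) (fC 0).
have qQ m x : `|q m x| <= C * \1_Q x.
  rewrite indicE; have [Qx|nQx] := pselect (Q x).
    rewrite mem_set// mulr1 /q.
    have dl s : is_derive s (1 : R) (fun s => f (x + s *: ei i)) ('D_(ei i) f (x + s *: ei i)).
      by apply/is_derive_line; exact: DeriveDef.
    have := @MVT R (fun s => f (x + s *: ei i)) (fun s => 'D_(ei i) f (x + s *: ei i)) 0 (t m) (t0 m)
      (fun s _ => dl s).
    have cl : {within `[0, t m], continuous (fun s => f (x + s *: ei i))}.
      apply: continuous_subspaceT => s; apply/differentiable_continuous/derivable1_diffP.
      by have [] := dl s.
    move=> /(_ cl) [c _]; rewrite scale0r addr0 subr0 => ->.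
    by rewrite mulrC mulfK ?lt0r_neq0.
  rewrite memNset// mulr0 /q !f0 ?subrr ?mulr0 ?normr0//.
    by move=> h; apply: nQx => j; apply: le_trans (h j) _; rewrite lerDl.
  move=> h; apply: nQx => j; have := h j; rewrite !mxE.
  have : `|t m * (ei i) ord0 j| <= 1.
    rewrite normrM (ger0_norm (ltW (t0 _))) mxE eqxx/=.
    by case: (j == i); rewrite ?normr1 ?normr0 ?mulr1 ?mulr0.
  by rewrite !mxE; move: (t m * _) (x ord0 j) => b c; rewrite !ler_norml; lra.
have qlim x : q m x @[m --> \oo] --> 'D_(ei i) f x.
  have := df x; rewrite /derivable => /cvg_ex[l hl].
  have -> : 'D_(ei i) f x = l by exact: cvg_lim hl.
  rewrite (_ : (fun m => q m x) = (fun h : R => h^-1 *: ((f \o shift x) (h *: ei i) - f x)) \o t).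
    exact: cvg_comp tlim hl.
  by apply/funext => m; rewrite /q /= [x + _]addrC.
have mD : measurable_fun [set: V] ('D_(ei i) f).
  apply: (measurable_fun_cvg (h := q)) => // x _; exact: qlim.
have iQ : mu.-integrable setT (fun x => (C * \1_Q x)%:E).
  by apply: integrable_mull; exact: integrable_indic_bounded.
have := @dominated_convergence _ _ _ mu _ measurableT (fun m x => (q m x)%:E)
  (fun x => ('D_(ei i) f x)%:E) (fun x => (C * \1_Q x)%:E).
case.
- by move=> m; exact/measurable_EFinP.
- exact/measurable_EFinP.
- by apply: aeW => x _; apply/cvg_EFin; [exact: nearW|exact: qlim].
- exact: iQ.
- by apply: aeW => x m _; rewrite lee_fin.
move=> iD _; rewrite -(fineK (integrable_fin_num measurableT iD)) => /fine_cvgP[_].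
move=> h; apply/esym; apply: cvg_unique h => //.
rewrite (_ : _ \o _ = fun=> 0); first exact: cvg_cst.
apply/funext => m /=.
have if' : mu.-integrable setT (EFin \o f).
  apply: (le_integrable _ _ _ iQ) => //; first exact/measurable_EFinP.
  move=> x _; rewrite /= lee_fin [leRHS]ger0_norm ?mulr_ge0// indicE.
  have [Qx|nQx] := pselect (Q x); first by rewrite mem_set// mulr1.
  rewrite f0 ?normr0 ?mulr_ge0// => h'; apply: nQx => j.
  by apply: le_trans (h' j) _; rewrite lerDl.
have ifa : mu.-integrable setT (EFin \o (fun x => f (x + t m *: ei i))).
  have iqm : mu.-integrable setT (EFin \o q m).
    apply: (le_integrable _ _ _ iQ) => //; first exact/measurable_EFinP.
    by move=> x _; rewrite /= lee_fin [leRHS]ger0_norm ?mulr_ge0// qQ.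
  rewrite (_ : _ \o _ = EFin \o (fun x => f x + t m * q m x)).
    by apply: integrable_addr => //; exact: integrable_mull.
  by apply/funext => x /=; rewrite mulVKf ?lt0r_neq0// subrKC.
have iB : mu.-integrable setT (EFin \o (fun x => f (x + t m *: ei i) - f x)).
  rewrite (_ : _ \o _ = EFin \o (fun x => f (x + t m *: ei i) + -1 * f x)).
    by apply: integrable_addr => //; exact: integrable_mull.
  by apply/funext => x /=; rewrite mulN1r.
rewrite -[LHS]/(\int[mu]_x q m x) /q RintegralZl// RintegralB//.
rewrite -[X in _ - X](@integrable_translate f (t m *: ei i))//.
rewrite (_ : \int[mu]_x f (x + _) = \int[mu]_x f (t m *: ei i + x)) ?subrr ?mulr0//.
by apply: eq_Rintegral => x _; rewrite addrC.
Qed.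

Definition supp f : set V := closure [set x | f x != 0].

Lemma supp_out f x : ~ supp f x -> f x = 0.
Proof.
by move=> h; apply/eqP/negP => /negP fx; apply: h; apply: subset_closure.
Qed.

Lemma supp_partial i f : supp (partial i f) `<=` supp f.
Proof.
suff h : [set x | partial i f x != 0] `<=` supp f.
  by move=> x /(closureS h); rewrite -(proj1 (closure_id _))//; exact: closed_closure.
move=> x /= dx; apply: contrapT => nx; move/eqP: dx; apply.
rewrite -(derive_cst (0 : R) x (ei i)); apply: near_eq_derive.
have : nbhs x (~` supp f).
  by apply: open_nbhs_nbhs; split => //; exact/closed_openC/closed_closure.
by apply: filterS => y ny; rewrite supp_out.
Qed.

Lemma partials_cat s1 s2 f : partials (s1 ++ s2) f = partials s1 (partials s2 f).
Proof. by rewrite /partials foldr_cat. Qed.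

Lemma test_partial Om i f : test_fun Om f -> test_fun Om (partial i f).
Proof.
move=> [sf cf fO]; split.
- by move=> s; have := sf (s ++ [:: i]); rewrite partials_cat.
- by apply: subclosed_compact cf _; [exact: closed_closure|exact: supp_partial].
- exact: subset_trans (@supp_partial i f) fO.
Qed.

Lemma test_partials Om s f : test_fun Om f -> test_fun Om (partials s f).
Proof. by move=> tf; elim: s => //= i s; exact: test_partial. Qed.

Lemma partials0 (s : seq 'I_n) : partials s (fun=> 0 : R) = (fun=> 0).
Proof.
elim: s => //= i s ->; apply/funext => x.
exact: (derive_cst (0 : R) x (ei i)).
Qed.

Lemma partialsD s f g : smooth f -> smooth g ->
  partials s (fun x => f x + g x) = (fun x => partials s f x + partials s g x).
Proof.
move=> sf sg; elim: s => //= i s ->; apply/funext => x.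
by apply: deriveD; [have [_] := sf s|have [_] := sg s].
Qed.

Lemma test0 Om : test_fun Om (fun=> 0).
Proof.
have h0 : closure [set x : V | (0 : R) != 0] = set0.
  by rewrite (_ : mkset _ = set0) ?closure0//; apply/seteqP; split=> x //=; rewrite eqxx.
split; rewrite ?h0; [|exact: compact0|exact: sub0set].
move=> s; rewrite partials0; split; first exact: cst_continuous.
by move=> i x; exact: derivable_cst.
Qed.

Lemma testD Om f g : test_fun Om f -> test_fun Om g -> test_fun Om (fun x => f x + g x).
Proof.
move=> [sf cf fO] [sg cg gO].
have h : closure [set x | f x + g x != 0] `<=` supp f `|` supp g.
  rewrite -closureU; apply: closureS => x /= fg; apply: contrapT.
  move=> /not_orP[/negP]; rewrite negbK => /eqP f0 /negP; rewrite negbK => /eqP g0.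
  by move: fg; rewrite f0 g0 addr0 eqxx.
split.
- move=> s; rewrite partialsD//; split.
    have [cfs _] := sf s; have [cgs _] := sg s.
    by move=> x; exact: (continuousD (cfs x) (cgs x)).
  by move=> i x; apply: derivableD; [have [_] := sf s|have [_] := sg s].
- by apply: subclosed_compact h; [exact: closed_closure|exact: compactU].
- by apply: subset_trans h _ => x -[/fO|/gO].
Qed.

Lemma test_sum Om (r : seq 'I_n) (F : 'I_n -> V -> R) : (forall i, test_fun Om (F i)) ->
  test_fun Om (fun x => \sum_(i <- r) F i x).
Proof.
move=> tF; elim: r => [|i r IH].
  by under eq_fun do rewrite big_nil; exact: test0.
by under eq_fun do rewrite big_cons; exact: testD.
Qed.

Lemma test_laplacian Om f : test_fun Om f -> test_fun Om (laplacian f).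
Proof. by move=> tf; apply: test_sum => i; do 2 apply: test_partial. Qed.

Lemma partialsZ s c f : smooth f ->
  partials s (fun x => c * f x) = (fun x => c * partials s f x).
Proof.
move=> sf; elim: s => //= i s ->; apply/funext => x.
by apply: (deriveZ c); have [_] := sf s.
Qed.

Lemma testZ Om c f : test_fun Om f -> test_fun Om (fun x => c * f x).
Proof.
move=> [sf cf fO].
have h : closure [set x | c * f x != 0] `<=` supp f.
  by apply: closureS => x /=; apply: contra_neq => ->; rewrite mulr0.
split.
- move=> s; rewrite partialsZ//; have [cfs dfs] := sf s; split.
    by move=> x; exact: (continuousM (@cst_continuous _ _ c x) (cfs x)).
  by move=> i x; have := @derivableZ _ _ _ _ c _ _ (dfs i x).
- by apply: subclosed_compact h; [exact: closed_closure|].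
- exact: subset_trans h _.
Qed.

Lemma laplacianD Om f g : test_fun Om f -> test_fun Om g ->
  laplacian (fun x => f x + g x) = (fun x => laplacian f x + laplacian g x).
Proof.
move=> [sf _ _] [sg _ _]; apply/funext => x; rewrite /laplacian -big_split.
by apply: eq_bigr => i _; have := partialsD [:: i; i] sf sg => /(congr1 (@^~ x)).
Qed.

Lemma laplacianZ Om c f : test_fun Om f ->
  laplacian (fun x => c * f x) = (fun x => c * laplacian f x).
Proof.
move=> [sf _ _]; apply/funext => x; rewrite /laplacian mulr_sumr.
by apply: eq_bigr => i _; have := partialsZ [:: i; i] c sf => /(congr1 (@^~ x)).
Qed.

Lemma test_out Om f x : test_fun Om f -> ~ Om x -> f x = 0.
Proof. by move=> [_ _ fO] nx; apply: supp_out => /fO. Qed.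

Lemma test_continuous Om f : test_fun Om f -> continuous f.
Proof. by move=> [/(_ [::])[]]. Qed.

Lemma test_derivable Om f i x : test_fun Om f -> derivable f x (ei i).
Proof. by move=> [/(_ [::])[_ +] _ _]; exact. Qed.

Lemma test_bounded Om f : test_fun Om f -> exists2 C : R, 0 <= C & forall x, `|f x| <= C.
Proof.
move=> tf; have cf := test_continuous tf; case: tf => _ sf _.
have /compact_bounded[C [Cr hC]] : compact (f @` supp f).
  by apply: continuous_compact => //; exact: continuous_subspaceT.
exists (`|C| + 1) => // x; have [sx|nx] := pselect (supp f x).
  by apply: (hC (`|C| + 1)); [rewrite ltr_pwDr// ler_norm|exists x].
by rewrite supp_out// normr0.
Qed.

Lemma test_cube Om f : test_fun Om f ->
  exists2 r : R, 0 < r & forall x : V, ~ (forall j, `|x ord0 j| <= r) -> f x = 0.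
Proof.
move=> [_ /compact_bounded/bounded_sub_cube[r r0 fr] _]; exists r => // x nx.
by apply: supp_out => /fr.
Qed.

Lemma test_measurable Om f : test_fun Om f -> measurable_fun [set: V] f.
Proof. by move=> /test_continuous; exact: continuous_measurable_rV. Qed.

Lemma test_integrable Om f : test_fun Om f -> mu.-integrable setT (EFin \o f).
Proof.
move=> tf; have [C C0 fC] := test_bounded tf; have [r r0 fr] := test_cube tf.
have mQ := @measurable_cube R n r.
set Q := [set x : V | _] in mQ.
have bQ : bounded_set Q.
  exists r; split; first exact: num_real.
  by move=> M rM x Qx; apply: le_trans (ltW rM); apply: norm_le_coord => //; exact: ltW.
rewrite (_ : EFin \o f = EFin \o (fun x => \1_Q x * f x)).
  apply: integrable_mul_bounded fC; first exact: integrable_indic_bounded.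
  exact: test_measurable tf.
apply/funext => x /=; rewrite indicE; have [Qx|nQx] := pselect (Q x).
  by rewrite mem_set// mul1r.
by rewrite fr// mulr0.
Qed.

Lemma test_sqint Om f : test_fun Om f -> sqint mu f.
Proof.
move=> tf; split; first exact: test_measurable tf.
have [C C0 fC] := test_bounded tf.
rewrite (_ : _ \o _ = EFin \o (fun x => f x * f x)); last by apply/funext => x /=; rewrite expr2.
by apply: integrable_mul_bounded fC; [exact: test_integrable tf|exact: test_measurable tf].
Qed.

Lemma is_derive_dot (g g' : R -> R) (z x : V) i : (forall t, is_derive t (1 : R) g (g' t)) ->
  is_derive x (ei i) (fun x => g (dot z x)) (z ord0 i * g' (dot z x)).
Proof.
move=> dg; have := @is_derive_line (fun x => g (dot z x)) x (ei i) 0 (z ord0 i * g' (dot z x)).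
rewrite scale0r addr0 => -[_]; apply.
have de : dot z (ei i) = z ord0 i.
  rewrite /dot (bigD1 i)//= !mxE !eqxx mulr1 big1 ?addr0// => j ji.
  by rewrite !mxE (negbTE ji) andbF mulr0.
have -> : (fun t : R => g (dot z (x + t *: ei i))) = g \o (cst (dot z x) + (fun t => z ord0 i * t)).
  by apply/funext => t; rewrite /= dotDr dotZr de [t * _]mulrC.
rewrite mulrC; apply: (@is_derive1_comp _ g (cst (dot z x) + (fun t => z ord0 i * t))).
  have -> : (cst (dot z x) + (fun t => z ord0 i * t)) 0 = dot z x by rewrite fctE mulr0 addr0.
  exact: dg.
have := is_deriveD (is_derive_cst (dot z x) (0 : R) 1) (is_derive_mull (z ord0 i) 0).
by rewrite add0r.
Qed.

(** Integration by parts: f x * g (z . x) is compactly supported, so its partial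
derivative integrates to 0. *)
Lemma ftrig_partial Om f i (g g' : R -> R) z : test_fun Om f ->
  (forall t, is_derive t (1 : R) g (g' t)) -> (forall t, `|g t| <= 1) -> (forall t, `|g' t| <= 1) ->
  measurable_fun [set: R] g -> measurable_fun [set: R] g' ->
  ftrig g (partial i f) z = - z ord0 i * ftrig g' f z.
Proof.
move=> tf dg g1 g'1 mg mg'.
have tdf := test_partial i tf.
have [C C0 fC] := test_bounded tf; have [C' C'0 fC'] := test_bounded tdf.
have [r r0 fr] := test_cube tf.
pose H := f * (fun x => g (dot z x)).
have dH x : is_derive x (ei i) H
    (f x * (z ord0 i * g' (dot z x)) + g (dot z x) * partial i f x).
  apply: is_deriveM; last exact: is_derive_dot.
  by apply: DeriveDef => //; exact: test_derivable tf.
have mgd (h : R -> R) : measurable_fun [set: R] h -> measurable_fun [set: V] (fun x => h (dot z x)).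
  by move=> mh; apply: (measurableT_comp mh); exact: measurable_dot.
have i1 : mu.-integrable setT (EFin \o (fun x => f x * g' (dot z x))).
  apply: (integrable_mul_bounded (C := 1)) => //; first exact: test_integrable tf.
  exact: mgd.
have i2 : mu.-integrable setT (EFin \o (fun x => partial i f x * g (dot z x))).
  apply: (integrable_mul_bounded (C := 1)) => //; first exact: test_integrable tdf.
  exact: mgd.
have := @integral_partial0 i H (C * (`|z ord0 i| * 1) + 1 * C' + C) r (ltW r0).
rewrite (_ : \int[mu]_x _ = z ord0 i * ftrig g' f z + ftrig g (partial i f) z); last first.
  rewrite /ftrig -RintegralZl// -RintegralD//; last exact: integrable_mull.
  by apply: eq_Rintegral => x _; have [_ ->] := dH x; ring.
move=> h; apply/eqP; rewrite mulNr -addr_eq0 addrC h//.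
- by apply: measurable_funM; [exact: test_measurable tf|exact: mgd].
- move=> x; rewrite /H normrM; apply: (@le_trans _ _ (C * 1)); first by rewrite ler_pM.
  by rewrite mulr1 lerDr addr_ge0 ?mulr_ge0.
- move=> x; have [_ ->] := dH x; apply: le_trans (ler_normD _ _) _.
  rewrite !normrM ler_wpDr// lerD//; last by rewrite ler_pM.
  by rewrite ler_pM ?mulr_ge0// ler_pM.
- by move=> x nx; rewrite -[LHS]/(f x * _) fr// mul0r.
Qed.

Lemma ftrig_sum (g : R -> R) (r : seq 'I_n) (F : 'I_n -> V -> R) z :
  measurable_fun [set: R] g -> (forall t, `|g t| <= 1) ->
  (forall i, mu.-integrable setT (EFin \o F i)) ->
  ftrig g (fun x => \sum_(i <- r) F i x) z = \sum_(i <- r) ftrig g (F i) z.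
Proof.
move=> mg g1 iF; rewrite /ftrig.
have mgd : measurable_fun [set: V] (fun x => g (dot z x)).
  by apply: (measurableT_comp mg); exact: measurable_dot.
elim: r => [|i r IH].
  rewrite big_nil; under eq_Rintegral do rewrite big_nil mul0r.
  by rewrite Rintegral_cst// mul0r.
rewrite big_cons -IH -RintegralD//; try exact: (integrable_mul_bounded (C := 1)).
  by apply: eq_Rintegral => x _; rewrite big_cons mulrDl.
apply: (integrable_mul_bounded (C := 1)) => //.
elim: r {IH} => [|j r IH].
  by under eq_fun do rewrite big_nil; exact: integrable0.
rewrite (_ : _ \o _ = EFin \o (fun x => F j x + \sum_(i <- r) F i x)).
  exact: integrable_addr.
by apply/funext => x /=; rewrite big_cons.
Qed.

Lemma ftrigN (g : R -> R) f z : measurable_fun [set: R] g -> (forall t, `|g t| <= 1) ->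
  mu.-integrable setT (EFin \o f) -> ftrig (fun t => - g t) f z = - ftrig g f z.
Proof.
move=> mg g1 if'; rewrite -mulN1r /ftrig -RintegralZl//.
  by apply: eq_Rintegral => x _; rewrite mulrN mulN1r.
apply: (integrable_mul_bounded (C := 1)) => //.
by apply: (measurableT_comp mg); exact: measurable_dot.
Qed.

Lemma ftrig_laplacian Om f (g g' : R -> R) z : test_fun Om f ->
  (forall t, is_derive t (1 : R) g (g' t)) -> (forall t, is_derive t (1 : R) g' (- g t)) ->
  (forall t, `|g t| <= 1) -> (forall t, `|g' t| <= 1) ->
  measurable_fun [set: R] g -> measurable_fun [set: R] g' ->
  ftrig g (laplacian f) z = - sqr_enorm z * ftrig g f z.
Proof.
move=> tf dg dg' g1 g'1 mg mg'.
rewrite ftrig_sum//; last first.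
  move=> i; exact: test_integrable (test_partial i (test_partial i tf)).
rewrite mulNr -mulrN -ftrigN//; last exact: test_integrable tf.
rewrite /sqr_enorm mulr_suml; apply: eq_bigr => i _.
rewrite (ftrig_partial i z (test_partial i tf) dg)//.
rewrite (ftrig_partial i z tf dg')//; first by rewrite !mulNr mulrN opprK mulrA expr2.
  by move=> t; rewrite normrN.
exact: measurableT_comp.
Qed.

(** Each of cos and sin is minus its second derivative, so that the Laplacian
multiplies both transforms by - |z|^2. *)
Lemma fpower_laplacian Om f z : test_fun Om f ->
  fpower (laplacian f) z = sqr_enorm z ^+ 2 * fpower f z.
Proof.
move=> tf; have mc := @measurable_cos R; have ms := @measurable_sin R.
have c1 := @cos_le1_norm R; have s1 := @sin_le1_norm R.
rewrite /fpower (ftrig_laplacian z tf (@is_derive_cos R))//; last 2 first.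
- by move=> t; rewrite normrN.
- exact: measurableT_comp.
rewrite (ftrig_laplacian z tf (@is_derive_sin R) (@is_derive_cos R))//.
by rewrite !exprMn sqrrN -mulrDr.
Qed.

End partial_derivatives.

(** * Strong convergence *)
Section l2_convergence.
Context d (T : measurableType d) (R : realType) (m : {measure set T -> \bar R}).

Definition l2cvg (f_ : nat -> T -> R) (f : T -> R) := [/\ forall i, sqint m (f_ i), sqint m f &
  ip m (fun x => f_ i x - f x) (fun x => f_ i x - f x) @[i --> \oo] --> (0 : R)].

Lemma l2cvg_cst (f : T -> R) : sqint m f -> l2cvg (fun=> f) f.
Proof.
move=> sf; split => //; rewrite (_ : (fun _ => _) = (fun=> 0)); first exact: cvg_cst.
apply/funext => _; rewrite /ip; under eq_Rintegral do rewrite subrr mul0r.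
by rewrite Rintegral_cst// mul0r.
Qed.

Lemma ip_sqrD_le (f g : T -> R) : sqint m f -> sqint m g ->
  ip m (fun x => f x + g x) (fun x => f x + g x) <= 2 * ip m f f + 2 * ip m g g.
Proof.
move=> sf sg; have := ip_ge0 m (fun x => f x - g x).
rewrite ipBB// ipDl//; last exact: sqintD.
have E (h : T -> R) : sqint m h -> ip m h (fun x => f x + g x) = ip m f h + ip m g h.
  by move=> sh; rewrite ipC ipDl.
rewrite !E// (ipC m g f); lra.
Qed.

Lemma l2cvgD f_ f g_ g : l2cvg f_ f -> l2cvg g_ g ->
  l2cvg (fun i x => f_ i x + g_ i x) (fun x => f x + g x).
Proof.
move=> [sf_ sf hf] [sg_ sg hg]; split; [by move=> i; exact: sqintD|exact: sqintD|].
pose a i := ip m (fun x => f_ i x - f x) (fun x => f_ i x - f x).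
pose b i := ip m (fun x => g_ i x - g x) (fun x => g_ i x - g x).
apply: (@squeeze_cvgr _ _ _ _ (fun=> 0) (fun i => 2 * a i + 2 * b i)).
- apply: nearW => i; rewrite ip_ge0/=.
  have := ip_sqrD_le (sqintB (sf_ i) sf) (sqintB (sg_ i) sg).
  rewrite (_ : (fun x => f_ i x - f x + (g_ i x - g x)) =
    (fun x => f_ i x + g_ i x - (f x + g x)))//.
  by apply/funext => x; ring.
- exact: cvg_cst.
- rewrite -[X in _ --> X](_ : 2 * 0 + 2 * 0 = 0 :> R); last ring.
  by apply: cvgD; apply: cvgM => //; exact: cvg_cst.
Qed.

Lemma l2cvgZ c f_ f : l2cvg f_ f -> l2cvg (fun i x => c * f_ i x) (fun x => c * f x).
Proof.
move=> [sf_ sf hf]; split; [by move=> i; exact: sqintZ|exact: sqintZ|].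
rewrite (_ : (fun i => _) = (fun i => c ^+ 2 *
    ip m (fun x => f_ i x - f x) (fun x => f_ i x - f x))).
  rewrite -[X in _ --> X](mulr0 (c ^+ 2)).
  by apply: cvgM => //; exact: cvg_cst.
apply/funext => i; have sB := sqintB (sf_ i) sf.
have -> : (fun x => c * f_ i x - c * f x) = (fun x => c * (f_ i x - f x)).
  by apply/funext => x; rewrite mulrBr.
rewrite ipZl//; last exact: sqintZ.
by rewrite ipC ipZl// mulrA expr2.
Qed.

Lemma l2cvg_sum (I : Type) (r : seq I) (f_ : I -> nat -> T -> R) (f : I -> T -> R) :
  (forall j, l2cvg (f_ j) (f j)) ->
  l2cvg (fun i x => \sum_(j <- r) f_ j i x) (fun x => \sum_(j <- r) f j x).
Proof.
move=> h; elim: r => [|j r IH].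
  under eq_fun do under eq_fun do rewrite big_nil; under [X in l2cvg _ X]eq_fun do rewrite big_nil.
  exact: l2cvg_cst (sqint0 _).
under eq_fun do under eq_fun do rewrite big_cons; under [X in l2cvg _ X]eq_fun do rewrite big_cons.
exact: l2cvgD.
Qed.

Lemma l2cvg_ip f_ f g : l2cvg f_ f -> sqint m g -> ip m (f_ i) g @[i --> \oo] --> ip m f g.
Proof. by move=> [? ? ?] ?; exact: ip_cvg. Qed.

(** |f_i|^2 = |f_i - f|^2 + 2 <f_i, f> - |f|^2. *)
Lemma l2cvg_norm f_ f : l2cvg f_ f -> ip m (f_ i) (f_ i) @[i --> \oo] --> ip m f f.
Proof.
move=> cf; have [sf_ sf hf] := cf.
rewrite (_ : (fun i => _) = (fun i => ip m (fun x => f_ i x - f x) (fun x => f_ i x - f x)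
    + 2 * ip m (f_ i) f - ip m f f)).
  rewrite -[X in _ --> X](_ : 0 + 2 * ip m f f - ip m f f = ip m f f); last ring.
  apply: cvgB; last exact: cvg_cst.
  by apply: cvgD => //; apply: cvgM; [exact: cvg_cst|exact: l2cvg_ip].
by apply/funext => i; rewrite ipBB//; ring.
Qed.

End l2_convergence.

(** * Eigenfunctions of the clamped plate *)
Section plate.
Variables (R : realType) (n : nat) (Om : set 'rV[R]_n).
Hypotheses (oOm : open Om) (bOm : bounded_set Om).
Local Notation V := 'rV[R]_n.
Local Notation mu := (lebesgue_rV R n).
Implicit Types (u v g f : V -> R).

Let mOm : measurable Om. Proof. exact: open_measurable_rV. Qed.

Lemma L2_sqint u : L2 Om u -> sqint mu (u \_ Om).
Proof.
move=> Lu; split; last exact: Lfun2_integrable_sqr.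
by move: Lu; rewrite /L2 inE => /andP[]; rewrite inE.
Qed.

Lemma L2_norm_ip u : sqint mu (u \_ Om) ->
  L2_norm Om u = (Num.sqrt (ip mu (u \_ Om) (u \_ Om)))%:E.
Proof.
move=> [mu2 iu2]; rewrite /L2_norm unlock /=.
have -> : (\int[mu]_x `|(u \_ Om x)%:E| `^ 2 = (ip mu (u \_ Om) (u \_ Om))%:E)%E.
  rewrite /ip /Rintegral fineK; last first.
    have := integrable_fin_num measurableT iu2.
    by under eq_integral do rewrite /= expr2.
  apply: eq_integral => x _; rewrite abse_EFin poweR_EFin powR_mulrn//.
  by rewrite real_normK ?num_real// expr2.
by rewrite poweR12_sqrt ?lee_fin ?ip_ge0.
Qed.

Lemma sqint_L2 u : sqint mu (u \_ Om) -> L2 Om u.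
Proof.
move=> su; rewrite /L2 inE; apply/andP; split; first by rewrite inE; case: su.
by rewrite inE /finite_norm/= -[ltLHS]/(L2_norm Om u) L2_norm_ip// ltry.
Qed.

Lemma l2cvg_tests (f_ : nat -> V -> R) u : L2 Om u -> (forall m, test_fun Om (f_ m)) ->
  L2_norm Om (f_ m \- u) @[m --> \oo] --> 0%E -> l2cvg mu f_ (u \_ Om).
Proof.
move=> Lu tf h; have su := L2_sqint Lu; split => //.
  by move=> m; exact: test_sqint (tf m).
have E m : (f_ m \- u) \_ Om = (fun x => f_ m x - (u \_ Om) x).
  apply/funext => x; rewrite !patchE; case: ifPn => // /negP nx.
  by rewrite (test_out (tf m)) ?subr0// => Ox; apply: nx; rewrite inE.
have sB m : sqint mu (fun x => f_ m x - (u \_ Om) x).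
  by apply: sqintB => //; exact: test_sqint (tf m).
pose N m := Num.sqrt (ip mu (fun x => f_ m x - (u \_ Om) x) (fun x => f_ m x - (u \_ Om) x)).
have {}h : N m @[m --> \oo] --> (0 : R).
  have : (N m)%:E @[m --> \oo] --> (0 : R)%:E.
    move: h; rewrite (_ : (fun m => _) = (fun m => (N m)%:E))//.
    by apply/funext => m; rewrite L2_norm_ip E.
  by move=> /fine_cvgP[_].
rewrite (_ : (fun m => _) = (fun m => N m * N m)).
  by rewrite -[X in _ --> X](mulr0 (0 : R)); exact: cvgM.
by apply/funext => m; rewrite /N -expr2 sqr_sqrtr ?ip_ge0.
Qed.

Lemma Rintegral_restrict u f : \int[mu]_(x in Om) (u x * f x) = ip mu (u \_ Om) f.
Proof.
rewrite Rintegral_mkcond; apply: eq_Rintegral => x _.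
by rewrite !patchE; case: ifPn => // _; rewrite mul0r.
Qed.

(** An eigenfunction u together with g = Laplacian of u, both extended by 0. The
weak equation is required in the form <g, Laplacian f> = lam <u, f>, and both
functions are limits of a single sequence of test functions, as membership in
the closure of the test functions provides. This is all that the proof uses of
a solution, and it is stable under linear combinations. *)
Definition eigenpair (lam : R) u g := [/\ forall x, ~ Om x -> u x = 0,
  forall x, ~ Om x -> g x = 0,
  forall f, test_fun Om f -> ip mu g (laplacian f) = lam * ip mu u f &
  exists2 f_ : nat -> V -> R, (forall m, test_fun Om (f_ m)) &
    l2cvg mu f_ u /\ l2cvg mu (fun m => laplacian (f_ m)) g].

Definition eigenfun lam u := exists g, eigenpair lam u g.

(** Completeness of the test functions in L2(Om). *)
Definition tests_total := forall h, L2 Om h ->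
  (forall f, test_fun Om f -> \int[mu]_(x in Om) (h x * f x) = 0) ->
  {ae mu, forall x, Om x -> h x = 0}.

Hypothesis tot : tests_total.

(** The weak second derivatives D of u are tested against the test functions
partial i (partial i f). The approximating sequence converges to D [::], which
has the same integrals as u against test functions, hence equals u a.e. by
completeness. *)
Lemma solution_eigenfun lam u : clamped_plate_solution Om lam u -> eigenfun lam (u \_ Om).
Proof.
move=> [[Lu [D hD [f_ tf hf]]] hu].
have sD i : sqint mu (D [:: i; i] \_ Om) by apply: L2_sqint; have [] := hD [:: i; i] isT.
have su := L2_sqint Lu.
exists (fun x => \sum_(i < n) (D [:: i; i] \_ Om) x); split.
- by move=> x nx; rewrite patchE memNset.
- by move=> x nx; rewrite big1// => i _; rewrite patchE memNset.
- move=> f tF; have tL := test_laplacian tF.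
  have E (F : 'I_n -> V -> R) : (fun x => \sum_(i < n) F i x) = (fun x => \sum_(i < n) 1 * F i x).
    by apply/funext => x; apply: eq_bigr => i _; rewrite mul1r.
  have t2 i : test_fun Om (partial i (partial i (laplacian f))) by do 2 apply: test_partial.
  rewrite E ip_suml//; last exact: test_sqint tL.
  rewrite -!Rintegral_restrict -hu// Rintegral_restrict [laplacian (laplacian f)]E ipC ip_suml//.
    apply: eq_bigr => i _; rewrite !mul1r -[LHS](Rintegral_restrict (D [:: i; i]) (laplacian f)).
    rewrite [RHS]ipC -[RHS]Rintegral_restrict.
    have [_ /(_ _ tL) /=] := hD [:: i; i] isT.
    by rewrite sqrrN expr1n mul1r => ->.
  by move=> i; exact: test_sqint (t2 i).
exists f_ => //; split.
  have [LD wD] := hD [::] isT.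
  have cf := l2cvg_tests LD tf (hf [::] isT).
  have sD0 := L2_sqint LD.
  have := l2cvgD cf (f := D [::] \_ Om) (g_ := fun=> fun=> 0)
    (g := fun x => (u \_ Om) x - (D [::] \_ Om) x).
  have -> : (fun i x => f_ i x + 0) = f_ by apply/funext => i; apply/funext => x; rewrite addr0.
  have -> : (fun x => (D [::] \_ Om) x + ((u \_ Om) x - (D [::] \_ Om) x)) = u \_ Om.
    by apply/funext => x; rewrite subrKC.
  apply; split; [by move=> _; exact: sqint0|exact: sqintB|].
  rewrite (_ : (fun _ => _) = (fun=> 0)); first exact: cvg_cst.
  apply/funext => _; rewrite /ip; under eq_Rintegral do rewrite sub0r mulrNN.
  have LB : L2 Om (fun x => u x - D [::] x).
    apply: sqint_L2; rewrite (_ : _ \_ _ = (fun x => (u \_ Om) x - (D [::] \_ Om) x)).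
      exact: sqintB.
    by apply/funext => x; rewrite !patchE; case: ifPn => //; rewrite subr0.
  have orth f : test_fun Om f -> \int[mu]_(x in Om) ((u x - D [::] x) * f x) = 0.
    move=> tF; rewrite Rintegral_restrict.
    have -> : (fun x => u x - D [::] x) \_ Om = (fun x => (u \_ Om) x - (D [::] \_ Om) x).
      by apply/funext => x; rewrite !patchE; case: ifPn => //; rewrite subr0.
    rewrite ipBl//; last exact: test_sqint tF.
    by rewrite -!Rintegral_restrict; have /= := wD f tF; rewrite expr0 mul1r => ->; rewrite subrr.
  have w0 : {ae mu, forall x, (u \_ Om) x - (D [::] \_ Om) x = 0}.
    have := tot LB orth; apply: filterS => x h; rewrite !patchE; case: ifPn => [|_].
      by rewrite inE => /h.
    by rewrite subr0.
  have [mB _] := sqintB su sD0.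
  rewrite /Rintegral (ae_eq_integral (cst 0%E))//.
  - by rewrite integral0.
  - by apply/measurable_EFinP; exact: measurable_funM.
  - by apply: filterS w0 => x wx _; rewrite /= wx mul0r.
apply: l2cvg_sum => i; apply: (l2cvg_tests (f_ := fun m => partials [:: i; i] (f_ m))).
- by have [] := hD [:: i; i] isT.
- by move=> m; exact: test_partials.
- exact: hf.
Qed.

Lemma eigenfun_sqint lam u : eigenfun lam u -> sqint mu u.
Proof. by move=> [g [_ _ _ [f_ _ [[_ + _] _]]]]. Qed.

Lemma eigenfun0 lam : eigenfun lam (fun=> 0).
Proof.
have L0 : laplacian (fun=> 0 : R) = (fun=> 0) :> (V -> R).
  apply/funext => x; rewrite /laplacian big1// => i _.
  by have := @partials0 R n [:: i; i] => /(congr1 (@^~ x)).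
have c0 := l2cvg_cst (sqint0 mu).
exists (fun=> 0); split => //.
  move=> f _; have -> : ip mu (fun=> 0) (laplacian f) = 0.
    by rewrite /ip; under eq_Rintegral do rewrite mul0r; rewrite Rintegral_cst// mul0r.
  by rewrite /ip; under eq_Rintegral do rewrite mul0r; rewrite Rintegral_cst// mul0r mulr0.
by exists (fun=> fun=> 0); [move=> _; exact: test0|rewrite L0].
Qed.

Lemma eigenfunD lam u v : eigenfun lam u -> eigenfun lam v ->
  eigenfun lam (fun x => u x + v x).
Proof.
move=> [g [u0 g0 hg [f_ tf [cf cLf]]]] [h [v0 h0 hh [e_ te [ce cLe]]]].
exists (fun x => g x + h x); split.
- by move=> x nx; rewrite u0// v0// addr0.
- by move=> x nx; rewrite g0// h0// addr0.
- move=> f tF; have tL := test_sqint (test_laplacian tF); have sF := test_sqint tF.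
  case: cf cLf ce cLe => _ su _ [_ sg _] [_ sv _] [_ sh _].
  by rewrite !ipDl// hg// hh// mulrDr.
exists (fun m x => f_ m x + e_ m x); first by move=> m; exact: testD.
split; first exact: l2cvgD.
by under eq_fun do rewrite (laplacianD (Om := Om))//; exact: l2cvgD.
Qed.

Lemma eigenfunZ lam c u : eigenfun lam u -> eigenfun lam (fun x => c * u x).
Proof.
move=> [g [u0 g0 hg [f_ tf [cf cLf]]]].
exists (fun x => c * g x); split.
- by move=> x nx; rewrite u0// mulr0.
- by move=> x nx; rewrite g0// mulr0.
- move=> f tF; have tL := test_sqint (test_laplacian tF); have sF := test_sqint tF.
  case: cf cLf => _ su _ [_ sg _].
  by rewrite !ipZl// hg// mulrCA.
exists (fun m x => c * f_ m x); first by move=> m; exact: testZ.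
split; first exact: l2cvgZ.
by under eq_fun do rewrite (laplacianZ _ (Om := Om))//; exact: l2cvgZ.
Qed.

Lemma eigenfun_sum lam k (c : 'I_k -> R) (e : 'I_k -> V -> R) :
  (forall i, eigenfun lam (e i)) -> eigenfun lam (fun x => \sum_(i < k) c i * e i x).
Proof.
move=> he; rewrite -[index_enum _]/(index_enum 'I_k); elim: (index_enum _) => [|i r IH].
  by under eq_fun do rewrite big_nil; exact: eigenfun0.
under eq_fun do rewrite big_cons.
by apply: eigenfunD => //; exact: eigenfunZ.
Qed.

(** The weak equation for u is tested with the approximants of v. *)
Lemma eigenpair_form lam u g lam' v h : eigenpair lam u g -> eigenpair lam' v h ->
  ip mu g h = lam * ip mu u v.
Proof.
move=> [_ _ hg [f_ _ [[_ su _] [_ sg _]]]] [_ _ _ [e_ te [ce cLe]]].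
have c1 : ip mu (laplacian (e_ m)) g @[m --> \oo] --> ip mu h g by exact: l2cvg_ip cLe sg.
have c2 : lam * ip mu (e_ m) u @[m --> \oo] --> lam * ip mu v u.
  by apply: cvgM; [exact: cvg_cst|exact: l2cvg_ip ce su].
rewrite ipC (ipC mu u); apply: cvg_unique c1 _ => //.
rewrite (_ : (fun m => _) = (fun m => lam * ip mu (e_ m) u))//.
by apply/funext => m; rewrite ipC hg// (ipC mu u).
Qed.

(** The form <g, h> is symmetric, whence lam <u, v> = lam' <u, v>. *)
Lemma eigenfun_orth lam lam' u v : eigenfun lam u -> eigenfun lam' v -> lam != lam' ->
  ip mu u v = 0.
Proof.
move=> [g eu] [h ev] ll; have := eigenpair_form ev eu; rewrite ipC (eigenpair_form eu ev).
move/eqP; rewrite (ipC mu v) -subr_eq0 -mulrBl mulf_eq0 subr_eq0 (negbTE ll) => /eqP.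
exact.
Qed.

Lemma sqint_indic : sqint mu \1_Om.
Proof.
split; first exact: measurable_indic.
rewrite (_ : _ \o _ = EFin \o \1_Om); first exact: integrable_indic_bounded.
by apply/funext => x /=; rewrite indicE; case: (x \in Om); rewrite ?expr1n ?expr0n.
Qed.

Lemma supported_mul_indic u f : (forall x, ~ Om x -> u x = 0) ->
  (fun x => u x * (\1_Om x * f x)) = (fun x => u x * f x).
Proof.
move=> u0; apply/funext => x; rewrite indicE; have [Ox|nOx] := pselect (Om x).
  by rewrite mem_set// mul1r.
by rewrite u0// !mul0r.
Qed.

Lemma supported_integrable u : sqint mu u -> (forall x, ~ Om x -> u x = 0) ->
  mu.-integrable setT (EFin \o u).
Proof.
move=> su u0; have := sqint_mul su sqint_indic.
have := supported_mul_indic (fun=> 1) u0.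
under eq_fun do rewrite mulr1; under [X in _ = X -> _]eq_fun do rewrite mulr1.
by move=> ->.
Qed.

Lemma sqint_trig (g : R -> R) (z : V) : measurable_fun [set: R] g -> (forall t, `|g t| <= 1) ->
  sqint mu (fun x => \1_Om x * g (dot z x)).
Proof.
move=> mg g1; have mgd : measurable_fun [set: V] (fun x => g (dot z x)).
  by apply: (measurableT_comp mg); exact: measurable_dot.
have [mI iI] := sqint_indic.
split; first exact: measurable_funM.
rewrite (_ : _ \o _ = EFin \o (fun x => \1_Om x ^+ 2 * g (dot z x) ^+ 2)).
  apply: (integrable_mul_bounded (C := 1)) => //; first exact: measurable_funX.
  by move=> x; rewrite normrX expr_le1.
by apply/funext => x /=; rewrite exprMn.
Qed.

Lemma ftrig_ip (g : R -> R) u z : (forall x, ~ Om x -> u x = 0) ->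
  ftrig g u z = ip mu u (fun x => \1_Om x * g (dot z x)).
Proof.
by move=> u0; rewrite /ftrig /ip; congr Rintegral; rewrite supported_mul_indic.
Qed.

(** On functions supported in Om, the transform at z is an inner product with a
square-integrable function, namely a plane wave cut off to Om. *)
Lemma l2cvg_ftrig (g : R -> R) (f_ : nat -> V -> R) u z : measurable_fun [set: R] g ->
  (forall t, `|g t| <= 1) -> (forall m, test_fun Om (f_ m)) -> (forall x, ~ Om x -> u x = 0) ->
  l2cvg mu f_ u -> ftrig g (f_ m) z @[m --> \oo] --> ftrig g u z.
Proof.
move=> mg g1 tf u0 cf; rewrite ftrig_ip//.
rewrite (_ : (fun m => _) = (fun m => ip mu (f_ m) (fun x => \1_Om x * g (dot z x)))).
  by apply: l2cvg_ip => //; exact: sqint_trig.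
by apply/funext => m; rewrite ftrig_ip// => x; exact: test_out.
Qed.

Lemma l2cvg_fpower (f_ : nat -> V -> R) u z : (forall m, test_fun Om (f_ m)) ->
  (forall x, ~ Om x -> u x = 0) -> l2cvg mu f_ u ->
  fpower (f_ m) z @[m --> \oo] --> fpower u z.
Proof.
move=> tf u0 cf; rewrite /fpower; under eq_fun do rewrite !expr2; rewrite !expr2.
by apply: cvgD; apply: cvgM; apply: l2cvg_ftrig => //;
  by [exact: measurable_cos|exact: measurable_sin|exact: cos_le1_norm|exact: sin_le1_norm].
Qed.

(** The identity for test functions passes to the limit for each z. *)
Lemma eigenpair_fpower lam u g z : eigenpair lam u g ->
  fpower g z = sqr_enorm z ^+ 2 * fpower u z.
Proof.
move=> [u0 g0 _ [f_ tf [cf cLf]]].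
have c1 := @l2cvg_fpower _ _ z (fun m => test_laplacian (tf m)) g0 cLf.
apply: cvg_unique c1 _ => //.
rewrite (_ : (fun m => _) = (fun m => sqr_enorm z ^+ 2 * fpower (f_ m) z)); last first.
  by apply/funext => m; rewrite (fpower_laplacian z (tf m)).
by apply: cvgM; [exact: cvg_cst|exact: l2cvg_fpower].
Qed.

Lemma ip_sqrE u : sqint mu u -> ((ip mu u u)%:E = \int[mu]_x (u x ^+ 2)%:E)%E.
Proof.
move=> su; rewrite /ip /Rintegral fineK.
  by apply: eq_integral => x _; rewrite expr2.
exact: (integrable_fin_num measurableT (sqint_mul su su)).
Qed.

(** The left-hand side is the integral of the squared Fourier transform of g, and
<g, g> = lam <u, u>. *)
Lemma eigenfun_quartic_le lam u : eigenfun lam u ->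
  (\int[mu]_z (enorm z ^+ 4 * fpower u z)%:E <= ((2 * pi) ^+ n * (lam * ip mu u u))%:E)%E.
Proof.
move=> [g eu]; have [u0 g0 _ [f_ tf [[_ su _] [_ sg _]]]] := eu.
have ig := supported_integrable sg g0.
under eq_integral do rewrite (exprM _ 2 2) sqr_enormE -(eigenpair_fpower _ eu).
apply: le_trans (fpower_integral_le ig) _.
by rewrite -(eigenpair_form eu eu) EFinM ip_sqrE.
Qed.

(** (a + b)^2 <= (1 + eta) a^2 + (1 + 1 / eta) b^2, applied to both transforms. *)
Lemma fpower_sum_le u v (eta : R) z : 0 < eta -> mu.-integrable setT (EFin \o u) ->
  mu.-integrable setT (EFin \o v) ->
  fpower (fun x => u x + v x) z <= (1 + eta) * fpower u z + (1 + eta^-1) * fpower v z.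
Proof.
move=> eta0 iu iv.
have D (g : R -> R) : measurable_fun [set: R] g -> (forall t, `|g t| <= 1) ->
    ftrig g (fun x => u x + v x) z = ftrig g u z + ftrig g v z.
  move=> mg g1; have mgd : measurable_fun [set: V] (fun x => g (dot z x)).
    by apply: (measurableT_comp mg); exact: measurable_dot.
  rewrite /ftrig -RintegralD//; try exact: (integrable_mul_bounded (C := 1)).
  by apply: eq_Rintegral => x _; rewrite mulrDl.
have sqr_le (a b : R) : (a + b) ^+ 2 <= (1 + eta) * a ^+ 2 + (1 + eta^-1) * b ^+ 2.
  rewrite -subr_ge0 (_ : _ - _ = eta^-1 * (eta * a - b) ^+ 2); last by field; lra.
  by rewrite mulr_ge0 ?invr_ge0 ?sqr_ge0 ?ltW.
rewrite /fpower !D//; [|exact: measurable_sin|exact: sin_le1_norm|exact: measurable_cos|exact: cos_le1_norm].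
have := sqr_le (ftrig cos u z) (ftrig cos v z); have := sqr_le (ftrig sin u z) (ftrig sin v z).
lra.
Qed.

Lemma fpower_fin_num u : sqint mu u -> (forall x, ~ Om x -> u x = 0) ->
  (\int[mu]_z (fpower u z)%:E \is a fin_num)%E.
Proof.
move=> su u0; rewrite ge0_fin_numE; last by apply: integral_EFin_ge0; exact: fpower_ge0.
apply: le_lt_trans (fpower_integral_le (supported_integrable su u0)) _.
by rewrite -ip_sqrE// -EFinM ltry.
Qed.

(** The bound for continuous functions is transferred from f_m = u + w_m, where w_m
tends to 0 in L2: with the upper half of Plancherel for w_m,
A |f_m|^2 <= (1 + eta) P + (1 + 1 / eta) A |w_m|^2, then m tends to infinity and eta
to 0. *)
Lemma eigenfun_plancherel lam u : eigenfun lam u ->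
  (((2 * pi) ^+ n * ip mu u u)%:E <= \int[mu]_z (fpower u z)%:E)%E.
Proof.
move=> [g [u0 _ _ [f_ tf [cf _]]]]; have [sf_ su hf] := cf.
have iu := supported_integrable su u0.
have Pfin := fpower_fin_num su u0.
rewrite -(fineK Pfin) lee_fin; set P := fine _; set A := (2 * pi) ^+ n.
have A0 : 0 <= A by rewrite exprn_ge0// mulr_ge0// pi_ge0.
have P0 : 0 <= P by apply: fine_ge0; apply: integral_EFin_ge0; exact: fpower_ge0.
pose w m x := f_ m x - u x.
have step (eta : R) m : 0 < eta ->
    A * ip mu (f_ m) (f_ m) <= (1 + eta) * P + (1 + eta^-1) * (A * ip mu (w m) (w m)).
  move=> eta0; have sw : sqint mu (w m) by exact: sqintB.
  have w0 x : ~ Om x -> w m x = 0 by move=> nx; rewrite /w u0// (test_out (tf m))// subr0.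
  have iw := supported_integrable sw w0.
  have [C _ fC] := test_bounded (tf m).
  rewrite -lee_fin EFinM ip_sqrE//.
  have := fpower_integral_ge (test_continuous (tf m)) fC (test_integrable (tf m)).
  rewrite EFinM -[X in (_ * X <= _)%E -> _](_ : (\int[mu]_x (f_ m x ^+ 2)%:E = _)%E); last first.
    by rewrite -ip_sqrE.
  move=> /le_trans; apply.
  have E : f_ m = (fun x => u x + w m x) by apply/funext => x; rewrite /w subrKC.
  have mu_ := measurable_fpower iu; have mw_ := measurable_fpower iw.
  apply: (@le_trans _ _ (\int[mu]_z ((1 + eta) * fpower u z + (1 + eta^-1) * fpower (w m) z)%:E)%E).
    apply: le_integral_EFin.
    - exact: measurable_fpower (test_integrable (tf m)).
    - by apply: measurable_funD; exact: measurable_funM.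
    - by move=> z; rewrite fpower_ge0/= {1}E; exact: fpower_sum_le.
  have e1 : 0 <= 1 + eta by lra.
  have e2 : 0 <= 1 + eta^-1 by rewrite addr_ge0// invr_ge0 ltW.
  rewrite integral_EFinD; last 4 first.
  - exact: measurable_funM.
  - exact: measurable_funM.
  - by move=> z; rewrite mulr_ge0// fpower_ge0.
  - by move=> z; rewrite mulr_ge0// fpower_ge0.
  rewrite !integral_EFinZ//; try exact: fpower_ge0.
  rewrite (EFinD ((1 + eta) * P)) (EFinM (1 + eta)) (EFinM (1 + eta^-1)) /P fineK//.
  rewrite leeD2l// lee_wpmul2l ?lee_fin//.
  by apply: le_trans (fpower_integral_le iw) _; rewrite EFinM ip_sqrE.
have lim (eta : R) : 0 < eta -> A * ip mu u u <= (1 + eta) * P.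
  move=> eta0.
  have c1 : A * ip mu (f_ m) (f_ m) @[m --> \oo] --> A * ip mu u u.
    by apply: cvgM; [exact: cvg_cst|exact: l2cvg_norm].
  have c2 : (1 + eta) * P + (1 + eta^-1) * (A * ip mu (w m) (w m)) @[m --> \oo] -->
      (1 + eta) * P + (1 + eta^-1) * (A * 0).
    apply: cvgD; first exact: cvg_cst.
    by apply: cvgM; [exact: cvg_cst|apply: cvgM => //; exact: cvg_cst].
  rewrite !mulr0 addr0 in c2.
  by apply: ler_cvg_to c1 c2 _; apply: nearW => m; exact: step.
apply/ler_addgt0Pr => e e0.
have P1 : 0 < P + 1 by lra.
apply: le_trans (lim (e / (P + 1)) _) _; first exact: divr_gt0.
rewrite mulrDl mul1r lerD2l mulrAC ler_pdivrMr// ler_pM2l//; lra.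
Qed.

End plate.

(** * Orthonormal eigenfunctions *)
Section eigenbasis.
Variables (R : realType) (n : nat) (Om : set 'rV[R]_n) (Gam : nat -> R).
Hypotheses (oOm : open Om) (bOm : bounded_set Om) (hGam : clamped_plate_spectrum Om Gam).
Local Notation V := 'rV[R]_n.
Local Notation mu := (lebesgue_rV R n).

Let mOm : measurable Om. Proof. exact: open_measurable_rV. Qed.

Lemma spectrum_gt0 j : 0 < Gam j.
Proof. by case: hGam => G0 nG _ _; apply: lt_le_trans G0 (nG _ _ _). Qed.

(** A function h of L2(Om) orthogonal to all test functions is a solution for every
lam, with 0 as its weak derivatives and approximants. As the spectrum is positive,
the solution space for lam = -1 has dimension 0, so h = 0 a.e. *)
Lemma spectrum_tests_total : tests_total Om.
Proof.
move=> h Lh orth; have [_ _ _ /(_ (-1))[m [e [_ _ span]] cm]] := hGam.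
have m0 : m = 0%N.
  have : [set j | Gam j = -1] = set0.
    apply/seteqP; split=> j //= Gj; have := spectrum_gt0 j; rewrite Gj; lra.
  move=> E; move: cm; rewrite E card_eq_sym card_eq0 => /eqP; case: m {e span} => // m.
  by move=> /seteqP[/(_ 0%N) h0 _]; have := h0 isT.
have I0 f : \int[mu]_(x in Om) (0 * f x) = 0.
  by under eq_Rintegral do rewrite mul0r; rewrite Rintegral_cst// mul0r.
have sol : clamped_plate_solution Om (-1) h.
  split; last first.
    move=> f tF; rewrite !orth ?mulr0//; do 2 apply: test_laplacian; exact: tF.
  split => //; exists (fun _ _ => 0).
    move=> s _; split.
      apply: sqint_L2; rewrite (_ : _ \_ _ = fun=> 0); first exact: sqint0.
      by apply/funext => x; rewrite patchE; case: ifPn.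
    by move=> f tF; rewrite I0 mulr0 orth//; exact: test_partials.
  exists (fun _ _ => 0); first by move=> _; exact: test0.
  move=> s _; rewrite (_ : (fun _ => _) = fun=> 0%E); first exact: cvg_cst.
  apply/funext => _; rewrite partials0 L2_norm_ip.
    rewrite (_ : _ \_ _ = fun=> 0); last first.
      by apply/funext => x; rewrite patchE/= subr0; case: ifPn.
    rewrite /ip; under eq_Rintegral do rewrite mul0r.
    by rewrite Rintegral_cst// mul0r sqrtr0.
  rewrite (_ : _ \_ _ = fun=> 0); first exact: sqint0.
  by apply/funext => x; rewrite patchE/= subr0; case: ifPn.
have [c] := span h sol; apply: filterS => x hx Ox; rewrite hx//.
by rewrite big1// => -[i im] _; exfalso; move: im; rewrite m0.
Qed.

(** Induction on k. The eigenvalue lam = Gam k has multiplicity m, and fewer than m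
indices j < k have Gam j = lam, since k is one more such index. Hence some
nonzero combination of the m independent solutions is orthogonal to the w j
already chosen for lam; orthogonality to the others is automatic. *)
Lemma orthonormal_eigenfuns (k : nat) : exists w : nat -> V -> R,
  (forall j, (j < k)%N -> eigenfun Om (Gam j) (w j)) /\
  forall i j, (i < k)%N -> (j < k)%N -> ip mu (w i) (w j) = (i == j)%:R.
Proof.
have tot := spectrum_tests_total.
elim: k => [|k [w [ew on]]]; first by exists (fun _ _ => 0).
have [_ _ _ /(_ (Gam k))[m [e [he indep _]]]] := hGam.
move=> /card_set_bijP[F [Fm Fi _]].
have {}Fm j : Gam j = Gam k -> (F j < m)%N by move=> Gj; exact: (Fm j).
case: m => [|m] in e he indep Fm *; first by have := Fm k erefl.
pose e' i := e i \_ Om.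
have he' i : eigenfun Om (Gam k) (e' i) by exact: solution_eigenfun (he i).
have se' i : sqint mu (e' i) := eigenfun_sqint (he' i).
(* The indices whose eigenfunctions must be avoided. *)
pose J := [set j : 'I_k | Gam j == Gam k]%SET.
(* The enumeration F of the indices of lam sends k outside the image of J. *)
have Jm : (#|J| < m.+1)%N.
  pose h (j : 'I_k) : 'I_m.+1 := inord (F j).
  have hi : {in J &, injective h}.
    move=> i j; rewrite !inE => /eqP iJ /eqP jJ /(congr1 val)/=.
    rewrite !inordK ?Fm// => Fij; apply/val_inj.
    by apply: Fi => //; rewrite inE.
  rewrite -(card_in_imset hi) -[X in (_ < X)%N]card_ord -cardsT.
  apply: proper_card; rewrite properE finset.subsetT; apply/subsetPn.
  exists (inord (F k)) => //; apply/imsetP => -[j]; rewrite inE => /eqP jJ /(congr1 val)/=.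
  rewrite !inordK ?Fm// => Fkj; have := ltn_ord j.
  by rewrite -(Fi k j) ?ltnn ?inE.
pose A := \matrix_(i < m.+1, j < #|J|) ip mu (e' i) (w (enum_val j)).
(* More rows than columns. *)
have /rowV0Pn[v /sub_kermxP vA v0] : kermx A != 0.
  rewrite -mxrank_eq0 mxrank_ker subn_eq0 -ltnNge.
  exact: leq_ltn_trans (rank_leq_col A) Jm.
pose z x := \sum_(i < m.+1) v ord0 i * e' i x.
have ez : eigenfun Om (Gam k) z by exact: eigenfun_sum.
have sz := eigenfun_sqint ez.
have zw j : (j < k)%N -> ip mu z (w j) = 0.
  move=> jk; have [GjE|GjN] := eqVneq (Gam j) (Gam k); last first.
    by apply: eigenfun_orth ez (ew j jk) _; rewrite eq_sym.
  have jJ : Ordinal jk \in J by rewrite finset.in_set; apply/eqP.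
  rewrite ip_suml//; last exact: eigenfun_sqint (ew j jk).
  transitivity ((v *m A) ord0 (enum_rank_in jJ (Ordinal jk))); last by rewrite vA mxE.
  by rewrite mxE; apply: eq_bigr => i _; rewrite mxE enum_rankK_in.
have zz : 0 < ip mu z z.
  rewrite lt_neqAle ip_ge0 andbT eq_sym; apply/eqP => zz0.
  have z0 := ip_eq0_ae sz zz0.
  move/eqP : v0; apply; apply/rowP => i; rewrite mxE; apply: (indep (fun i => v ord0 i)).
  apply: filterS z0 => x zx Ox; rewrite -[RHS]zx; apply: eq_bigr => l _.
  by rewrite /e' patchE mem_set.
pose c := (Num.sqrt (ip mu z z))^-1.
have cz : ip mu (fun x => c * z x) (fun x => c * z x) = 1.
  rewrite ipZl//; last exact: sqintZ.
  rewrite ipC ipZl// mulrA -expr2 exprVn sqr_sqrtr ?mulVf ?gt_eqF//; exact: ltW.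
exists (fun j => if j == k then (fun x => c * z x) else w j); split.
  move=> j; rewrite ltnS leq_eqVlt; case: eqVneq => [->_|_ /= jk]; last exact: ew.
  exact: eigenfunZ.
have cw j : (j < k)%N -> ip mu (fun x => c * z x) (w j) = 0.
  by move=> jk; rewrite ipZl ?zw ?mulr0//; exact: eigenfun_sqint (ew j jk).
have lt j : (j < k.+1)%N -> j != k -> (j < k)%N by move=> jk1 jk; rewrite ltn_neqAle jk.
move=> i j hi hj; have [ik|ik] := boolP (i == k); have [jk|jk] := boolP (j == k).
- by rewrite cz (eqP ik) (eqP jk) eqxx.
- by rewrite cw ?lt// (eqP ik) eq_sym (negbTE jk).
- by rewrite ipC cw ?lt// (eqP jk) (negbTE ik).
- by apply: on; exact: lt.
Qed.

End eigenbasis.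

(** * The spectral density *)

(** 2 - 2 cos t = 4 sin^2 (t / 2); a chord of the unit circle is
shorter than its arc. *)
Lemma one_sub_cos_le (R : realType) (t : R) : 2 - 2 * cos t <= t ^+ 2.
Proof.
have h (y : R) : 0 <= y -> sin y ^+ 2 <= y ^+ 2.
  move=> y0; have [y1|y1] := leP 1 y.
    apply: (@le_trans _ _ 1); last by rewrite exprn_ege1.
    by rewrite -(cos2Dsin2 y) lerDr sqr_ge0.
  have s0 : 0 <= sin y by apply: sin_ge0_pi; rewrite y0/=; have := @pi_ge3 R; lra.
  by rewrite lerXn2r ?nnegrE// sin_le_id.
have {}h (y : R) : sin y ^+ 2 <= y ^+ 2.
  have [y0|y0] := leP 0 y; first exact: h.
  by rewrite -(sqrrN (sin y)) -(sqrrN y) -sinN; apply: h; lra.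
have := h (t / 2); have := cos_mulr2n (t / 2); have := cos2Dsin2 (t / 2).
rewrite (_ : (t / 2) *+ 2 = t); last by rewrite mulr2n; field.
rewrite mulr2n => h1 ->; have -> : (t / 2) ^+ 2 = t ^+ 2 / 4 by field.
lra.
Qed.

(** Cauchy-Schwarz, from the nonnegativity of the sum of (|x|^2 z_i - (z . x) x_i)^2. *)
Lemma dot_sqr_le (R : realType) (n : nat) (z x : 'rV[R]_n) :
  dot z x ^+ 2 <= sqr_enorm z * sqr_enorm x.
Proof.
have X0 := sqr_enorm_ge0 x; set X := sqr_enorm x in X0 *; set D := dot z x.
have E : \sum_(i < n) (X * z ord0 i - D * x ord0 i) ^+ 2 = X * (X * sqr_enorm z - D ^+ 2).
  transitivity (X ^+ 2 * sqr_enorm z - 2 * (X * D) * D + D ^+ 2 * X); last by ring.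
  have e1 : X ^+ 2 * sqr_enorm z = \sum_(i < n) X ^+ 2 * z ord0 i ^+ 2 by rewrite -mulr_sumr.
  have e2 : 2 * (X * D) * D = \sum_(i < n) 2 * (X * D) * (z ord0 i * x ord0 i).
    by rewrite -mulr_sumr.
  have e3 : D ^+ 2 * X = \sum_(i < n) D ^+ 2 * x ord0 i ^+ 2 by rewrite -mulr_sumr.
  by rewrite e1 e2 e3 -sumrB -big_split; apply: eq_bigr => i _ /=; ring.
have S0 : 0 <= X * (X * sqr_enorm z - D ^+ 2).
  by rewrite -E; apply: sumr_ge0 => i _; exact: sqr_ge0.
have [X1|X1] := ltP 0 X; first by move: S0; rewrite pmulr_rge0// subr_ge0 mulrC.
have {X1}X1 : X = 0 by apply/le_anti; rewrite X1 X0.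
rewrite X1 mulr0 /D /dot big1 ?expr0n// => i _.
suff -> : x ord0 i = 0 by rewrite mulr0.
have : x ord0 i ^+ 2 <= X.
  by rewrite /X /sqr_enorm (bigD1 i)//= lerDl sumr_ge0// => j _; exact: sqr_ge0.
by rewrite X1 => h; apply/eqP; rewrite -sqrf_eq0 eq_le h sqr_ge0.
Qed.

Section spectral_density.
Variables (R : realType) (n : nat) (Om : set 'rV[R]_n) (k : nat) (w : nat -> 'rV[R]_n -> R).
Local Notation V := 'rV[R]_n.
Local Notation mu := (lebesgue_rV R n).
Hypotheses (oOm : open Om) (bOm : bounded_set Om).
Hypothesis sw : forall j, (j < k)%N -> sqint mu (w j).
Hypothesis w0 : forall j, (j < k)%N -> forall x, ~ Om x -> w j x = 0.
Hypothesis on : forall i j, (i < k)%N -> (j < k)%N -> ip mu (w i) (w j) = (i == j)%:R.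

Let mOm : measurable Om. Proof. exact: open_measurable_rV. Qed.

Lemma bessel_on (h : V -> R) : sqint mu h -> \sum_(j < k) ip mu (w j) h ^+ 2 <= ip mu h h.
Proof.
move=> sh; apply: (@bessel _ _ _ mu k (fun j : 'I_k => w j)) => //.
  by move=> j; exact: sw.
by move=> i j; rewrite on.
Qed.

(** Real (g = cos) and imaginary (g = sin) parts of a plane wave centred at a and
cut off to Om. *)
Definition wave (g : R -> R) (a z x : V) : R := \1_Om x * g (dot z (x - a)).

Lemma sqint_wave (g : R -> R) a z : measurable_fun [set: R] g -> (forall t, `|g t| <= 1) ->
  sqint mu (wave g a z).
Proof.
move=> mg g1; have mgd : measurable_fun [set: V] (fun x => g (dot z (x - a))).
  apply: (measurableT_comp mg).
  rewrite (_ : (fun x => _) = (fun x => dot z x - dot z a)).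
    by apply: measurable_funB => //; exact: measurable_dot.
  by apply/funext => x; rewrite dotBr.
have [mI iI] := sqint_indic oOm bOm.
split; first exact: measurable_funM.
rewrite (_ : _ \o _ = EFin \o (fun x => \1_Om x ^+ 2 * g (dot z (x - a)) ^+ 2)).
  apply: (integrable_mul_bounded (C := 1)) => //; first exact: measurable_funX.
  by move=> x; rewrite normrX expr_le1.
by apply/funext => x /=; rewrite exprMn.
Qed.

Let swc a z : sqint mu (wave cos a z).
Proof. by apply: sqint_wave; [exact: measurable_cos|exact: cos_le1_norm]. Qed.

Let sws a z : sqint mu (wave sin a z).
Proof. by apply: sqint_wave; [exact: measurable_sin|exact: sin_le1_norm]. Qed.

(** Moving the centre of the waves to a multiplies the Fourier transform by a
number of modulus 1. *)
Lemma fpower_wave a z j : (j < k)%N ->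
  fpower (w j) z = ip mu (w j) (wave cos a z) ^+ 2 + ip mu (w j) (wave sin a z) ^+ 2.
Proof.
move=> jk; have sj := sw jk.
have E g : ftrig g (w j) z = ip mu (w j) (wave g 0 z).
  rewrite (ftrig_ip _ _ (w0 jk)); congr (ip mu (w j) _).
  by apply/funext => x; rewrite /wave subr0.
pose c := cos (dot z a); pose s := sin (dot z a).
have Ec : wave cos a z = (fun x => c * wave cos 0 z x + s * wave sin 0 z x).
  by apply/funext => x; rewrite /wave subr0 dotBr cosB /c /s; ring.
have Es : wave sin a z = (fun x => c * wave sin 0 z x + (- s) * wave cos 0 z x).
  by apply/funext => x; rewrite /wave subr0 dotBr sinB /c /s; ring.
have lin b d (f h : V -> R) : sqint mu f -> sqint mu h ->
    ip mu (w j) (fun x => b * f x + d * h x) = b * ip mu (w j) f + d * ip mu (w j) h.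
  by move=> sf sh; rewrite ipC ipDl ?ipZl//; [rewrite !(ipC mu (w j))|exact: sqintZ|exact: sqintZ].
rewrite Ec Es !lin// /fpower !E.
move: (ip mu (w j) (wave cos 0 z)) (ip mu (w j) (wave sin 0 z)) => p q.
transitivity ((c ^+ 2 + s ^+ 2) * (p ^+ 2 + q ^+ 2)); last by ring.
by rewrite cos2Dsin2 mul1r.
Qed.

Lemma wave_norm a z : ip mu (wave cos a z) (wave cos a z) + ip mu (wave sin a z) (wave sin a z) =
  volume Om.
Proof.
rewrite -RintegralD//; try exact: sqint_mul.
transitivity (\int[mu]_x \1_Om x).
  apply: eq_Rintegral => x _; rewrite /wave.
  have := cos2Dsin2 (dot z (x - a)); move: (cos _) (sin _) => c s cs.
  transitivity (\1_Om x * \1_Om x * (c ^+ 2 + s ^+ 2) : R); first by ring.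
  by rewrite cs mulr1 indicE; case: (x \in Om); rewrite ?mulr1 ?mulr0.
by rewrite /Rintegral integral_indic// setIT.
Qed.

(** Bessel's inequality for the two waves, the squares of which add up to the
indicator function of Om. *)
Lemma sum_fpower_le z : \sum_(j < k) fpower (w j) z <= volume Om.
Proof.
rewrite -(wave_norm 0 z); apply: le_trans (lerD (bessel_on (swc 0 z)) (bessel_on (sws 0 z))).
by rewrite -big_split; apply: ler_sum => j _; rewrite (fpower_wave 0).
Qed.

(** Pointwise, the squared distance of the two waves is at most
((z - z') . (x - a))^2. *)
Lemma wave_dist a z z' :
  ip mu (fun x => wave cos a z x - wave cos a z' x) (fun x => wave cos a z x - wave cos a z' x) +
  ip mu (fun x => wave sin a z x - wave sin a z' x) (fun x => wave sin a z x - wave sin a z' x) <=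
  sqr_enorm (z - z') * \int[mu]_(x in Om) sqr_enorm (x - a).
Proof.
have sc := sqintB (swc a z) (swc a z'); have ss := sqintB (sws a z) (sws a z').
have ii : mu.-integrable Om (EFin \o (fun x => sqr_enorm (x - a))).
  have [C C0 CO] := sqr_enormB_le a bOm.
  apply: (integrable_bounded (C := C)) => //; first exact: measurable_sqr_enormB.
  by move=> x Ox; rewrite ger0_norm ?sqr_enorm_ge0//; exact: CO.
rewrite -RintegralD//; try exact: sqint_mul.
rewrite -RintegralZl// [leRHS]Rintegral_mkcond; apply: le_Rintegral => //.
- by apply: (integrable_addr (f := fun x => _ * _) (g := fun x => _ * _)); exact: sqint_mul.
- rewrite -restrict_EFin; apply/(integrable_mkcond _ mOm).
  exact: (integrableZl mOm (sqr_enorm (z - z')) ii).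
move=> x _; rewrite /wave patchE indicE; case: (x \in Om); last by rewrite !mul0r subr0 mul0r addr0.
rewrite !mul1r -!expr2.
have := cos2Dsin2 (dot z (x - a)); have := cos2Dsin2 (dot z' (x - a)).
have := one_sub_cos_le (dot z (x - a) - dot z' (x - a)).
have := dot_sqr_le (z - z') (x - a); rewrite dotBl cosB.
move: (cos (dot z _)) (sin (dot z _)) (cos (dot z' _)) (sin (dot z' _)) => c s c' s'.
move: ((_ - _) ^+ 2) (_ * sqr_enorm _) => D E *.
nra.
Qed.

(** For t > 0, p^2 - q^2 <= (p - q)^2 / (2 t) + t (p^2 + q^2). Summed over the
coefficients p, q of the waves at z and z', Bessel's inequality bounds the first
part by E / (2 t) and the second one by 2 t V; take t = X / (4 V), with X the
difference to be bounded. *)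
Lemma sum_fpower_dist_sqr a z z' : 0 < volume Om ->
  0 < \sum_(j < k) fpower (w j) z - \sum_(j < k) fpower (w j) z' ->
  (\sum_(j < k) fpower (w j) z - \sum_(j < k) fpower (w j) z') ^+ 2 <=
  4 * volume Om * (sqr_enorm (z - z') * \int[mu]_(x in Om) sqr_enorm (x - a)).
Proof.
move=> V0; set X := _ - _ => X0; set E := sqr_enorm _ * _.
pose p g z (j : 'I_k) := ip mu (w j) (wave g a z).
have fE y : \sum_(j < k) fpower (w j) y = \sum_(j < k) (p cos y j ^+ 2 + p sin y j ^+ 2).
  by apply: eq_bigr => j _; exact: fpower_wave.
have wB (j : 'I_k) f h : sqint mu f -> sqint mu h ->
    ip mu (w j) (fun x => f x - h x) = ip mu (w j) f - ip mu (w j) h.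
  by move=> sf sh; rewrite ipC (ipBl sf sh (sw (ltn_ord j))) !(ipC mu _ (w j)).
have dE : \sum_(j < k) ((p cos z j - p cos z' j) ^+ 2 + (p sin z j - p sin z' j) ^+ 2) <= E.
  apply: le_trans (wave_dist a z z').
  rewrite big_split; apply: lerD.
    apply: le_trans (bessel_on (sqintB (swc a z) (swc a z'))).
    by apply: ler_sum => j _; rewrite wB.
  apply: le_trans (bessel_on (sqintB (sws a z) (sws a z'))).
  by apply: ler_sum => j _; rewrite wB.
have ineq t : 0 < t -> X <= E / (2 * t) + 2 * t * volume Om.
  move=> t0; have pq (r q : R) : r ^+ 2 - q ^+ 2 <= (r - q) ^+ 2 / (2 * t) + t * (r ^+ 2 + q ^+ 2).
    rewrite -subr_ge0.
    have -> : (r - q) ^+ 2 / (2 * t) + t * (r ^+ 2 + q ^+ 2) - (r ^+ 2 - q ^+ 2) =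
        ((r - q) - t * (r + q)) ^+ 2 / (2 * t) + t / 2 * (r - q) ^+ 2.
      by field; exact: lt0r_neq0.
    have t0' := ltW t0.
    by apply: addr_ge0; [apply: divr_ge0|apply: mulr_ge0]; rewrite ?sqr_ge0// ?mulr_ge0// divr_ge0.
  apply: (@le_trans _ _ (\sum_(j < k)
     (((p cos z j - p cos z' j) ^+ 2 + (p sin z j - p sin z' j) ^+ 2) / (2 * t) +
      t * ((p cos z j ^+ 2 + p sin z j ^+ 2) + (p cos z' j ^+ 2 + p sin z' j ^+ 2))))).
    rewrite /X (fE z) (fE z') -sumrB; apply: ler_sum => j _.
    have := pq (p cos z j) (p cos z' j); have := pq (p sin z j) (p sin z' j).
    by rewrite mulrDl; lra.
  rewrite big_split/=; apply: lerD; first rewrite -mulr_suml.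
    by rewrite ler_wpM2r// invr_ge0 mulr_ge0// ltW.
  rewrite -mulr_sumr big_split/= -(fE z) -(fE z') [2 * t]mulrC -mulrA ler_pM2l//.
  have := sum_fpower_le z; have := sum_fpower_le z'; lra.
clearbody X E.
have t0 : 0 < X / (4 * volume Om) by rewrite divr_gt0// mulr_gt0.
have := ineq _ t0.
have -> : E / (2 * (X / (4 * volume Om))) = 2 * E * volume Om / X.
  by field; rewrite !lt0r_neq0.
have -> : 2 * (X / (4 * volume Om)) * volume Om = X / 2.
  by field; rewrite !lt0r_neq0.
move=> h; have := ler_wpM2r (ltW X0) h; rewrite mulrDl divfK ?lt0r_neq0//.
lra.
Qed.

(** The centre a is free in the previous bound, so that the infimum over a, the
moment of inertia, may be taken. *)
Lemma sum_fpower_lipschitz z z' : 0 < volume Om ->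
  \sum_(j < k) fpower (w j) z - \sum_(j < k) fpower (w j) z' <=
  2 * Num.sqrt (volume Om * moment_of_inertia Om) * enorm (z - z').
Proof.
move=> V0; set X := _ - _; set I := moment_of_inertia Om.
have [X0|X0] := leP X 0.
  by apply: le_trans X0 _; rewrite !mulr_ge0 ?sqrtr_ge0.
have h a := sum_fpower_dist_sqr a V0 X0.
have q0 : 0 < sqr_enorm (z - z').
  rewrite lt_neqAle sqr_enorm_ge0 andbT eq_sym; apply/eqP => q0.
  have := h 0; rewrite q0 mul0r mulr0 leNgt => /negP; apply.
  by rewrite exprn_gt0.
have hI : X ^+ 2 / (4 * volume Om * sqr_enorm (z - z')) <= I.
  apply: moment_of_inertia_lb => a; rewrite ler_pdivrMr ?mulr_gt0//.
  by apply: le_trans (h a) _; rewrite le_eqVlt; apply/orP; left; apply/eqP; ring.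
have I0 : 0 <= I by apply: le_trans hI; rewrite divr_ge0 ?sqr_ge0// ltW// !mulr_gt0.
have r0 : 0 <= 2 * Num.sqrt (volume Om * I) * enorm (z - z') by rewrite !mulr_ge0 ?sqrtr_ge0.
rewrite -(@ler_pXn2r _ 2 _ X) ?nnegrE ?(ltW X0)//.
rewrite !exprMn sqr_sqrtr; last by rewrite mulr_ge0// ltW.
rewrite sqr_enormE.
move: hI; rewrite ler_pdivrMr ?mulr_gt0// => /le_trans; apply.
by rewrite le_eqVlt; apply/orP; left; apply/eqP; ring.
Qed.

End spectral_density.

(** * The sum of the first eigenvalues *)

Lemma powR_root (R : realType) (a : R) (n : nat) : (0 < n)%N -> 0 < a ->
  0 < a `^ (n%:R^-1) /\ (a `^ (n%:R^-1)) ^+ n = a.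
Proof.
move=> n0 a0; split; first exact: powR_gt0.
by rewrite -powR_mulrn ?powR_ge0// -powRrM mulVf ?powRr1 ?ltW// pnatr_eq0 -lt0n.
Qed.

Section eigenvalue_sum.
Variables (R : realType) (n : nat) (Om : set 'rV[R]_n) (Gam : nat -> R) (k : nat).
Hypotheses (n_gt0 : (0 < n)%N) (domOm : is_domain Om) (bOm : bounded_set Om).
Hypotheses (hGam : clamped_plate_spectrum Om Gam) (k_gt0 : (0 < k)%N).
Local Notation mu := (lebesgue_rV R n).
Local Notation B := (unit_ball_volume R n).
Local Notation V := (volume Om).
Local Notation I := (moment_of_inertia Om).
Local Notation N := (n%:R : R).
Local Notation K := (k%:R : R).

Let oOm : open Om. Proof. by case: domOm. Qed.
Let mOm : measurable Om. Proof. exact: open_measurable_rV. Qed.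
Let N1 : 1 <= N. Proof. by rewrite ler1n. Qed.
Let K1 : 1 <= K. Proof. by rewrite ler1n. Qed.
Let B0 : 0 < B. Proof. exact: unit_ball_volume_gt0. Qed.

Lemma volume_gt0 : 0 < V.
Proof.
rewrite -lte_fin -volumeE//; apply: open_measure_gt0 => //.
by case: domOm.
Qed.
Let V0 := volume_gt0.

(** Among the domains of given volume the ball has the least moment of inertia. *)
Lemma inertia_ball_lb r : 0 <= r -> B * r ^+ n = V -> N / (N + 2) * V * r ^+ 2 <= I.
Proof. by move=> r0 Br; apply: moment_of_inertia_lb => a; exact: inertia_lb. Qed.

Lemma inertia_gt0 : 0 < I.
Proof.
have [r0 rn] := powR_root n_gt0 (divr_gt0 V0 B0).
apply: lt_le_trans (inertia_ball_lb (ltW r0) _); last by rewrite rn mulrC divfK ?lt0r_neq0.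
have N0 : 0 < N by have := N1; lra.
have N2 : 0 < N + 2 by lra.
by rewrite mulr_gt0 ?exprn_gt0// mulr_gt0// divr_gt0.
Qed.
Let I0 := inertia_gt0.

(** Smallness of the parameter e of the gain. With B r^n = V, the ball of radius r
bounds I from below by n / (n + 2) V r^2; and (r rho)^n = (2 pi)^n k / B^2 is at
least (pi / 2)^n, as B <= 2^n. *)
Lemma inertia_radius_le rho : 0 < rho -> V * B * rho ^+ n = (2 * pi) ^+ n * K ->
  V / I / (4 * rho ^+ 2) <= 3^-1.
Proof.
have N1' := N1; have K1' := K1; move=> rho0 hrho; have [] := powR_root n_gt0 (divr_gt0 V0 B0).
set r := _ `^ _ => r0 rn.
have Ir := inertia_ball_lb (ltW r0); rewrite rn mulrC divfK ?lt0r_neq0// in Ir.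
have {}Ir := Ir erefl.
(* pi / 2 >= 3 / 2 *)
have rrho : 3 / 2 <= r * rho.
  have pi3 := @pi_ge3 R.
  rewrite -(@ler_pXn2r _ n)// ?nnegrE ?mulr_ge0 ?(ltW r0) ?(ltW rho0)//.
  have e : (r * rho) ^+ n * (B * B) = (2 * pi) ^+ n * K.
    by rewrite exprMn rn -hrho; field; rewrite lt0r_neq0.
  have BB : B * B <= 2 ^+ n * 2 ^+ n by have B0' := ltW B0; apply: ler_pM => //; exact: unit_ball_volume_le.
  have BB0 : 0 < B * B by rewrite mulr_gt0.
  rewrite -(ler_pM2r BB0) e.
  apply: (@le_trans _ _ ((3 / 2) ^+ n * (2 ^+ n * 2 ^+ n))).
    by rewrite ler_wpM2l// exprn_ge0.
  rewrite -!exprMn; apply: (@le_trans _ _ ((2 * pi) ^+ n * 1)); last first.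
    by rewrite ler_wpM2l// exprn_ge0//; lra.
  by rewrite mulr1 lerXn2r ?nnegrE//; lra.
have rr : 9 / 4 <= r ^+ 2 * rho ^+ 2.
  by rewrite -exprMn; move: (r * rho) rrho => y hy; nra.
rewrite ler_pdivrMr; last by rewrite mulr_gt0// exprn_gt0.
rewrite ler_pdivrMr//.
have h : 4 * rho ^+ 2 * (N / (N + 2) * V * r ^+ 2) <= 4 * rho ^+ 2 * I.
  by rewrite ler_wpM2l// mulr_ge0// exprn_ge0// ltW.
suff : 3 * V <= 4 * rho ^+ 2 * (N / (N + 2) * V * r ^+ 2) by lra.
have -> : 4 * rho ^+ 2 * (N / (N + 2) * V * r ^+ 2) =
  (4 * (r ^+ 2 * rho ^+ 2)) * (N / (N + 2)) * V by ring.
rewrite ler_pM2r//.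
have N3 : 3^-1 <= N / (N + 2) by rewrite ler_pdivlMr; lra.
apply: (@le_trans _ _ (9 * 3^-1)); first lra.
by apply: ler_pM => //; lra.
Qed.

(** The density F of the eigenfunctions has mass at least k, fourth moment at most
the eigenvalue sum, height at most M and slope at most L. The term e^2 / 3 of the
gain becomes the middle term, e^4 / 36 the last one, by e^2 = V / (4 I rho^2). *)
Lemma eigenvalue_sum_lb rho : 0 < rho -> V * B * rho ^+ n = (2 * pi) ^+ n * K ->
  rho ^+ 4 / (N + 4) * N + rho ^+ 2 * (V / I) / (12 * (N + 4)) +
    (V / I) ^+ 2 / (576 * (N + 4)) <= K^-1 * \sum_(j < k) Gam j.
Proof.
move=> rho0 hrho; have N1' := N1; have K1' := K1.
have [w [ew on]] := orthonormal_eigenfuns oOm hGam k.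
have sw j : (j < k)%N -> sqint mu (w j) by move=> jk; exact: eigenfun_sqint (ew j jk).
have w0 j : (j < k)%N -> forall x, ~ Om x -> w j x = 0.
  by move=> jk; have [g []] := ew j jk.
have wI j : (j < k)%N -> mu.-integrable setT (EFin \o w j).
  by move=> jk; exact: (supported_integrable oOm bOm (sw j jk) (w0 j jk)).
have pi3 := @pi_ge3 R.
pose A := (2 * pi : R) ^+ n; have A0 : 0 < A by rewrite exprn_gt0//; lra.
have Ai0 : 0 < A^-1 by rewrite invr_gt0.
pose S z := \sum_(j < k) fpower (w j) z.
have mf (j : 'I_k) : measurable_fun [set: 'rV[R]_n] (fpower (w j)).
  by apply: measurable_fpower; exact: wI.
have mS : measurable_fun [set: 'rV[R]_n] S by exact: measurable_sum.
have S0 z : 0 <= S z by apply: sumr_ge0 => j _; exact: fpower_ge0.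
pose F z := A^-1 * S z.
pose q := Num.sqrt (V / I); pose s0 := Num.sqrt (V * I).
have q0 : 0 < q by rewrite sqrtr_gt0 divr_gt0.
have q2 : q ^+ 2 = V / I by rewrite sqr_sqrtr// divr_ge0 ?ltW.
have s00 : 0 < s0 by rewrite sqrtr_gt0 mulr_gt0.
have sq : s0 * q = V.
  rewrite /s0 /q -sqrtrM; last by rewrite mulr_ge0 ?ltW.
  rewrite (_ : V * I * (V / I) = V ^+ 2); last by field; rewrite lt0r_neq0.
  by rewrite sqrtr_sqr ger0_norm// ltW.
(* e = (M / L) / rho *)
pose e := q / (2 * rho).
have e0 : 0 < e by rewrite divr_gt0// mulr_gt0.
have e2 : e ^+ 2 = V / I / (4 * rho ^+ 2).
  by rewrite -q2 /e; field; rewrite lt0r_neq0.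
have e3 : e ^+ 2 <= 3^-1 by rewrite e2; exact: inertia_radius_le.
pose s := 1 + 2 / 3 * e.
have s1 : 1 <= s by rewrite lerDl mulr_ge0// ltW.
(* The fourth root prescribed by the fourth moment bound. *)
pose x := Num.sqrt (Num.sqrt (2 / (s ^+ 4 + 1))).
have s41 : 0 < s ^+ 4 + 1 by rewrite ltr_wpDl// exprn_ge0//; lra.
have hx : x ^+ 4 * (s ^+ 4 + 1) = 2.
  rewrite (exprM _ 2 2) !sqr_sqrtr ?sqrtr_ge0//; last by rewrite divr_ge0// ltW.
  by rewrite divfK// lt0r_neq0.
have x0 : 0 <= x by exact: sqrtr_ge0.
pose M := V * A^-1; pose L := 2 * s0 * A^-1.
have M0 : 0 < M by rewrite mulr_gt0.
have L0 : 0 <= L by rewrite !mulr_ge0// ltW.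
have Lse : L * (s - 1) * rho = 2 / 3 * M.
  rewrite /L /M /s /e -sq; field; rewrite !lt0r_neq0//=.
have Fsum : (\int[mu]_z (S z)%:E = \sum_(j < k) \int[mu]_z (fpower (w j) z)%:E)%E.
  by apply: integral_EFin_sum => // j z; exact: fpower_ge0.
have hF : (K%:E <= \int[mu]_z (F z)%:E)%E.
  rewrite integral_EFinZ//; last exact: ltW.
  rewrite Fsum; apply: (@le_trans _ _ (A^-1%:E * \sum_(j < k) A%:E)%E).
    rewrite sumEFin -EFinM lee_fin sumr_const card_ord -[A *+ k]mulr_natr mulKf//.
    exact: lt0r_neq0.
  rewrite lee_wpmul2l ?lee_fin ?(ltW Ai0)//; apply: lee_sum => j _.
  have := eigenfun_plancherel oOm bOm (ew j (ltn_ord j)).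
  by rewrite on// eqxx mulr1.
have hG : (\int[mu]_z (enorm z ^+ 4 * F z)%:E <= (\sum_(j < k) Gam j)%:E)%E.
  have -> : (\int[mu]_z (enorm z ^+ 4 * F z)%:E =
     A^-1%:E * \sum_(j < k) \int[mu]_z (enorm z ^+ 4 * fpower (w j) z)%:E)%E.
    have me4 (j : 'I_k) : measurable_fun [set: 'rV[R]_n] (fun z => enorm z ^+ 4 * fpower (w j) z).
      by apply: measurable_funM => //; apply: measurable_funX; exact: measurable_enorm.
    have e40 (j : 'I_k) z : 0 <= enorm z ^+ 4 * fpower (w j) z.
      by rewrite mulr_ge0 ?fpower_ge0// exprn_ge0// enorm_ge0.
    rewrite -integral_EFin_sum// -integral_EFinZ//.
    - by apply: eq_integral => z _; rewrite /F /S mulrCA !mulr_sumr.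
    - exact: ltW.
    - exact: measurable_sum.
    - by move=> z; apply: sumr_ge0 => j _.
  apply: (@le_trans _ _ (A^-1%:E * \sum_(j < k) (A * Gam j)%:E)%E).
    rewrite lee_wpmul2l ?lee_fin ?(ltW Ai0)//; apply: lee_sum => j _.
    have := eigenfun_quartic_le oOm bOm (ew j (ltn_ord j)).
    by rewrite on// eqxx mulr1.
  by rewrite sumEFin -EFinM lee_fin -mulr_sumr mulKf// lt0r_neq0.
have := @quartic_moment_lb R n F M L K rho s x.
have mF : measurable_fun [set: 'rV[R]_n] F by exact: measurable_funM.
have FM z : 0 <= F z <= M.
  rewrite mulr_ge0 ?(ltW Ai0)//= /F mulrC /M ler_pM2r//.
  exact: (sum_fpower_le oOm bOm sw w0 on).
have Mk : M * B * rho ^+ n = K.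
  have -> : M * B * rho ^+ n = V * B * rho ^+ n * A^-1 by rewrite /M; ring.
  by rewrite hrho mulrAC mulfV ?mul1r// lt0r_neq0.
have Flip z : F z - L * (s - 1) * enorm z <= F (s *: z).
  rewrite lerBlDr -lerBlDl.
  have := sum_fpower_lipschitz oOm bOm sw w0 on z (s *: z) V0.
  have -> : enorm (z - s *: z) = (s - 1) * enorm z.
    have -> : z - s *: z = (1 - s) *: z by rewrite scalerBl scale1r.
    rewrite -enormZ ?subr_ge0// /enorm !sqr_enormZ; congr (Num.sqrt (_ * _)); ring.
  rewrite -/(S z) -/(S (s *: z)) -/s0 => h.
  have := ler_wpM2l (ltW Ai0) h; rewrite /F /L; lra.
move=> /(_ mF FM hF M0 rho0 Mk s1 L0 Flip x0 hx); rewrite Lse.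
have -> : 2 / 3 * M / M = 2 / 3 by rewrite mulfK// lt0r_neq0.
move=> /(_ _); have M23 : 2 / 3 * M <= M by lra.
move=> /(_ M23) /le_trans/(_ hG); rewrite lee_fin => main.
have gain := @gain_lb R e x n n_gt0 (ltW e0) e3 x0 hx; rewrite -/s in gain.
have K0 : 0 < K by lra.
rewrite ler_pdivlMl//; apply: le_trans main.
have -> : K * (rho ^+ 4 / (N + 4) * N + rho ^+ 2 * (V / I) / (12 * (N + 4)) +
    (V / I) ^+ 2 / (576 * (N + 4))) =
  K * rho ^+ 4 / (N + 4) * (N + (e ^+ 2 / 3 + e ^+ 4 / 36)).
  rewrite (exprM e 2 2) e2; field; rewrite !lt0r_neq0//; lra.
rewrite ler_wpM2l//; last by rewrite lerD2l; apply: le_trans gain _; lra.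
by rewrite !mulr_ge0 ?invr_ge0 ?exprn_ge0 ?(ltW rho0)//; lra.
Qed.

End eigenvalue_sum.

(* 27 * 1024 = 27648; large ring numerals are unary. *)
Theorem mainTheorem1 (R : realType) (n : nat) (n_gt0 : (0 < n)%N)
    (Om : set 'rV[R]_n) (domOm : is_domain Om) (bOm : bounded_set Om)
    (Gam : nat -> R) (hGam : clamped_plate_spectrum Om Gam)
    (k : nat) (k_gt0 : (1 <= k)%N) :
  let N : R := n%:R in
  let K : R := k%:R in
  let V := volume Om in
  let B := unit_ball_volume R n in
  let I := moment_of_inertia Om in
  K^-1 * \sum_(j < k) Gam j >=
    N / (N + 4) * (16 * pi ^+ 4 / (B * V) `^ (4 / N)) * K `^ (4 / N)
    + ((N + 2) / (12 * N * (N + 4)) - 1 / (1152 * N ^+ 2 * (N + 4)))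
      * (V / I) * (N / (N + 2)) * (4 * pi ^+ 2 / (B * V) `^ (2 / N))
      * K `^ (2 / N)
    + (1 / (576 * N * (N + 4)) - 1 / (27 * 1024 * N ^+ 2 * (N + 2) * (N + 4)))
      * (V / I) ^+ 2.
Proof.
cbv zeta; set N := (n%:R : R); set K := (k%:R : R).
set V := volume Om; set B := unit_ball_volume R n; set I := moment_of_inertia Om.
have oOm : open Om by case: domOm.
have V0 : 0 < V by exact: volume_gt0.
have I0 : 0 < I by exact: inertia_gt0.
have B0 : 0 < B by exact: unit_ball_volume_gt0.
have BV0 : 0 < B * V by exact: mulr_gt0.
have N1 : 1 <= N by rewrite ler1n.
have N0 : 0 < N by lra.
have K1 : 1 <= K by rewrite ler1n.
have K0 : 0 < K by lra.
have pi0 := pi_gt0 R.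
have [r0 rn] := powR_root n_gt0 BV0; have [t0 tn] := powR_root n_gt0 K0.
have pw (a : R) (m : nat) : 0 <= a -> a `^ (m%:R / N) = (a `^ N^-1) ^+ m.
  by move=> a0; rewrite mulrC powRrM powR_mulrn// powR_ge0.
(* The radius of the extremal density, for which M B rho^n = k. *)
pose rho := 2 * pi * K `^ N^-1 / (B * V) `^ N^-1.
have rho0 : 0 < rho by rewrite divr_gt0// !mulr_gt0.
have hrho : V * B * rho ^+ n = (2 * pi) ^+ n * K.
  rewrite /rho expr_div_n [in LHS]exprMn rn tn [V * B]mulrC [LHS]mulrC divfK//.
  by rewrite lt0r_neq0.
have := eigenvalue_sum_lb n_gt0 domOm bOm hGam k_gt0 rho0 hrho.
rewrite -/N -/K -/V -/B -/I; apply: le_trans.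
rewrite (pw _ 4%N (ltW BV0)) (pw _ 2%N (ltW BV0)) (pw _ 4%N (ltW K0)) (pw _ 2%N (ltW K0)).
have -> : N / (N + 4) * (16 * pi ^+ 4 / ((B * V) `^ N^-1) ^+ 4) * (K `^ N^-1) ^+ 4 =
    rho ^+ 4 / (N + 4) * N.
  rewrite /rho; move: ((B * V) `^ N^-1) (K `^ N^-1) r0 t0 => r t r0 t0.
  move: (@pi R) => p; field; apply/andP; split; apply: lt0r_neq0 => //; lra.
have W0 : 0 < V / I by exact: divr_gt0.
have N2 : 0 < N + 2 by lra.
have N4 : 0 < N + 4 by lra.
rewrite -2!addrA lerD2l; apply: lerD.
  set c := 1 / (1152 * _ * _).
  have c0 : 0 <= c.
    apply: divr_ge0; first exact: ler01.
    by apply: mulr_ge0; [apply: mulr_ge0; [exact: ler0n|exact: sqr_ge0]|exact: ltW].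
  clearbody c.
  have -> : ((N + 2) / (12 * N * (N + 4)) - c) * (V / I) * (N / (N + 2)) *
      (4 * pi ^+ 2 / (B * V) `^ N^-1 ^+ 2) * K `^ N^-1 ^+ 2 =
      rho ^+ 2 * (V / I) / (12 * (N + 4)) - c * (V / I) * (N / (N + 2)) * rho ^+ 2.
    rewrite /rho; move: ((B * V) `^ N^-1) (K `^ N^-1) r0 t0 (V / I) => r t r0 t0 W.
    move: (@pi R) => p; field; rewrite !lt0r_neq0//.
  rewrite gerBl; apply: mulr_ge0; last exact: sqr_ge0.
  apply: mulr_ge0; last exact/ltW/divr_gt0.
  by apply: mulr_ge0 => //; exact: ltW.
rewrite [leRHS]mulrC; apply: ler_wpM2r; first exact: sqr_ge0.
set c := 1 / (27 * 1024 * _ * _ * _).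
have c0 : 0 <= c.
  apply: divr_ge0; first exact: ler01.
  apply: mulr_ge0; last exact: ltW.
  apply: mulr_ge0; last exact: ltW.
  by apply: mulr_ge0; [apply: mulr_ge0; exact: ler0n|exact: sqr_ge0].
clearbody c.
have h576 : 0 < 576 :> R by rewrite ltr0n.
move: (576 : R) h576 => a a0.
apply: (@le_trans _ _ (1 / (a * N * (N + 4)))); first by rewrite gerBl.
rewrite mul1r lef_pV2 ?posrE; last 2 first.
- by rewrite mulr_gt0// mulr_gt0.
- by rewrite mulr_gt0.
by rewrite ler_pM2r// ler_peMr// ltW.
Qed.
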